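(* Let $M\cong G/K$ be a compact homogeneous manifold, let $2\leq p_1<\infty$, $1\leq p_2<\infty$, and let $F$ be the Fourier integral operator $$F\varphi(x)=\sum_{[\pi]\in\widehat{G}_0}d_{\pi}\,\mathrm{Tr}\big(\Phi(x,\pi)a(x,\pi)\widehat{\varphi}(\pi)\big),\qquad \varphi\in C^{\infty}(M),$$ with phase function $\Phi$ and symbol $a$. Suppose that $$\Vert\Phi^{-1}\Vert_\infty:=\sup_{(x,[\pi])\in M\times\widehat G_0}\Vert\Phi(x,\pi)^{-1}\Vert_{op}<\infty.$$ If $F:L^{p_1}(M)\rightarrow L^{p_2}(M)$ is nuclear, then $a(x,\pi)\in\ell^{p_1}_\pi L^{p_2}_x(M\times\widehat G_0)$, that is, $$\left(\int_{M}\left(\sum_{[\pi]\in\widehat{G}_0}d_{\pi}\,k_{\pi}^{p_1\left(\frac{1}{p_1}-\frac{1}{2}\right)}\Vert a(x,\pi)\Vert^{p_1}_{\mathrm{HS}}\right)^{\frac{p_2}{p_1}}dx\right)^{\frac{1}{p_2}}<\infty.$$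
   Context: $G$ is a compact Lie group, $K$ a closed subgroup, $M=G/K$ with its normalized $G$-invariant measure. $\widehat G$ is the unitary dual of $G$, and $\widehat G_0\subset\widehat G$ is the set of (classes of) irreducible unitary representations $\pi$ of class I with respect to $K$, i.e. such that there is a nonzero vector $v$ with $\pi(h)v=v$ for all $h\in K$. $d_\pi$ is the dimension of $\pi$, $B_\pi$ is the space of $K$-invariant vectors of $\pi$, and $k_\pi=\dim B_\pi$. Each $\pi$ is realized as a unitary matrix representation in an orthonormal basis whose first $k_\pi$ vectors span $B_\pi$. For a function $f$ on $M$, $\widehat f(\pi)=\int_G\dot f(x)\pi(x)^*\,dx\in\mathbb{C}^{d_\pi\times d_\pi}$ is the Fourier transform of its lifting $\dot f(x):=f(xK)$ to $G$ (normalized Haar measure). The phase function is $\Phi:M\times\widehat G_0\to\bigcup_{[\pi]}\mathrm{GL}(d_\pi)$ with $\Phi(x,\pi)\in\mathrm{GL}(d_\pi)$, and the symbol is a (distribution) $a$ on $M\times\widehat G_0$ with $a(x,\pi)\in\mathbb{C}^{d_\pi\times d_\pi}$, such that only the upper-left $k_\pi\times k_\pi$ block of $a(x,\pi)$ may be nonzero, i.e. $a(x,\pi)_{ij}=0$ whenever $i>k_\pi$ or $j>k_\pi$. $\Vert\cdot\Vert_{\mathrm{HS}}$ is the Hilbert-Schmidt norm and $\Vert\cdot\Vert_{op}$ the operator norm of matrices. For Banach spaces $E_1,E_2$, a densely defined linear operator $T:D(T)\subset E_1\to E_2$ is said to be (to extend to) a nuclear operator from $E_1$ into $E_2$ if there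 exist sequences $(e_n')$ in the dual $E_1'$ and $(y_n)$ in $E_2$ such that $Tf=\sum_{n} e_n'(f)y_n$ for all $f\in D(T)$ and $\sum_{n}\Vert e_n'\Vert_{E_1'}\Vert y_n\Vert_{E_2}<\infty$. Here $D(F)=C^\infty(M)\subset L^{p_1}(M)$. *)

(* Defs.v *)
From HB Require Import structures.
From mathcomp Require Import all_boot all_order all_algebra finmap.
From mathcomp Require Import spectral complex.
From mathcomp Require Import all_classical all_reals all_analysis.
From mathcomp Require summability.

Set Implicit Arguments.
Unset Strict Implicit.
Unset Printing Implicit Defensive.

Import Order.TTheory GRing.Theory Num.Theory.
Import numFieldNormedType.Exports.
Import ComplexField.Normc.

Local Open Scope classical_set_scope.
Local Open Scope ring_scope.
Local Open Scope sesquilinear_scope.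
Local Open Scope complex_scope.

Section Smooth.
Context {R : realType}.

(* Used with [U] open only, so that the values of [f] outside [U] are
   irrelevant. *)
Fixpoint Ck (n : nat) (W : normedModType R) (k : nat) (U : set 'rV[R]_n)
    (f : 'rV[R]_n -> W) : Prop :=
  (forall x, U x -> {for x, continuous f}) /\
  (if k is k'.+1 then
     forall v : 'rV[R]_n,
       (forall x, U x -> derivable f x v) /\ Ck k' U (fun x => 'D_v f x)
   else True).

Definition smooth_on (n : nat) (W : normedModType R) (U : set 'rV[R]_n)
    (f : 'rV[R]_n -> W) : Prop :=
  forall k, Ck k U f.

(* [cmap] and [cinv] are total functions, meaningful on the open sets [cdom]
   and [ccod] only. *)
Record chart (n : nat) (X : topologicalType) := Chart {
  cdom : set X;
  ccod : set 'rV[R]_n;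
  cmap : X -> 'rV[R]_n;
  cinv : 'rV[R]_n -> X;
  cdom_open : open cdom;
  ccod_open : open ccod;
  cmap_in : forall x, cdom x -> ccod (cmap x);
  cinv_in : forall u, ccod u -> cdom (cinv u);
  cmapK : forall x, cdom x -> cinv (cmap x) = x;
  cinvK : forall u, ccod u -> cmap (cinv u) = u;
  cmap_cont : forall x, cdom x -> {for x, continuous cmap};
  cinv_cont : forall u, ccod u -> {for u, continuous cinv} }.

Record manifold (n : nat) (X : topologicalType) := Manifold {
  mfd_hausdorff : hausdorff_space X;
  mfd_countable : @second_countable X;
  atlas : set (chart n X);
  atlas_cover : forall x, exists2 c, atlas c & cdom c x;
  atlas_compat : forall c d, atlas c -> atlas d ->
    smooth_on (ccod c `&` cinv c @^-1` cdom d) (cmap d \o cinv c) }.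

Definition smooth_map n m (X Y : topologicalType) (A : manifold n X)
    (B : manifold m Y) (f : X -> Y) : Prop :=
  continuous f /\
  forall c d, atlas A c -> atlas B d ->
    smooth_on [set u | ccod c u /\ cdom d (f (cinv c u))]
              (fun u => cmap d (f (cinv c u))).

(* Smoothness on the product manifold X x Y, in the product charts
   X x Y -> R^(n + m). *)
Definition smooth_map2 n m p (X Y Z : topologicalType) (A : manifold n X)
    (B : manifold m Y) (C : manifold p Z) (f : X -> Y -> Z) : Prop :=
  continuous (fun z : X * Y => f z.1 z.2) /\
  forall c d e, atlas A c -> atlas B d -> atlas C e ->
    let g (u : 'rV[R]_(n + m)) := f (cinv c (lsubmx u)) (cinv d (rsubmx u)) in
    smooth_on [set u | [/\ ccod c (lsubmx u), ccod d (rsubmx u)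
                         & cdom e (g u)]]
              (fun u => cmap e (g u)).

Definition smooth_real n (X : topologicalType) (A : manifold n X)
    (f : X -> R) : Prop :=
  forall c, atlas A c ->
    @smooth_on n R^o (ccod c) (fun u => f (cinv c u)).

Definition smooth_complex n (X : topologicalType) (A : manifold n X)
    (f : X -> R[i]) : Prop :=
  smooth_real A (fun x => complex.Re (f x)) /\
  smooth_real A (fun x => complex.Im (f x)).

End Smooth.
Arguments chart : clear implicits.
Arguments manifold : clear implicits.

(* No compatibility between the group law and the topology is built in here:
   it is part of [lie_group]. *)
#[short(type="ptopGroupType")]
HB.structure Definition PTopGroup := {G of Group G & PointedTopological G}.

Record lie_group (R : realType) (n : nat) (G : ptopGroupType) := LieGroup {
  lie_mfd : manifold R n G;
  lie_mul : smooth_map2 lie_mfd lie_mfd lie_mfd (fun x y : G => (x * y)%g);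
  lie_inv : smooth_map lie_mfd lie_mfd (fun x : G => (x^-1)%g) }.

Definition is_subgroup (G : ptopGroupType) (K : set G) : Prop :=
  [/\ K 1%g, forall x y, K x -> K y -> K (x * y)%g
    & forall x, K x -> K (x^-1)%g].

(* A smooth manifold M with a smooth transitive action of the Lie group G for
   which K is the stabilizer of the base point: g K |-> g . base identifies
   G/K with M. *)
Record homogeneous (R : realType) (n m : nat) (G : ptopGroupType)
    (LG : lie_group R n G) (K : set G) (M : ptopologicalType) := Homogeneous {
  hom_mfd : manifold R m M;
  act : G -> M -> M;
  base : M;
  act1 : forall x, act 1%g x = x;
  actM : forall g h x, act (g * h)%g x = act g (act h x);
  act_smooth : smooth_map2 (lie_mfd LG) hom_mfd hom_mfd act;
  act_trans : forall x y, exists g, act g x = y;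
  stab_base : forall g, K g <-> act g base = base }.

Notation borel T := (g_sigma_algebraType (@open T)).

Definition is_haar (R : realType) (G : ptopGroupType)
    (mu : probability (borel G) R) : Prop :=
  forall (g : G) (A : set (borel G)), measurable A ->
    mu ((fun x : G => (g * x)%g) @^-1` A) = mu A.

Definition is_invariant (R : realType) (G : ptopGroupType)
    (M : ptopologicalType) (act : G -> M -> M)
    (nu : probability (borel M) R) : Prop :=
  forall (g : G) (A : set (borel M)), measurable A ->
    nu (act g @^-1` A) = nu A.

Section Representations.
Context {R : realType} {G : ptopGroupType}.
Local Notation C := R[i].

Definition irreducible_rep (d : nat) (pi : G -> 'M[C]_d) : Prop :=
  (0 < d)%N /\
  (* The row space of W stands for a subspace of C^d, whose vectors are
     transposed; (pi g)^T acts on these by right multiplication. *)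
  forall W : 'M[C]_d, (forall g, stablemx W (pi g)^T) -> W = 0 \/ row_full W.

Definition unitary_irrep (d : nat) (pi : G -> 'M[C]_d) : Prop :=
  [/\ pi 1%g = 1%:M,
      forall x y, pi (x * y)%g = pi x *m pi y,
      forall x, pi x \is unitarymx,
      forall i j, continuous (fun x => pi x i j : C^o)
    & irreducible_rep pi].

Definition equiv_rep (d d' : nat) (pi : G -> 'M[C]_d) (rho : G -> 'M[C]_d') :
    Prop :=
  exists T : 'M[C]_(d', d),
    [/\ T \is unitarymx, T^t* \is unitarymx
      & forall x, T *m pi x = rho x *m T].

Definition invariant_vector (K : set G) (d : nat) (pi : G -> 'M[C]_d)
    (v : 'cV[C]_d) : Prop :=
  forall h, K h -> pi h *m v = v.

Definition class_one (K : set G) (d : nat) (pi : G -> 'M[C]_d) : Prop :=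
  exists2 v, v != 0 & invariant_vector K pi v.

(* A system of representatives, indexed by I, of the class-I part of the
   unitary dual. Irreducible unitary representations of a compact group are
   finite-dimensional, hence the matrices. *)
Record class_one_dual (K : set G) (I : choiceType) := ClassOneDual {
  rdim : I -> nat;
  rep : forall i, G -> 'M[C]_(rdim i);
  rep_irr : forall i, unitary_irrep (rep i);
  rep_class_one : forall i, class_one K (rep i);
  rep_inj : forall i j, equiv_rep (rep i) (rep j) -> i = j;
  rep_surj : forall d (rho : G -> 'M[C]_d),
    unitary_irrep rho -> class_one K rho -> exists i, equiv_rep (rep i) rho;
  (* [kdim] is dim B_pi: by [kdimP] the first kdim basis vectors span B_pi. *)
  kdim : I -> nat;
  kdim_le : forall i, (kdim i <= rdim i)%N;
  kdimP : forall i (v : 'cV[C]_(rdim i)),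
    invariant_vector K (rep i) v <->
    (forall j : 'I_(rdim i), (kdim i <= j)%N -> v j 0 = 0) }.

End Representations.
Arguments class_one_dual R {G} K I.

Section Norms.
Context {R : realType}.
Local Notation C := R[i].

Definition hsnorm (m n : nat) (A : 'M[C]_(m, n)) : R :=
  Num.sqrt (\sum_i \sum_j normc (A i j) ^+ 2).

(* On column vectors [hsnorm] is the Euclidean norm. *)
Definition opnorm (d : nat) (A : 'M[C]_d) : R :=
  sup [set hsnorm (A *m v) | v in [set v : 'cV[C]_d | hsnorm v <= 1]].

End Norms.

Section Lebesgue.
Context {R : realType} {dsp : measure_display} {T : measurableType dsp}.
Variable mu : {measure set T -> \bar R}.
Local Notation C := R[i].

Definition Cmeasurable (f : T -> C) : Prop :=
  measurable_fun setT (fun x => complex.Re (f x)) /\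
  measurable_fun setT (fun x => complex.Im (f x)).

Definition Cintegral (f : T -> C) : C :=
  (\int[mu]_x complex.Re (f x))%R +i* (\int[mu]_x complex.Im (f x))%R.

Definition Lpnorm (p : R) (f : T -> C) : \bar R :=
  Lnorm mu p%:E (fun x => (normc (f x))%:E).

(* The elements of L^p are handled as functions, not as classes modulo a.e.
   equality. *)
Definition Lp (p : R) : set (T -> C) :=
  [set f | Cmeasurable f /\ (Lpnorm p f < +oo)%E].

Definition dual_norm (p : R) (e : (T -> C) -> C) : \bar R :=
  ereal_sup [set (normc (e f))%:E
            | f in [set f | Lp p f /\ (Lpnorm p f <= 1)%E]].

(* Bounded linear functionals on L^p; boundedness makes them constant on
   classes modulo a.e. equality. *)
Definition Lp_dual (p : R) (e : (T -> C) -> C) : Prop :=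
  (forall (c : C) f g, Lp p f -> Lp p g ->
     e (fun x => c * f x + g x) = c * e f + e g) /\
  (dual_norm p e < +oo)%E.

Definition nuclear (p1 p2 : R) (D : set (T -> C))
    (F : (T -> C) -> (T -> C)) : Prop :=
  (forall f, D f -> Lp p2 (F f)) /\
  exists (e : nat -> (T -> C) -> C) (y : nat -> T -> C),
    [/\ forall n, Lp_dual p1 (e n),
        forall n, Lp p2 (y n),
        forall f, D f ->
          (fun N : nat => Lpnorm p2
             (fun x => F f x - \sum_(0 <= n < N) e n f * y n x)) @ \oo
          --> 0%E
      & (\sum_(0 <= n <oo) (dual_norm p1 (e n) * Lpnorm p2 (y n)) < +oo)%E].

End Lebesgue.

Section FIO.
Context {R : realType} {n m : nat} {G : ptopGroupType} {LG : lie_group R n G}.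
Context {K : set G} {M : ptopologicalType} {I : choiceType}.
Variables (H : homogeneous m LG K M) (mu : probability (borel G) R)
  (nu : probability (borel M) R) (Gh : class_one_dual R K I).
Local Notation C := R[i].

Definition lifting (f : M -> C) (x : G) : C := f (act H x (base H)).

Definition fourier (f : M -> C) (i : I) : 'M[C]_(rdim Gh i) :=
  \matrix_(p, q)
    Cintegral mu (fun x : borel G => lifting f x * ((rep Gh i x)^t*) p q).

Definition is_phase (Phi : M -> forall i : I, 'M[C]_(rdim Gh i)) : Prop :=
  forall x i, Phi x i \in unitmx.

Definition is_symbol (a : M -> forall i : I, 'M[C]_(rdim Gh i)) : Prop :=
  (forall i p q, Cmeasurable (fun x : borel M => a x i p q)) /\
  (forall x i (p q : 'I_(rdim Gh i)),
     (kdim Gh i <= p)%N || (kdim Gh i <= q)%N -> a x i p q = 0).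

(* The series over the dual, which carries no order, converges along the finite
   subsets of I, for almost all x. *)
Definition is_fio (Phi a : M -> forall i : I, 'M[C]_(rdim Gh i))
    (F : (M -> C) -> (M -> C)) : Prop :=
  forall phi, smooth_complex (hom_mfd H) phi ->
    {ae nu, forall x : borel M,
      summability.partial_sum
        (fun i => (rdim Gh i)%:R * \tr (Phi x i *m a x i *m fourier phi i))
        @ summability.totally --> (F phi x : C^o)}.

Definition inv_phase_norm (Phi : M -> forall i : I, 'M[C]_(rdim Gh i)) :
    \bar R :=
  ereal_sup (range (fun z : M * I => (opnorm (invmx (Phi z.1 z.2)))%:E)).

Definition symbol_norm (p1 p2 : R)
    (a : M -> forall i : I, 'M[C]_(rdim Gh i)) : \bar R :=
  ((\int[nu]_(x in [set: borel M])
      (\esum_(i in [set: I])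
         ((rdim Gh i)%:R * (kdim Gh i)%:R `^ (p1 * (p1^-1 - 2^-1))
          * hsnorm (a x i) `^ p1)%:E) `^ (p2 / p1)) `^ p2^-1)%E.

End FIO.

(* Main.v *)
(* For s < k_pi the matrix coefficient g |-> pi(g)_{rs} descends to a smooth
   function phi^pi_{rs} on M = G/K, and by Schur orthogonality F phi^pi_{rs}(x) is
   the (r,s) entry of Phi(x,pi) a(x,pi) for almost all x. If F is nuclear with
   data (e_n, y_n), then for almost all x the entries of Phi(x,pi) a(x,pi) are
   therefore the values on the phi^pi_{rs} of the functional
   e^x = sum_n y_n(x) e_n on L^{p1}, whose norm is at most
   Y(x) = sum_n |e_n| |y_n(x)|. The dual Hausdorff-Young inequality (p1 >= 2)
     sum_pi d_pi k_pi (|(e^x(phi^pi_{rs}))_{rs}|_HS / sqrt k_pi)^{p1} <= C |e^x|^{p1}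
   bounds the inner sum of the symbol norm by a multiple of Y(x)^{p1}, the inverse
   of Phi costing a constant factor, and Y is in L^{p2} by Minkowski's inequality. *)

Require Import Defs.
From HB Require Import structures.
From mathcomp Require Import all_boot all_order all_algebra finmap spectral complex.
From mathcomp Require Import all_classical all_reals all_analysis.
From mathcomp Require Import measurable_realfun ring lra.
From mathcomp Require summability.
Import Order.TTheory GRing.Theory Num.Theory.
Import numFieldNormedType.Exports.
Import ComplexField.Normc.
Local Open Scope classical_set_scope.
Local Open Scope ring_scope.
Local Open Scope complex_scope.
Set Implicit Arguments.
Unset Strict Implicit.
Unset Printing Implicit Defensive.

(** * A smooth function vanishing exactly for t <= 0 *)

(** Three obstacles shape the argument. Nuclearity speaks about smooth functions, while a
    representation is only assumed continuous: smoothness of the coefficients has to come from the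
    smooth action alone, through convolution with a bump function on M. Each evaluation of F on a
    coefficient holds off a null set that depends on the coefficient. These null sets can be united
    because the class-I dual is countable, a consequence of the second countability of M.
    Convergence in L^{p2} only yields that, at almost every x, the partial sums return arbitrarily
    close to F phi(x) infinitely often. The functional e^x is therefore never formed: the dual
    inequality is applied to finite partial sums of it, whose values on the coefficients are Cauchy
    with tails bounded by those of Y(x), and then passes to the limit. The constant of that
    inequality is not sharp, since it comes from real interpolation with dyadic truncation. Dividing
    the Hilbert-Schmidt norm by sqrt k_pi gives both endpoint estimates constant 1, and d k (|.|_HS
    / sqrt k)^p = d k^{1 - p/2} |.|_HS^p is the weight of the symbol norm. *)

Section BumpFunction.
Context {R : realType}.

(** The exponential absorbs every power of t, by exp t >= 1 + t^n / n!. In the induction on [P] a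
    factor ['X] costs one power, so the induction hypothesis is used at [n.+1]. *)
Lemma expRN_horner_cvg0 (P : {poly R}) (n : nat) :
  exists2 C : R, 0 <= C & forall t, 1 <= t -> `|P.[t] * expR (- t)| <= C / t ^+ n.
Proof.
elim/poly_ind: P n => [|P c IH] n.
  by exists 0 => // t _; rewrite horner0 !mul0r normr0.
have [C C0 hC] := IH n.+1.
exists (C + `|c| * (n`!)%:R); first by rewrite addr_ge0 // mulr_ge0.
move=> t t1; have t0 : 0 < t by exact: lt_le_trans t1.
rewrite hornerMXaddC mulrDl (le_trans (ler_normD _ _)) // mulrDl lerD //.
  rewrite mulrAC normrM (ger0_norm (ltW t0)).
  have /(ler_pM (normr_ge0 _) (ltW t0)) /(_ (lexx t)) := hC _ t1.
  by move/le_trans; apply; rewrite exprS invfM mulrA mulrAC divfK // gt_eqF.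
rewrite normrM -mulrA ler_wpM2l // ger0_norm ?expR_ge0 // expRN.
rewrite -[leRHS]invrK lef_pV2 ?posrE ?expR_gt0 ?invr_gt0 ?mulr_gt0 ?ltr0n ?fact_gt0 ?invr_gt0 ?exprn_gt0//.
rewrite invfM invrK mulrC.
case: n {hC} => [|n]; first by rewrite expr0 fact0 invr1 mulr1 -expR0 ler_expR ltW.
by apply: le_trans (expR_ge1Dxn n (ltW t0)); rewrite lerDr.
Qed.

(* The derivatives of exp(-1/t) have the form P(1/t) exp(-1/t). *)
Definition flat (P : {poly R}) (t : R) : R :=
  if 0 < t then P.[t^-1] * expR (- t^-1) else 0.

(** Decay of order 2 at infinity becomes quadratic vanishing at 0 under t -> 1/t; this makes the
    difference quotient at 0 tend to 0. *)
Lemma flat_le (P : {poly R}) : exists2 C : R, 0 <= C &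
  forall t, `|t| <= 1 -> `|flat P t| <= C * `|t| ^+ 2.
Proof.
have [C C0 hC] := expRN_horner_cvg0 P 2.
exists C => // t t1; rewrite /flat; case: ifPn => [t0|_]; last first.
  by rewrite normr0 mulr_ge0.
rewrite (gtr0_norm t0) in t1 *.
by rewrite (le_trans (hC _ _)) ?invf_ge1 // exprVn invrK.
Qed.

(** The family [flat] is stable under differentiation, so smoothness to every order is an induction
    with [P] generalized. *)
Lemma is_derive_flat (P : {poly R}) (t : R) :
  is_derive t 1 (flat P) (flat ('X^2 * (P - P^`())) t).
Proof.
have [t0|t0|->] := ltgtP t 0.
- apply: (@near_eq_is_derive _ R R (cst 0)) => //.
    by near=> s; rewrite /flat ltNge ltW //=; near: s; exact: lt_nbhsl.
  by rewrite /flat ltNge (ltW t0) /=; exact: is_derive_cst.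
- apply: (@near_eq_is_derive _ R R (fun s : R => P.[s^-1] * expR (- s^-1))) => //.
    by near=> s; rewrite /flat ifT //; near: s; exact: lt_nbhsr.
  rewrite /flat t0.
  have d1 : is_derive t 1 (fun s : R => s^-1) (- t ^- 2).
    apply: DeriveDef; first by apply: derivableV; rewrite ?gt_eqF.
    by rewrite deriveV ?gt_eqF // derive_id /GRing.scale /= mulr1.
  have d2 : is_derive t 1 (fun s : R => P.[s^-1]) (- t ^- 2 * P^`().[t^-1]).
    by have := is_derive1_comp (is_derive_poly P t^-1) d1; rewrite mulrC.
  have d3 : is_derive t 1 (fun s : R => expR (- s^-1)) (t ^- 2 * expR (- t^-1)).
    have d4 : is_derive t 1 (fun s : R => - s^-1) (t ^- 2).
      by have := is_deriveN d1; rewrite opprK.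
    have := @is_derive1_comp R expR (fun s => - s^-1) t _ _ (is_derive_expR _) d4.
    by rewrite mulrC.
  have := is_deriveM d2 d3; rewrite /GRing.scale /= => d5.
  apply: (is_derive_eq d5); rewrite hornerM hornerXn hornerD hornerN exprVn; ring.
- have [C C0 hC] := flat_le P.
  have f0 Q : flat Q 0 = 0 by rewrite /flat ltxx.
  rewrite f0.
  have cv : h^-1 *: (flat P (h *: 1 + 0) - flat P 0) @[h --> 0^'] --> (0 : R).
    apply/cvgr0Pnorm_le => e e0.
    near=> h.
    have h0 : h != 0 by near: h; exact: nbhs_dnbhs_neq.
    have h1 : `|h| <= 1.
      near: h; apply: dnbhs0_le; exact: ltr01.
    have h2 : `|h| <= e / (C + 1).
      near: h; apply: dnbhs0_le.
      by rewrite divr_gt0 // ltr_wpDl.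
    rewrite f0 addr0 subr0 /GRing.scale /= mulr1 normrM normfV.
    rewrite ler_pdivrMl ?normr_gt0 // (le_trans (hC _ h1)) // expr2 mulrCA ler_wpM2l //.
    rewrite mulrC (le_trans (ler_wpM2r C0 h2)) // mulrAC ler_pdivrMr ?ltr_wpDl //.
    by rewrite ler_pM2l // lerDl.
  apply: DeriveDef; first by apply/cvg_ex; exists 0.
  exact/cvg_lim.
Unshelve. all: by end_near. Qed.

Lemma flat_ge0 (t : R) : 0 <= flat 1 t.
Proof. by rewrite /flat; case: ifP => // _; rewrite hornerC mul1r expR_ge0. Qed.

Lemma flat_gt0 (t : R) : 0 < t -> 0 < flat 1 t.
Proof. by rewrite /flat => ->; rewrite hornerC mul1r expR_gt0. Qed.

Lemma flat_eq0 (P : {poly R}) (t : R) : t <= 0 -> flat P t = 0.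
Proof. by rewrite /flat ltNge => ->. Qed.

Lemma continuous_flat (P : {poly R}) : continuous (flat P).
Proof.
move=> t; apply/differentiable_continuous/derivable1_diffP.
by case: (is_derive_flat P t).
Qed.

End BumpFunction.

Lemma continuous_mx (X : topologicalType) (R : realType) m n
    (f : X -> 'M[R]_(m, n)) x :
  (forall i j, {for x, continuous (fun z => f z i j)}) -> {for x, continuous f}.
Proof.
move=> fc A [P PA sPA]; apply: filterS (_ : nbhs x (fun y => forall i j, P i j (f y i j))).
  by move=> y Py; apply: sPA.
have : \forall y \near x, forall ij : 'I_m * 'I_n, P ij.1 ij.2 (f y ij.1 ij.2).
  by apply: filter_forall => -[i j]; apply: fc; apply: PA.
by apply: filterS => y h i j; exact: (h (i, j)).
Qed.

Lemma continuous_pair (X Y Z : topologicalType) (f : X -> Y) (g : X -> Z) x :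
  {for x, continuous f} -> {for x, continuous g} ->
  {for x, continuous (fun y => (f y, g y))}.
Proof. by move=> cf cg; exact: (cvg_pair cf cg). Qed.

(** * Smoothness of integrals depending on a parameter *)

Section SliceSmooth.
Context {R : realType} {T : topologicalType} {m : nat}.
Implicit Types (O : set (T * 'rV[R]_m)) (h : T -> 'rV[R]_m -> R).

(* Smoothness of [h t x] in [x] alone, all derivatives being jointly
   continuous in [(t, x)]. *)
Fixpoint sliceCk (k : nat) O h : Prop :=
  (forall z, O z -> {for z, continuous (fun z => h z.1 z.2)}) /\
  (if k is k'.+1 then
     forall v : 'rV[R]_m,
       (forall z, O z -> derivable (h z.1) z.2 v) /\
       sliceCk k' O (fun t x => 'D_v (h t) x)
   else True).

Lemma sliceCkS k O h : sliceCk k.+1 O h -> sliceCk k O h.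
Proof.
elim: k h => [|k IH] h [hc hd]; split=> // v.
by have [hd1 hd2] := hd v; split=> //; exact: IH.
Qed.

(** Permits different descriptions of [h] near different points, as a bump function extended by zero
    requires. *)
Lemma sliceCk_local k O h :
  (forall z, O z -> exists2 W, W z & sliceCk k W h) -> sliceCk k O h.
Proof.
elim: k h => [|k IH] h hO; split=> //.
- by move=> z /hO[W Wz [hc _]]; exact: hc.
- by move=> z /hO[W Wz [hc _]]; exact: hc.
- move=> v; split; first by move=> z /hO[W Wz [_ /(_ v)[hd _]]]; exact: hd.
  by apply: IH => z /hO[W Wz [_ /(_ v)[_ hd]]]; exists W.
Qed.

Lemma near_slice O t (x : 'rV[R]_m) : open O -> O (t, x) -> \forall y \near x, O (t, y).
Proof.
move=> oO Otx; have [[A B] /= [At Bx] sAB] : nbhs (t, x) O by exact: open_nbhs_nbhs.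
by apply: filterS Bx => y By; apply: sAB; split=> //=; exact: nbhs_singleton.
Qed.

Lemma sliceCk_ext k O h h' : open O -> (forall z, O z -> h z.1 z.2 = h' z.1 z.2) ->
  sliceCk k O h -> sliceCk k O h'.
Proof.
move=> oO; elim: k h h' => [|k IH] h h' hh' [hc hd]; split=> //.
- move=> z Oz; rewrite /prop_for /continuous_at -(hh' _ Oz).
  apply: cvg_trans (hc _ Oz); apply: near_eq_cvg.
  by apply: filterS (open_nbhs_nbhs (conj oO Oz)) => y /hh'.
- move=> z Oz; rewrite /prop_for /continuous_at -(hh' _ Oz).
  apply: cvg_trans (hc _ Oz); apply: near_eq_cvg.
  by apply: filterS (open_nbhs_nbhs (conj oO Oz)) => y /hh'.
- move=> v; have [hd1 hd2] := hd v.
  have nh z : O z -> \forall y \near z.2, h z.1 y = h' z.1 y.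
    case: z => t x Oz; apply: filterS (near_slice oO Oz) => y Oy.
    exact: (hh' (t, y)).
  split; first by move=> z Oz; apply: near_eq_derivable (nh _ Oz) (hd1 _ Oz).
  by apply: IH hd2 => z Oz; apply: near_eq_derive; exact: nh.
Qed.

Lemma sliceCk_param k O (r : T -> R) : continuous r -> sliceCk k O (fun t _ => r t).
Proof.
move=> cr; have cO z : O z -> {for z, continuous (fun z : T * 'rV[R]_m => r z.1)}.
  by move=> _; apply: (continuous_comp (f := fst)); [exact: cvg_fst|exact: cr].
elim: k r cr cO => [|k IH] r cr cO; split=> // v; split=> [z _|].
  exact: derivable_cst.
have -> : (fun (t : T) x => 'D_v (fun _ : 'rV[R]_m => r t) x) = (fun t _ => cst 0 t).
  by apply/funext => t; apply/funext => x; exact: derive_cst.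
by apply: IH; [exact: cst_continuous|move=> z _; exact: cst_continuous].
Qed.

Lemma sliceCkD k O h h' : open O -> sliceCk k O h -> sliceCk k O h' ->
  sliceCk k O (fun t x => h t x + h' t x).
Proof.
move=> oO; elim: k h h' => [|k IH] h h' [hc hd] [hc' hd']; split=> //.
- by move=> z Oz; apply: cvgD; [exact: hc|exact: hc'].
- by move=> z Oz; apply: cvgD; [exact: hc|exact: hc'].
- move=> v; have [hd1 hd2] := hd v; have [hd1' hd2'] := hd' v; split.
    by move=> z Oz; apply: derivableD; [exact: hd1|exact: hd1'].
  apply: sliceCk_ext (IH _ _ hd2 hd2') => // z Oz /=.
  by rewrite deriveD //; [exact: hd1|exact: hd1'].
Qed.

Lemma sliceCkM k O h h' : open O -> sliceCk k O h -> sliceCk k O h' ->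
  sliceCk k O (fun t x => h t x * h' t x).
Proof.
move=> oO; elim: k h h' => [|k IH] h h' hh hh'.
  case: (hh) (hh') => [hc _] [hc' _].
  by split=> // z Oz; apply: cvgM; [exact: hc|exact: hc'].
case: (hh) (hh') => [hc hd] [hc' hd']; split=> //.
  by move=> z Oz; apply: cvgM; [exact: hc|exact: hc'].
move=> v; have [hd1 hd2] := hd v; have [hd1' hd2'] := hd' v; split.
  by move=> z Oz; apply: derivableM; [exact: hd1|exact: hd1'].
apply: sliceCk_ext (sliceCkD oO (IH _ _ (sliceCkS hh) hd2')
  (IH _ _ (sliceCkS hh') hd2)) => // z Oz /=.
by rewrite deriveM //; [exact: hd1|exact: hd1'].
Qed.

Lemma sliceCk_sum k O p (h : 'I_p -> T -> 'rV[R]_m -> R) : open O ->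
  (forall i, sliceCk k O (h i)) -> sliceCk k O (fun t x => \sum_i h i t x).
Proof.
move=> oO; elim: p h => [|p IH] h hh.
  under eq_fun do under eq_fun do rewrite big_ord0.
  by apply: (@sliceCk_param k O (cst 0)); exact: cst_continuous.
under eq_fun do under eq_fun do rewrite big_ord_recr.
by apply: sliceCkD => //; apply: IH.
Qed.

Lemma derive_line (f : 'rV[R]_m -> R) x v :
  'D_1 (fun s : R => f (s *: v + x)) 0 = 'D_v f x.
Proof.
apply: (f_equal (fun F : R -> R => lim (F @ 0^'))); apply/funext => h /=.
by rewrite addr0 scale0r add0r [h%:A]mulr1.
Qed.

(** Only derivability along [v] is assumed, not differentiability, so the chain rule is applied on
    the line s -> x + s v. *)
Lemma is_derive_comp_flat (P : {poly R}) (f : 'rV[R]_m -> R) x v :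
  derivable f x v ->
  is_derive x v (fun y => flat P (f y)) (flat ('X^2 * (P - P^`())) (f x) * 'D_v f x).
Proof.
move=> df; pose g (s : R) := f (s *: v + x).
have dg : is_derive (0 : R) 1 g ('D_v f x).
  have dg : derivable g (0 : R) 1 by apply/(derivable1P f x v).
  by rewrite -derive_line; exact: (DeriveDef dg).
have := is_derive1_comp (is_derive_flat P (g 0)) dg.
rewrite {2}/g scale0r add0r => -[d1 d2].
have d3 : derivable (fun y => flat P (f y)) x v by apply/derivable1P.
by apply: (DeriveDef d3); rewrite -d2 -derive_line.
Qed.

Lemma sliceCk_flat k O (P : {poly R}) h : open O -> sliceCk k O h ->
  sliceCk k O (fun t x => flat P (h t x)).
Proof.
move=> oO; elim: k h P => [|k IH] h P hh.
  case: (hh) => [hc _]; split=> // z Oz.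
  by apply: (continuous_comp (f := fun z => h z.1 z.2)); [exact: hc|exact: continuous_flat].
case: (hh) => [hc hd]; split=> //.
  by move=> z Oz; apply: (continuous_comp (f := fun z => h z.1 z.2)); [exact: hc|exact: continuous_flat].
move=> v; have [hd1 hd2] := hd v; split.
  by move=> z Oz; case: (is_derive_comp_flat P (hd1 _ Oz)).
apply: sliceCk_ext (sliceCkM oO (IH _ ('X^2 * (P - P^`())) (sliceCkS hh)) hd2) => // z Oz /=.
by case: (is_derive_comp_flat P (hd1 _ Oz)).
Qed.

(** No derivative is taken in the parameter, so a merely continuous change of parameter is allowed.
    It serves for inversion on the group. *)
Lemma sliceCk_reparam k O h (f : T -> T) : continuous f -> sliceCk k O h ->
  sliceCk k [set z | O (f z.1, z.2)] (fun t x => h (f t) x).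
Proof.
move=> cf; elim: k h => [|k IH] h [hc hd].
  split=> // z Oz; apply: (continuous_comp (f := fun z : T * 'rV[R]_m => (f z.1, z.2)) (g := fun z => h z.1 z.2)); last exact: (hc _ Oz).
  by apply: continuous_pair; [|exact: cvg_snd];
    by apply: (continuous_comp (f := fst)); [exact: cvg_fst|exact: cf].
split=> //.
  move=> z Oz; apply: (continuous_comp (f := fun z : T * 'rV[R]_m => (f z.1, z.2)) (g := fun z => h z.1 z.2)); last exact: (hc _ Oz).
  by apply: continuous_pair; [|exact: cvg_snd];
    by apply: (continuous_comp (f := fst)); [exact: cvg_fst|exact: cf].
move=> v; have [hd1 hd2] := hd v; split; last exact: IH hd2.
by move=> z Oz; exact: (hd1 _ Oz).
Qed.

Lemma continuous_row_mx n (c : T -> 'rV[R]_n) (z : T * 'rV[R]_m) :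
  {for z.1, continuous c} ->
  {for z, continuous (fun z : T * 'rV[R]_m => row_mx (c z.1) z.2)}.
Proof.
move=> cc; apply: continuous_mx => i j; case: (split_ordP j) => j' ->.
  rewrite (_ : (fun z => _) = fun z : T * 'rV[R]_m => c z.1 i j'); last first.
    by apply/funext => y; rewrite row_mxEl.
  apply: (@continuous_comp _ _ _ (fun z : T * 'rV[R]_m => c z.1) (fun M : 'rV[R]_n => M i j')); last exact: coord_continuous.
  by apply: (continuous_comp (f := fst)); [exact: cvg_fst|exact: cc].
rewrite (_ : (fun z => _) = fun z : T * 'rV[R]_m => z.2 i j'); last first.
  by apply/funext => y; rewrite row_mxEr.
by apply: (@continuous_comp _ _ _ snd (fun M : 'rV[R]_m => M i j')); [exact: cvg_snd|exact: coord_continuous].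
Qed.

(** The chart coordinates of the parameter are frozen: a derivative in [x] along [v] is a derivative
    of [A] along [row_mx 0 v]. This is how smoothness of the action in product charts is
    exploited. *)
Lemma sliceCk_Ck n p k (W : set 'rV[R]_(n + m)) (A : 'rV[R]_(n + m) -> 'rV[R]_p)
    (O : set (T * 'rV[R]_m)) (c : T -> 'rV[R]_n) j : open O -> Ck k W A ->
  (forall z, O z -> {for z.1, continuous c} /\ W (row_mx (c z.1) z.2)) ->
  sliceCk k O (fun t x => A (row_mx (c t) x) 0 j).
Proof.
move=> oO + hO; elim: k A => [|k IH] A [Ac Ad].
  split=> // z /hO[cz Wz]; apply: (@continuous_comp _ _ _ (fun z : T * 'rV[R]_m => A (row_mx (c z.1) z.2)) (fun M : 'rV[R]_p => M 0 j)).
    apply: (@continuous_comp _ _ _ (fun z : T * 'rV[R]_m => row_mx (c z.1) z.2) A); last exact: Ac.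
    exact: continuous_row_mx.
  exact: coord_continuous.
split=> //.
  move=> z /hO[cz Wz]; apply: (@continuous_comp _ _ _ (fun z : T * 'rV[R]_m => A (row_mx (c z.1) z.2)) (fun M : 'rV[R]_p => M 0 j)).
    apply: (@continuous_comp _ _ _ (fun z : T * 'rV[R]_m => row_mx (c z.1) z.2) A); last exact: Ac.
    exact: continuous_row_mx.
  exact: coord_continuous.
move=> v; have [d1 d2] := Ad (row_mx 0 v).
have eqs t x s : row_mx (c t) (s *: v + x) = s *: row_mx 0 v + row_mx (c t) x :> 'rV[R]_(n + m).
  by rewrite scale_row_mx add_row_mx scaler0 add0r.
have dA (z : T * 'rV[R]_m) : O z -> derivable (fun y => A (row_mx (c z.1) y)) z.2 v.
  move=> /hO[cz Wz]; have := d1 _ Wz; rewrite /derivable /=.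
  by under [X in _ -> cvg (X @ _)]eq_fun do rewrite eqs.
split=> [z Oz|].
  by have /derivable_mxP := dA _ Oz; exact.
apply: sliceCk_ext (IH _ d2) => // z Oz.
have := derive_mx (dA _ Oz) => /matrixP/(_ 0 j); rewrite [in RHS]mxE => <-.
apply: (f_equal (fun F : R -> 'rV[R]_p => lim (F @ 0^') 0 j)).
by apply/funext => s /=; rewrite eqs.
Qed.

End SliceSmooth.

Lemma near_eq_continuous (X Y : topologicalType) (f g : X -> Y) x :
  (\forall y \near x, f y = g y) -> {for x, continuous f} -> {for x, continuous g}.
Proof.
move=> fg cf; rewrite /prop_for /continuous_at -(nbhs_singleton fg).
by apply: cvg_trans cf; apply: near_eq_cvg.
Qed.

Lemma continuous_for_le (R : realType) (X : topologicalType) (f : X -> R^o) x :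
  (forall e, 0 < e -> \forall y \near x, `|f x - f y| <= e) -> {for x, continuous f}.
Proof. by move=> H; apply/cvgrPdist_le => e e0; exact: H. Qed.

Lemma Ck_ext (R : realType) n (W : normedModType R) k (U : set 'rV[R]_n) (f g : 'rV[R]_n -> W) :
  open U -> (forall x, U x -> f x = g x) -> Ck k U f -> Ck k U g.
Proof.
move=> oU.
have nfg (f1 g1 : 'rV[R]_n -> W) x : (forall x, U x -> f1 x = g1 x) -> U x ->
    \forall y \near x, f1 y = g1 y.
  move=> fg Ux; have : nbhs x U by exact: open_nbhs_nbhs.
  by apply: filterS => y /fg.
elim: k f g => [|k IH] f g fg [fc fd].
  by split=> // x Ux; apply: near_eq_continuous (nfg _ _ _ fg Ux) (fc _ Ux).
split=> [x Ux|v].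
  by apply: near_eq_continuous (nfg _ _ _ fg Ux) (fc _ Ux).
have [d1 d2] := fd v.
split; first by move=> x Ux; apply: near_eq_derivable (nfg _ _ _ fg Ux) (d1 _ Ux).
by apply: IH d2 => x Ux; apply: near_eq_derive; exact: nfg.
Qed.

Lemma continuous_borel_measurable (R : realType) (T : ptopologicalType) (f : T -> R) :
  continuous f -> measurable_fun setT (f : borel T -> R).
Proof.
move=> /continuousP cf; apply: (measurability _ (RGenOpens.measurableE R)).
move=> _ [_ [a [b ->] <-]]; rewrite setTI.
by apply: sub_sigma_algebra; apply: cf; exact: interval_open.
Qed.

Section IntegralSmooth.
Context {R : realType} {T : ptopologicalType} {m : nat}.
Hypothesis T_compact : compact [set: T].
Variable mu : probability (borel T) R.

Lemma continuous_integrable (f : T -> R) :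
  continuous f -> mu.-integrable setT (EFin \o (f : borel T -> R)).
Proof.
move=> cf; apply: measurable_bounded_integrable => //.
- by apply: (@le_lt_trans _ _ 1%E); [rewrite -(@probability_setT _ _ _ mu)|exact: ltry].
- exact: continuous_borel_measurable.
- have := continuous_compact (continuous_subspaceT cf) T_compact.
  move=> /compact_bounded [M [Mr HM]]; exists M; split=> // x Mx y _.
  by apply: (HM x Mx); exists y.
Qed.

(** The tube lemma: compactness of [T] makes continuity at the points (t, x0) uniform in t. *)
Lemma tube_le (f : T -> 'rV[R]_m -> R) x0 (e : R) :
  (forall t, {for (t, x0), continuous (fun z => f z.1 z.2)}) -> 0 < e ->
  \forall x \near x0, forall t, `|f t x - f t x0| <= e.
Proof.
move=> cf e0.
have nc := (compact_near_coveringP [set: T]).1 T_compact.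
have H := nc _ (nbhs x0) (fun x t => `|f t x - f t x0| <= e) (nbhs_filter x0).
apply: filterS (H _) => [x hx t|t _]; first exact: hx.
have /cvgrPdist_le/(_ (e / 2)) := cf t; rewrite divr_gt0 // => /(_ isT) /= [[A B] /= [At Bx] AB].
exists (A, B) => //= -[t' x] [/= At' Bx'].
have h1 := AB (t', x) (conj At' Bx').
have h2 := AB (t', x0) (conj At' (nbhs_singleton Bx)).
rewrite /= in h1 h2; rewrite -(subrK (f t x0) (f t' x)) -addrA.
rewrite (le_trans (ler_normD _ _)) // (splitr e) lerD //; first by rewrite distrC.
Qed.

Lemma dist_Rintegral_le (f g : T -> R) (e : R) : continuous f -> continuous g ->
  (forall t, `|f t - g t| <= e) ->
  `|(\int[mu]_t f t)%R - (\int[mu]_t g t)%R| <= e.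
Proof.
move=> cf cg fg; rewrite -RintegralB //; try exact: continuous_integrable.
have cfg : continuous (fun t => f t - g t) by move=> t; apply: cvgB; [exact: cf|exact: cg].
apply: (le_trans (le_normr_Rintegral _ _)) => //; first exact: continuous_integrable.
have cn : continuous (fun t => `|f t - g t|) by move=> t; apply: cvg_norm; exact: cfg.
have ce : continuous (fun _ : T => e) by move=> t; exact: cvg_cst.
apply: (le_trans (le_Rintegral _ (continuous_integrable cn) (continuous_integrable ce) _)) => //.
rewrite Rintegral_cst // -[leRHS]mulr1; rewrite le_eqVlt; apply/orP; left; apply/eqP; congr (_ * _).
exact: (f_equal fine (probability_setT mu)).
Qed.

Lemma MVT_line (g : R -> R) (d s : R) : 0 < d ->
  (forall c, `|c| < d -> derivable g c 1) -> `|s| < d ->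
  exists2 c, `|c| <= `|s| & g s - g 0 = 'D_1 g c * s.
Proof.
move=> d0 dg sd.
have cg c : `|c| < d -> {for c, continuous g}.
  by move=> /dg /derivable1_diffP /differentiable_continuous.
have [s0|s0] := leP 0 s.
- have [|c|c cs ->] := @MVT_segment R g (fun c => 'D_1 g c) 0 s s0.
  + move=> c; rewrite in_itv /= => /andP[c0 cs]; apply/derivableP/dg.
    by rewrite gtr0_norm // (lt_trans cs) // -(ger0_norm s0).
  + apply: continuous_in_subspaceT => x; rewrite inE /= in_itv /= => /andP[x0 xs].
    by apply: cg; rewrite ger0_norm // (le_lt_trans xs) // -(ger0_norm s0).
  + move: cs; rewrite in_itv /= => /andP[c0 cs]; exists c; last by rewrite subr0.
    by rewrite !ger0_norm.
- have [|c|c cs E] := @MVT_segment R g (fun c => 'D_1 g c) s 0 (ltW s0).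
  + move=> c; rewrite in_itv /= => /andP[c0 cs]; apply/derivableP/dg.
    by rewrite ltr0_norm // (le_lt_trans _ sd) // ltr0_norm // lerN2 ltW.
  + apply: continuous_in_subspaceT => x; rewrite inE /= in_itv /= => /andP[x0 xs].
    by apply: cg; rewrite ler0_norm // (le_lt_trans _ sd) // ltr0_norm // lerN2.
  + move: cs; rewrite in_itv /= => /andP[c0 cs]; exists c.
      by rewrite !ler0_norm ?lerN2 // ltW.
    by rewrite -opprB E sub0r mulrN opprK.
Qed.

Lemma derivable_line n (f : 'rV[R]_n -> R) x v (c : R) :
  derivable f (c *: v + x) v ->
  derivable (fun s : R => f (s *: v + x)) c 1 /\
  'D_1 (fun s : R => f (s *: v + x)) c = 'D_v f (c *: v + x).
Proof.
move=> df; rewrite /derivable /derive.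
have e : (fun h : R => h^-1 *: (((fun s : R => f (s *: v + x)) \o shift c) (h%:A) -
    f (c *: v + x))) =
    (fun h : R => h^-1 *: ((f \o shift (c *: v + x)) (h *: v) - f (c *: v + x))).
  by apply/funext => h /=; rewrite [h%:A]mulr1 scalerDl addrA.
by split; [exact: (eq_ind_r (fun F : R -> R => cvg (F @ 0^')) df e) | exact: (f_equal (fun F : R -> R => lim (F @ 0^')) e)].
Qed.

(** Differentiation under the integral sign. By the mean value theorem a difference quotient of
    [h t] is a derivative at a nearby point of the line, and [tube_le] compares it with the
    derivative at x uniformly in t. *)
Lemma Ck_Rintegral k (U : set 'rV[R]_m) (h : T -> 'rV[R]_m -> R) : open U ->
  sliceCk k [set z | U z.2] h ->
  Ck k U (fun x => (\int[mu]_t h t x)%R : R^o).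
Proof.
move=> oU.
have slice_cont (f : T -> 'rV[R]_m -> R) x :
    (forall z, U z.2 -> {for z, continuous (fun z => f z.1 z.2)}) ->
    U x -> continuous (fun t => f t x).
  move=> fc Ux t; apply: (@continuous_comp _ _ _ (fun t => (t, x)) (fun z => f z.1 z.2)).
    by apply: continuous_pair; [exact: cvg_id|exact: cvg_cst].
  exact: fc.
have int_cont (f : T -> 'rV[R]_m -> R) x :
    (forall z, U z.2 -> {for z, continuous (fun z => f z.1 z.2)}) ->
    U x -> {for x, continuous (fun x => (\int[mu]_t f t x)%R : R^o)}.
  move=> fc Ux; apply: continuous_for_le => e e0.
  have tb := tube_le (fun t => fc (t, x) Ux) e0.
  have nU : nbhs x U by exact: open_nbhs_nbhs.
  near=> y; rewrite distrC; apply: dist_Rintegral_le.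
  - by apply: slice_cont => //; near: y.
  - exact: slice_cont.
  - by near: y.
elim: k h => [|k IH] h [hc hd]; first by split=> // x Ux; exact: int_cont.
split=> [x Ux|v]; first exact: int_cont.
have [d1 d2] := hd v.
have dc z : U z.2 -> {for z, continuous (fun z => 'D_v (h z.1) z.2)}.
  by move=> Uz; case: (k) d2 => [|k'] [+ _]; exact.
have cvD x : U x -> (fun s : R => s^-1 *: ((\int[mu]_t h t (s *: v + x))%R - (\int[mu]_t h t x)%R))
    @ 0^' --> (\int[mu]_t 'D_v (h t) x)%R.
  move=> Ux; apply/cvgrPdist_le => e e0.
  have tb := @tube_le (fun t x => 'D_v (h t) x) x e (fun t => dc (t, x) Ux) e0.
  have nU : nbhs x U by exact: open_nbhs_nbhs.
  have cl : {for (0 : R), continuous (fun s : R => s *: v + x)}.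
    apply: continuousD; last exact: cst_continuous.
    exact: scalel_continuous.
  have : \forall s \near (0 : R), U (s *: v + x) /\
     forall t, `|'D_v (h t) (s *: v + x) - 'D_v (h t) x| <= e.
    apply: (cl (fun y => U y /\ forall t, `|'D_v (h t) y - 'D_v (h t) x| <= e)).
    by rewrite scale0r add0r; apply: filterI.
  move=> [d /= d0 hball].
  have hb s : `|s| < d -> U (s *: v + x) /\
     forall t, `|'D_v (h t) (s *: v + x) - 'D_v (h t) x| <= e.
    by move=> sd; apply: hball; rewrite /= sub0r normrN.
  near=> s.
  have s0 : s != 0 by near: s; exact: nbhs_dnbhs_neq.
  have sd : `|s| < d by near: s; exact: dnbhs0_lt.
  have [Us _] := hb _ sd.
  have hs := slice_cont h _ hc Us; have hx := slice_cont h _ hc Ux.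
  have cq : continuous (fun t => s^-1 * (h t (s *: v + x) - h t x)).
    by move=> t; apply: cvgM; [exact: cvg_cst|apply: cvgB; [exact: hs|exact: hx]].
  have -> : s^-1 *: ((\int[mu]_t h t (s *: v + x))%R - (\int[mu]_t h t x)%R) =
     (\int[mu]_t (s^-1 * (h t (s *: v + x) - h t x)))%R.
    apply: (@etrans _ _ (s^-1 * ((\int[mu]_t h t (s *: v + x))%R - (\int[mu]_t h t x)%R))) => //.
    rewrite -RintegralB //; try exact: continuous_integrable.
    rewrite -RintegralZl //; apply: (continuous_integrable (f := fun t => h t (s *: v + x) - h t x)).
    by move=> t; apply: cvgB; [exact: hs|exact: hx].
  apply: dist_Rintegral_le => //; first exact: (slice_cont (fun t x => 'D_v (h t) x)).
  move=> t.
  have [|c cs] := @MVT_line (fun s : R => h t (s *: v + x)) d s d0 _ sd.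
    by move=> c cd; have [+ _] := hb _ cd => /(d1 (t, _)) /derivable_line[].
  have cd := le_lt_trans cs sd.
  have [Uc hc'] := hb _ cd.
  have [_ ->] := derivable_line (d1 (t, _) Uc).
  rewrite scale0r add0r => ->; rewrite mulrCA mulVf // mulr1.
  by rewrite distrC.
split; first by move=> x Ux; apply/cvg_ex; exists (\int[mu]_t 'D_v (h t) x)%R; exact: cvD.
apply: Ck_ext (IH _ d2) => // x Ux.
by apply/esym/cvg_lim => //; exact: cvD.
Unshelve. all: by end_near. Qed.

End IntegralSmooth.

(** * Integrals of bounded complex functions *)

Section ComplexNorm.
Context {R : rcfType}.
Implicit Types x y : R[i].

Lemma normcE x : `|x| = (normc x)%:C.
Proof. by []. Qed.

Lemma normc_ge0 x : 0 <= normc x.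
Proof. by case: x => a b; rewrite sqrtr_ge0. Qed.

Lemma normcD_le x y : normc (x + y) <= normc x + normc y.
Proof. by rewrite -lecR [X in _ <= X]rmorphD /= -!normcE ler_normD. Qed.

Lemma normc_sqr x : normc x ^+ 2 = complex.Re x ^+ 2 + complex.Im x ^+ 2.
Proof. by case: x => a b /=; rewrite sqr_sqrtr // addr_ge0 ?sqr_ge0. Qed.

Lemma Re_le_normc x : `|complex.Re x| <= normc x.
Proof.
rewrite -(ler_pXn2r (n := 2)) ?nnegrE ?normc_ge0 // real_normK ?num_real // normc_sqr.
by rewrite lerDl sqr_ge0.
Qed.

Lemma Im_le_normc x : `|complex.Im x| <= normc x.
Proof.
rewrite -(ler_pXn2r (n := 2)) ?nnegrE ?normc_ge0 // real_normK ?num_real // normc_sqr.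
by rewrite lerDr sqr_ge0.
Qed.

Lemma complex_ReM x y : complex.Re (x * y) = complex.Re x * complex.Re y - complex.Im x * complex.Im y.
Proof. by case: x y => [a b] [c d]. Qed.

Lemma complex_ImM x y : complex.Im (x * y) = complex.Re x * complex.Im y + complex.Im x * complex.Re y.
Proof. by case: x y => [a b] [c d]. Qed.

Lemma complex_ReD x y : complex.Re (x + y) = complex.Re x + complex.Re y.
Proof. by case: x y => [a b] [c d]. Qed.

Lemma complex_ImD x y : complex.Im (x + y) = complex.Im x + complex.Im y.
Proof. by case: x y => [a b] [c d]. Qed.

Lemma complex_Re_conj x : complex.Re (Num.conj x) = complex.Re x.
Proof. by case: x. Qed.

Lemma complex_Im_conj x : complex.Im (Num.conj x) = - complex.Im x.
Proof. by case: x. Qed.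

Lemma normc_conj x : normc (Num.conj x) = normc x.
Proof. by apply: complexI; rewrite -!normcE norm_conjC. Qed.

Lemma conjCM x y : Num.conj (x * y) = Num.conj x * Num.conj y.
Proof. exact: rmorphM. Qed.

Lemma conjC_sum (J : Type) (s : seq J) (Q : pred J) (F : J -> R[i]) :
  Num.conj (\sum_(i <- s | Q i) F i) = \sum_(i <- s | Q i) Num.conj (F i).
Proof. exact: rmorph_sum. Qed.

Lemma mulr_conj x : x * Num.conj x = (normc x ^+ 2)%:C.
Proof. by rewrite -normCK normcE rmorphXn. Qed.

Lemma normc_real (a : R) : normc a%:C = `|a|.
Proof. by rewrite /= expr0n /= addr0 sqrtr_sqr. Qed.

Lemma normc_sum (J : Type) (s : seq J) (P : pred J) (F : J -> R[i]) :
  normc (\sum_(i <- s | P i) F i) <= \sum_(i <- s | P i) normc (F i).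
Proof.
elim/big_ind2 : _ => //; first by rewrite normc0.
by move=> a b c d h1 h2; apply: le_trans (normcD_le _ _) _; rewrite lerD.
Qed.

End ComplexNorm.

Lemma continuous_Re (R : realType) (X : topologicalType) (f : X -> R[i]) :
  continuous (f : X -> (R[i])^o) -> continuous (fun x => complex.Re (f x)).
Proof.
move=> cf x; apply/cvgrPdist_lt => e e0.
have e0' : 0 < e%:C :> R[i] by rewrite ltcR.
have /cvgrPdist_lt/(_ _ e0') := cf x; apply: filterS => y.
rewrite normcE ltcR; apply: le_lt_trans.
by rewrite -[X in `|_ - X|]opprK; apply: le_trans (Re_le_normc _); case: (f x) (f y) => [a b] [c d] /=; rewrite opprK.
Qed.

Lemma continuous_Im (R : realType) (X : topologicalType) (f : X -> R[i]) :
  continuous (f : X -> (R[i])^o) -> continuous (fun x => complex.Im (f x)).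
Proof.
move=> cf x; apply/cvgrPdist_lt => e e0.
have e0' : 0 < e%:C :> R[i] by rewrite ltcR.
have /cvgrPdist_lt/(_ _ e0') := cf x; apply: filterS => y.
rewrite normcE ltcR; apply: le_lt_trans.
by rewrite -[X in `|_ - X|]opprK; apply: le_trans (Im_le_normc _); case: (f x) (f y) => [a b] [c d] /=; rewrite opprK.
Qed.

Section BoundedIntegral.
Context {R : realType} {dsp : measure_display} {T : measurableType dsp}.
Variable P : probability T R.
Local Notation C := R[i].
Implicit Types f g : T -> C.

(** A conjugation-stable algebra contained in every L^p of a probability space. It contains the
    matrix coefficients and their finite combinations, so integrability never has to be discussed
    exponent by exponent. *)
Definition bmeas f := Cmeasurable f /\ exists B : R, forall x, normc (f x) <= B.

Lemma Re_Cintegral f : complex.Re (Cintegral P f) = (\int[P]_x complex.Re (f x))%R.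
Proof. by []. Qed.

Lemma Im_Cintegral f : complex.Im (Cintegral P f) = (\int[P]_x complex.Im (f x))%R.
Proof. by []. Qed.

Lemma bmeas_cst (c : C) : bmeas (fun _ => c).
Proof. by split; [split; exact: measurable_cst|exists (normc c)]. Qed.

Lemma CmeasurableD f g : Cmeasurable f -> Cmeasurable g -> Cmeasurable (fun x => f x + g x).
Proof.
move=> [f1 f2] [g1 g2]; split.
  by under eq_fun do rewrite complex_ReD; exact: measurable_funD.
by under eq_fun do rewrite complex_ImD; exact: measurable_funD.
Qed.

Lemma CmeasurableM f g : Cmeasurable f -> Cmeasurable g -> Cmeasurable (fun x => f x * g x).
Proof.
move=> [f1 f2] [g1 g2]; split.
  by under eq_fun do rewrite complex_ReM; apply: measurable_funB; exact: measurable_funM.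
by under eq_fun do rewrite complex_ImM; apply: measurable_funD; exact: measurable_funM.
Qed.

Lemma Cmeasurable_normc f : Cmeasurable f -> measurable_fun setT (fun x => normc (f x)).
Proof.
move=> [f1 f2]; rewrite (_ : (fun _ => _) = fun x => Num.sqrt (complex.Re (f x) ^+ 2 + complex.Im (f x) ^+ 2)).
  apply: (measurableT_comp (continuous_measurable_fun (@sqrt_continuous R))).
  by apply: measurable_funD; apply: measurable_funX.
by apply/funext => x; rewrite -normc_sqr sqrtr_sqr ger0_norm ?normc_ge0.
Qed.

Lemma bmeasD f g : bmeas f -> bmeas g -> bmeas (fun x => f x + g x).
Proof.
move=> [mf [A fA]] [mg [B gB]]; split; first exact: CmeasurableD.
by exists (A + B) => x; rewrite (le_trans (normcD_le _ _)) // lerD.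
Qed.

Lemma bmeasM f g : bmeas f -> bmeas g -> bmeas (fun x => f x * g x).
Proof.
move=> [mf [A fA]] [mg [B gB]]; split; first exact: CmeasurableM.
by exists (A * B) => x; rewrite normcM ler_pM ?normc_ge0.
Qed.

Lemma bmeas_conj f : bmeas f -> bmeas (fun x => Num.conj (f x)).
Proof.
move=> [[m1 m2] [A fA]]; split; last by exists A => x; rewrite normc_conj.
split; first by under eq_fun do rewrite complex_Re_conj.
by under eq_fun do rewrite complex_Im_conj; exact: measurableT_comp.
Qed.

Lemma bmeas_sum (J : Type) (s : seq J) (Q : pred J) (F : J -> T -> C) :
  (forall i, bmeas (F i)) -> bmeas (fun x => \sum_(i <- s | Q i) F i x).
Proof.
move=> bF; elim: s => [|j s IH].
  by under eq_fun do rewrite big_nil; exact: bmeas_cst.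
under eq_fun do rewrite big_cons.
by case: (Q j); [exact: bmeasD|].
Qed.

Lemma bounded_integrable (f : T -> R) : measurable_fun setT f ->
  (exists B : R, forall x, `|f x| <= B) -> P.-integrable setT (EFin \o f).
Proof.
move=> mf [B fB]; apply: measurable_bounded_integrable => //.
  by apply: (@le_lt_trans _ _ 1%E); [rewrite -(@probability_setT _ _ _ P)|exact: ltry].
exists B; split; first exact: num_real.
by move=> x Bx y _ /=; rewrite (le_trans (fB y)) // ltW.
Qed.

Lemma bmeas_Re f : bmeas f -> P.-integrable setT (EFin \o (fun x => complex.Re (f x))).
Proof.
move=> [[m1 m2] [B fB]]; apply: bounded_integrable => //.
by exists B => x; exact: le_trans (Re_le_normc _) _.
Qed.

Lemma bmeas_Im f : bmeas f -> P.-integrable setT (EFin \o (fun x => complex.Im (f x))).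
Proof.
move=> [[m1 m2] [B fB]]; apply: bounded_integrable => //.
by exists B => x; exact: le_trans (Im_le_normc _) _.
Qed.

Lemma CintegralD f g : bmeas f -> bmeas g ->
  Cintegral P (fun x => f x + g x) = Cintegral P f + Cintegral P g.
Proof.
move=> bf bg; rewrite /Cintegral.
under eq_Rintegral do rewrite complex_ReD; under [X in _ +i* X]eq_Rintegral do rewrite complex_ImD.
by rewrite !RintegralD //; [exact: bmeas_Im|exact: bmeas_Im|exact: bmeas_Re|exact: bmeas_Re].
Qed.

Lemma CintegralZ (c : C) f : bmeas f ->
  Cintegral P (fun x => c * f x) = c * Cintegral P f.
Proof.
move=> bf; rewrite /Cintegral.
have iR := bmeas_Re bf; have iI := bmeas_Im bf.
have Z (a : R) h : P.-integrable setT (EFin \o h) -> P.-integrable setT (EFin \o (fun x => a * h x)).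
  by move=> ih; have := integrableZl measurableT a ih; apply: eq_integrable.
under eq_Rintegral do rewrite complex_ReM; under [X in _ +i* X]eq_Rintegral do rewrite complex_ImM.
rewrite RintegralB ?RintegralD ?RintegralZl //; try exact: Z.
by case: c.
Qed.

Lemma Cintegral_cst (c : C) : Cintegral P (fun _ => c) = c.
Proof.
rewrite /Cintegral !Rintegral_cst //; case: c => a b /=.
by congr (_ +i* _); rewrite -[RHS]mulr1; congr (_ * _); exact: (f_equal fine (probability_setT P)).
Qed.

Lemma Cintegral_sum (J : Type) (s : seq J) (Q : pred J) (F : J -> T -> C) :
  (forall i, bmeas (F i)) ->
  Cintegral P (fun x => \sum_(i <- s | Q i) F i x) = \sum_(i <- s | Q i) Cintegral P (F i).
Proof.
move=> bF; elim: s => [|j s IH].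
  by rewrite big_nil; under [in LHS]eq_fun do rewrite big_nil; exact: Cintegral_cst.
rewrite big_cons; under [in LHS]eq_fun do rewrite big_cons.
by case: (Q j) => //; rewrite CintegralD ?IH //; exact: bmeas_sum.
Qed.

Lemma Cintegral_comp (tau : T -> T) f : measurable_fun setT tau ->
  (forall A, measurable A -> P (tau @^-1` A) = P A) -> bmeas f ->
  Cintegral P (fun x => f (tau x)) = Cintegral P f.
Proof.
move=> mt Pt bf; rewrite /Cintegral.
have Rc (h : T -> R) : P.-integrable setT (EFin \o h) ->
    measurable_fun setT h ->
    (exists B : R, forall x, `|h x| <= B) ->
    (\int[P]_x h (tau x))%R = (\int[P]_x h x)%R.
  move=> ih mh [B hB]; rewrite /Rintegral; congr fine.
  rewrite -[LHS]/(\int[P]_(x in tau @^-1` setT) ((EFin \o h) \o tau) x)%E.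
  rewrite -(@integral_pushforward _ _ _ _ _ tau mt P setT (EFin \o h)) //.
  - apply: eq_measure_integral => A mA _; exact: Pt.
  - exact/measurable_EFinP.
  - apply: bounded_integrable; first exact: measurableT_comp.
    by exists B => x.
case: (bf) => [[m1 m2] [B fB]].
congr (_ +i* _); apply: Rc => //.
- exact: bmeas_Re.
- by exists B => x; exact: le_trans (Re_le_normc _) _.
- exact: bmeas_Im.
- by exists B => x; exact: le_trans (Im_le_normc _) _.
Qed.

End BoundedIntegral.

(** * Bump functions on the homogeneous space *)

Section HomogeneousSmooth.
Context {R : realType} {n m : nat} {G : ptopGroupType} {LG : lie_group R n G}.
Context {K : set G} {M : ptopologicalType}.
Variable H : homogeneous m LG K M.
Local Notation atlasM := (atlas (hom_mfd H)).

Lemma act_continuous : continuous (fun z : G * M => act H z.1 z.2).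
Proof. by case: (act_smooth H). Qed.

Lemma act_chart_continuous (d : chart R m M) g u : atlasM d -> ccod d u ->
  {for (g, u), continuous (fun z : G * 'rV[R]_m => act H z.1 (cinv d z.2))}.
Proof.
move=> ad du.
apply: (@continuous_comp _ _ _ (fun z : G * 'rV[R]_m => (z.1, cinv d z.2))
  (fun z : G * M => act H z.1 z.2)); last exact: act_continuous.
apply: continuous_pair; first exact: cvg_fst.
apply: (@continuous_comp _ _ _ snd (cinv d)); first exact: cvg_snd.
exact: cinv_cont.
Qed.

(** In a chart [e] around the base point the bump is [flat 1] of dl^2 - |y - y0|^2, extended by
    zero. Its smoothness is stated for the translates x -> eta (g x), jointly continuous in g,
    because these are what gets integrated over the group. *)
Lemma exists_bump (N : set M) : open N -> N (base H) ->
  exists eta : M -> R, [/\ forall x, 0 <= eta x, 0 < eta (base H),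
    forall x, eta x != 0 -> N x
  & forall d, atlasM d -> forall k,
      sliceCk k [set z | ccod d z.2] (fun g u => eta (act H g (cinv d u)))].
Proof.
move=> oN Nb.
have [e ae eb] := atlas_cover (hom_mfd H) (base H).
pose y0 := cmap e (base H).
have ey0 : ccod e y0 by exact: cmap_in.
have : nbhs y0 (ccod e `&` cinv e @^-1` N).
  apply: filterI; first by apply: open_nbhs_nbhs; split=> //; exact: ccod_open.
  apply: (cinv_cont ey0); rewrite cmapK //.
  by apply: open_nbhs_nbhs.
move=> /nbhs_ballP[r /= r0 hr].
(* Half the radius, so that the closed Euclidean ball [B] lies inside the open sup-norm ball of
   radius [r]. *)
pose dl := r / 2.
have dl0 : 0 < dl by rewrite divr_gt0.
pose sq (y : 'rV[R]_m) := \sum_j (y 0 j - y0 0 j) * (y 0 j - y0 0 j).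
pose B := [set y | sq y <= dl ^+ 2].
have sqc y j : sq y <= dl ^+ 2 -> `|y 0 j - y0 0 j| <= dl.
  move=> sy; rewrite -(ler_pXn2r (n := 2)) ?nnegrE // ?(ltW dl0) //.
  rewrite real_normK ?num_real //; apply: le_trans sy.
  rewrite /sq (bigD1 j) //= -expr2 lerDl sumr_ge0 // => i _.
  by rewrite -expr2 sqr_ge0.
have BV y : B y -> ccod e y /\ N (cinv e y).
  move=> By; apply: hr; split=> // i j; rewrite (ord1 i) /ball /= distrC.
  by rewrite (le_lt_trans (sqc _ _ By)) // ltr_pdivrMr // ltr_pMr // ltr1n.
have cB : compact B.
  apply: bounded_closed_compact.
    exists (`|y0| + dl); split; first exact: num_real.
    move=> x xb y /= By; apply: le_trans (ltW xb).
    rewrite -(subrK y0 y) addrC (le_trans (ler_normD _ _)) // lerD //.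
    rewrite /Num.Def.normr /= mx_normrE; apply: bigmax_le; first exact: ltW.
    by move=> [i j] _; rewrite (ord1 i) !mxE; exact: sqc.
  apply: (@closed_comp _ _ sq [set z | z <= dl ^+ 2]); last exact: closed_le.
  move=> y _; rewrite /sq.
  have cj j : {for y, continuous (fun y : 'rV[R]_m => y 0 j - y0 0 j)}.
    by apply: continuousB; [exact: (@coord_continuous R 1 m 0 j y)|exact: cst_continuous].
  rewrite (_ : (fun _ => _) = \sum_j (fun y : 'rV[R]_m => (y 0 j - y0 0 j) * (y 0 j - y0 0 j))); last first.
    by apply/funext => z; rewrite fct_sumE.
  elim/big_ind : _ => [|f g cf cg|j _]; first exact: cst_continuous.
    exact: continuousD.
  exact: (continuousM (cj j) (cj j)).
(* [M] is Hausdorff, so the compact set [S] is closed; off [S] the bump vanishes, hence it vanishes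
   on an open set. *)
pose S := cinv e @` B.
have cS : closed S.
  apply: compact_closed; first exact: (mfd_hausdorff (hom_mfd H)).
  apply: continuous_compact cB; apply: continuous_in_subspaceT => y.
  by rewrite inE => /BV[ey _]; exact: cinv_cont.
pose eta x := if `[< cdom e x >] then flat 1 (dl ^+ 2 - sq (cmap e x)) else 0.
have etaS x : ~ S x -> eta x = 0.
  move=> nSx; rewrite /eta; case: asboolP => // ex; apply: flat_eq0.
  rewrite leNgt subr_gt0; apply/negP => lt; apply: nSx.
  by exists (cmap e x); [exact: ltW|exact: cmapK].
exists eta; split.
- by move=> x; rewrite /eta; case: asboolP => // _; exact: flat_ge0.
- rewrite /eta; case: asboolP => // _; apply: flat_gt0.
  rewrite /sq big1 ?subr0 ?exprn_gt0 // => j _.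
  by rewrite subrr mul0r.
- move=> x ex; have [[y By <-]|/etaS e0] := pselect (S x); first by case: (BV _ By).
  by rewrite e0 eqxx in ex.
(* The translated point lies either in the domain of [e], where the explicit formula applies nearby,
   or outside it and so off [S], where the bump is zero nearby. *)
move=> d ad k; apply: sliceCk_local => -[g0 u0] /= du0.
pose al (z : G * 'rV[R]_m) := act H z.1 (cinv d z.2).
have alc z : ccod d z.2 -> {for z, continuous al}.
  by case: z => g u du; exact: act_chart_continuous.
have oal (Q : set M) (Q' : set G) : open Q -> open Q' ->
    open [set z : G * 'rV[R]_m | [/\ Q' z.1, ccod d z.2 & Q (al z)]].
  move=> oQ oQ'; rewrite openE => z [Q'z dz Qz].
  have h1 : \forall w \near z, Q (al w) by apply: (alc _ dz); exact: open_nbhs_nbhs.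
  have h2 : \forall w \near z, ccod d w.2.
    by apply: (@cvg_snd _ _ (nbhs z.1) (nbhs z.2)); by apply: open_nbhs_nbhs; split=> //; exact: ccod_open.
  have h3 : \forall w \near z, Q' w.1.
    by apply: (@cvg_fst _ _ (nbhs z.1) (nbhs z.2)); exact: open_nbhs_nbhs.
  by apply: filterS3 h1 h2 h3.
have [ex0|nex0] := pselect (cdom e (al (g0, u0))).
- have [c ac cg0] := atlas_cover (lie_mfd LG) g0.
  pose O := [set z : G * 'rV[R]_m | [/\ cdom c z.1, ccod d z.2 & cdom e (al z)]].
  have oO : open O by apply: oal; exact: cdom_open.
  exists O; first by split.
  have [_ /(_ c d e ac ad ae k)] := act_smooth H.
  set A := (fun u : 'rV[R]_(n + m) => cmap e _).
  set W := (W in Ck k W A).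
  move=> sA.
  have sj j : sliceCk k O (fun g u => A (row_mx (cmap c g) u) 0 j).
    apply: (sliceCk_Ck j oO sA) => -[g u] /= [cg du eu]; split; first exact: cmap_cont.
    by rewrite /W /= !row_mxKl !row_mxKr cmapK //; split => //; exact: cmap_in.
  have cstS (a : R) : sliceCk k O (fun _ _ => a).
    by apply: (@sliceCk_param _ _ _ k O (cst a)); exact: cst_continuous.
  have s2 : sliceCk k O (fun g u => flat 1 (dl ^+ 2 + (-1) * sq (A (row_mx (cmap c g) u)))).
    apply: sliceCk_flat => //; apply: sliceCkD => //; apply: sliceCkM => //.
    apply: sliceCk_sum => // j.
    by apply: sliceCkM => //; apply: sliceCkD.
  apply: sliceCk_ext s2 => // -[g u] /= [cg du eu].
  rewrite /eta; case: asboolP => // _; rewrite mulN1r /A.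
  by rewrite !row_mxKl !row_mxKr cmapK.
- pose O := [set z : G * 'rV[R]_m | [/\ [set: G] z.1, ccod d z.2 & (~` S) (al z)]].
  have oO : open O by apply: oal; [exact: closed_openC|exact: openT].
  exists O.
    by split=> //= -[y By yx]; apply: nex0; rewrite -yx; apply: cinv_in; case: (BV _ By).
  have c0 : sliceCk k O (fun _ _ => 0).
    by apply: (@sliceCk_param _ _ _ k O (cst 0)); exact: cst_continuous.
  by apply: sliceCk_ext c0 => // -[g u] [_ du nS] /=; rewrite etaS.
Qed.

End HomogeneousSmooth.

(** * Schur orthogonality *)

Section Schur.
Context {R : realType} {G : ptopGroupType}.
Local Notation C := R[i].
Local Open Scope sesquilinear_scope.

(** Schur's lemma. The transposes follow the row-space convention of [irreducible_rep]: an
    eigenspace of [X^T], which exists over an algebraically closed field, is stable under all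
    [(rho g)^T] and hence everything. *)
Lemma irreducible_commutant d (rho : G -> 'M[C]_d) (X : 'M[C]_d) :
  irreducible_rep rho -> (forall h, X *m rho h = rho h *m X) ->
  exists c : C, X = c%:M.
Proof.
case: d rho X => [|d] rho X [] // _ irr Xc.
have [a ra] : exists a, root (char_poly X^T) a.
  by apply/closed_rootP; rewrite size_char_poly.
have := ra; rewrite -eigenvalue_root_char /eigenvalue => W0.
exists a; case: (irr (eigenspace X^T a)) => [g|We|Wf].
- have Xg : (rho g)^T *m (X^T - a%:M) = (X^T - a%:M) *m (rho g)^T.
    by rewrite mulmxBr mulmxBl scalar_mxC -!trmx_mul Xc.
  apply/sub_kermxP; rewrite -mulmxA Xg mulmxA.
  by have /sub_kermxP -> := submx_refl (eigenspace X^T a); rewrite mul0mx.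
- by rewrite We eqxx in W0.
- apply: trmx_inj; rewrite tr_scalar_mx; apply/eqP; rewrite -subr_eq0; apply/eqP.
  apply: (row_full_inj Wf); rewrite mulmx0.
  exact/sub_kermxP/submx_refl.
Qed.

Lemma unitary_irrepV d (pi : G -> 'M[C]_d) h : unitary_irrep pi ->
  (pi h^-1%g)^t* = pi h.
Proof.
move=> [p1 pM pU _ _]; have := pM h h^-1%g; rewrite mulgV p1 => e.
by rewrite -[LHS]mul1mx e -mulmxA (unitarymxP _) ?mulmx1.
Qed.

Lemma trmxC_mul m n p (A : 'M[C]_(m, n)) (B : 'M[C]_(n, p)) :
  (A *m B)^t* = B^t* *m A^t*.
Proof. by rewrite trmx_mul map_mxM. Qed.

Lemma trmxCZ m n (a : C) (A : 'M[C]_(m, n)) : (a *: A)^t* = Num.conj a *: A^t*.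
Proof. by apply/matrixP => i j; rewrite !mxE rmorphM. Qed.

Lemma mxtrace_mulmx_trC m n (A : 'M[C]_(m, n)) :
  \tr (A *m A^t*) = (\sum_i \sum_j normc (A i j) ^+ 2)%:C.
Proof.
rewrite rmorph_sum /mxtrace; apply: eq_bigr => i _; rewrite rmorph_sum mxE.
by apply: eq_bigr => j _; rewrite !mxE mulr_conj.
Qed.

(** Both products of [A] with its adjoint commute with the representations, hence are scalar by
    [irreducible_commutant]. The scalar is common and positive, and dividing [A] by its square root
    makes it unitary. *)
Lemma intertwiner_equiv d d' (pi : G -> 'M[C]_d) (rho : G -> 'M[C]_d') (A : 'M[C]_(d, d')) :
  unitary_irrep pi -> unitary_irrep rho -> (forall h, pi h *m A = A *m rho h) ->
  A <> 0 -> equiv_rep rho pi.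
Proof.
move=> up ur pA A0.
have rA h : A^t* *m pi h = rho h *m A^t*.
  by have := f_equal (fun X => X^t*) (pA h^-1%g); rewrite !trmxC_mul (unitary_irrepV _ up) (unitary_irrepV _ ur).
have [c cE] : exists c : C, A *m A^t* = c%:M.
  case: (up) => _ _ _ _ irr; apply: (irreducible_commutant irr) => h.
  by rewrite -mulmxA rA mulmxA -pA mulmxA.
have [c' cE'] : exists c : C, A^t* *m A = c%:M.
  case: (ur) => _ _ _ _ irr; apply: (irreducible_commutant irr) => h.
  by rewrite -mulmxA -pA mulmxA rA mulmxA.
(* Compute the product of [A], its adjoint and [A] in two ways. *)
have cc : c = c'.
  have : c *: A = c' *: A by rewrite -!mul_scalar_mx -cE -mulmxA cE' scalar_mxC.
  move/eqP; rewrite -subr_eq0 -scalerBl scaler_eq0 subr_eq0 => /orP[/eqP//|/eqP].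
  by move/A0.
have d0 : (0 < d)%N by case: up => _ _ _ _ [].
have c0 : 0 < c.
  have tr : \tr (A *m A^t*) = c * d%:R by rewrite cE mxtrace_scalar mulr_natr.
  have dn : 0 < d%:R :> C by rewrite ltr0n.
  rewrite -(pmulr_lgt0 _ dn) -tr mxtrace_mulmx_trC ltcR lt0r; apply/andP; split; last first.
    by rewrite sumr_ge0 // => i _; rewrite sumr_ge0 // => j _; rewrite sqr_ge0.
  apply/eqP => s0; apply: A0; apply/matrixP => i j; rewrite mxE.
  have s1 : \sum_j normc (A i j) ^+ 2 = 0.
    apply/eqP; move/eqP: s0; rewrite psumr_eq0 => [/allP/(_ i)|k _].
      by rewrite mem_index_enum => /(_ isT).
    by rewrite sumr_ge0 // => l _; rewrite sqr_ge0.
  move/eqP: s1; rewrite psumr_eq0 => [/allP/(_ j)|l _]; last by rewrite sqr_ge0.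
  by rewrite mem_index_enum => /(_ isT); rewrite sqrf_eq0 => /eqP /eq0_normc.
pose s := (sqrtC c)^-1.
have ss : s * Num.conj s * c = 1.
  have sr : Num.conj s = s.
    by apply: CrealP; rewrite rpredV; apply: ger0_real; rewrite sqrtC_ge0 ltW.
  by rewrite sr /s -expr2 exprVn sqrtCK mulVf // gt_eqF.
exists (s *: A); split.
- apply/unitarymxP; rewrite trmxCZ -scalemxAl -scalemxAr scalerA cE.
  by rewrite scale_scalar_mx ss.
- apply/unitarymxP; rewrite trmxCK trmxCZ -scalemxAl -scalemxAr scalerA cE'.
  by rewrite scale_scalar_mx -cc (mulrC (Num.conj s)) ss.
- by move=> x; rewrite -scalemxAl -scalemxAr pA.
Qed.

Section Orthogonality.
Context {dsp : measure_display} {T : measurableType dsp}.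
Variables (P : probability T R) (tau : G -> T -> T).
Hypothesis mtau : forall h, measurable_fun setT (tau h).
Hypothesis Ptau : forall h A, measurable A -> P (tau h @^-1` A) = P A.
Variables (d d' : nat) (pi : G -> 'M[C]_d) (rho : G -> 'M[C]_d').
Variables (f : T -> 'cV[C]_d) (g : T -> 'cV[C]_d').
Hypothesis fm : forall p, bmeas (fun x => f x p 0).
Hypothesis gm : forall p, bmeas (fun x => g x p 0).
Hypothesis fE : forall h x, f (tau h x) = pi h *m f x.
Hypothesis gE : forall h x, g (tau h x) = rho h *m g x.

(** The integral of f(x) g(x)^*. The setting is any probability space with transformations [tau h]
    preserving [P], because orthogonality is needed both on the group under left translation and on
    [M] under the action. *)
Definition gram : 'M[C]_(d, d') :=
  \matrix_(p, q) Cintegral P (fun x => f x p 0 * Num.conj (g x q 0)).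

Let bm p q : bmeas (fun x => f x p 0 * Num.conj (g x q 0)).
Proof. by apply: bmeasM => //; exact: bmeas_conj. Qed.

Lemma gram_intertwines : unitary_irrep rho -> forall h, pi h *m gram = gram *m rho h.
Proof.
move=> ur h.
have bZ p q c : bmeas (fun x => c * (f x p 0 * Num.conj (g x q 0))).
  by apply: bmeasM => //; exact: bmeas_cst.
(* Invariance of [P] gives this conjugation identity; unitarity of [rho h] turns it into an
   intertwining relation. *)
suff e : gram = pi h *m gram *m (rho h)^t*.
  rewrite {2}e -mulmxA.
  have uh : rho h \is unitarymx by case: ur.
  rewrite -[(rho h)^t* *m rho h](_ : 1%:M = _) ?mulmx1 //.
  by rewrite -{2}[rho h]trmxCK; apply/esym/unitarymxP; rewrite trmxC_unitary.
apply/matrixP => p q; rewrite !mxE.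
transitivity (Cintegral P (fun x => f (tau h x) p 0 * Num.conj (g (tau h x) q 0))).
  by rewrite (Cintegral_comp (mtau h) (@Ptau h) (bm p q)).
transitivity (Cintegral P (fun x => \sum_j \sum_i
    (pi h p i * Num.conj (rho h q j)) * (f x i 0 * Num.conj (g x j 0)))).
  congr (Cintegral P _); apply/funext => x; rewrite fE gE !mxE rmorph_sum mulr_sumr.
  apply: eq_bigr => j _; rewrite mulr_suml; apply: eq_bigr => i _.
  by rewrite rmorphM; ring.
rewrite Cintegral_sum; last by move=> j; apply: bmeas_sum => i; exact: bZ.
apply: eq_bigr => j _; rewrite !mxE mulr_suml Cintegral_sum => [|i]; last exact: bZ.
by apply: eq_bigr => i _; rewrite CintegralZ // !mxE; ring.
Qed.

Lemma Cintegral_ortho p q : unitary_irrep pi -> unitary_irrep rho ->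
  ~ equiv_rep rho pi -> Cintegral P (fun x => f x p 0 * Num.conj (g x q 0)) = 0.
Proof.
move=> up ur ne; have [g0|g0] := pselect (gram = 0).
  by have /matrixP/(_ p q) := g0; rewrite !mxE.
by case: ne; apply: (intertwiner_equiv up ur (gram_intertwines ur)).
Qed.

End Orthogonality.

(** The Gram matrix is scalar by Schur's lemma, and its trace is the integral of the constant inner
    product [k], which gives the factor k / d. *)
Lemma Cintegral_schur {dsp : measure_display} {T : measurableType dsp}
    (P : probability T R) (tau : G -> T -> T) d (pi : G -> 'M[C]_d)
    (f g : T -> 'cV[C]_d) (k : C) p q :
  (forall h, measurable_fun setT (tau h)) ->
  (forall h A, measurable A -> P (tau h @^-1` A) = P A) ->
  (forall p, bmeas (fun x => f x p 0)) -> (forall p, bmeas (fun x => g x p 0)) ->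
  (forall h x, f (tau h x) = pi h *m f x) -> (forall h x, g (tau h x) = pi h *m g x) ->
  unitary_irrep pi -> (forall x, \sum_r f x r 0 * Num.conj (g x r 0) = k) ->
  Cintegral P (fun x => f x p 0 * Num.conj (g x q 0)) = (p == q)%:R * (k / d%:R).
Proof.
move=> mt Pt fm gm fE gE up fgk.
case: (up) => _ _ _ _ irr.
have d0 : d%:R != 0 :> C by rewrite pnatr_eq0 -lt0n; case: irr.
have gi := gram_intertwines mt Pt fm gm fE gE up.
have [c cE] := irreducible_commutant irr (fun h => esym (gi h)).
have /matrixP/(_ p q) := cE; rewrite !mxE => ->.
have -> : k / d%:R = c; last by rewrite mulr_natl.
apply: (mulIf d0); rewrite mulfVK // mulr_natr -mxtrace_scalar -cE /mxtrace.
rewrite -(Cintegral_cst P k).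
rewrite (_ : (fun _ => k) = fun x => \sum_r f x r 0 * Num.conj (g x r 0)); last first.
  by apply/funext => x; rewrite fgk.
rewrite Cintegral_sum => [|r]; first by apply: eq_bigr => r _; rewrite mxE.
by apply: bmeasM => //; exact: bmeas_conj.
Qed.

End Schur.

(** Transitivity and compactness cover the space by finitely many translates of [U]. If [U] were
    null they would all be null, against total mass 1. *)
Lemma nbhs_measurable_gt0 (R : realType) (T : ptopologicalType) (I : choiceType)
    (P : probability (borel T) R) (tau : I -> T -> T) (U : set T) :
  compact [set: T] -> (forall g, continuous (tau g)) ->
  (forall g (A : set (borel T)), measurable A -> P (tau g @^-1` A) = P A) ->
  (forall x y, exists g, tau g x = y) -> open U -> U !=set0 -> (0 < P U)%E.
Proof.
move=> cT ct Pt tr oU [u Uu]; rewrite lt_neqAle measure_ge0 andbT eq_sym.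
apply/eqP => PU0.
have mU : @measurable _ (borel T) U by exact: sub_sigma_algebra.
have otau g : open (tau g @^-1` U) by apply: open_comp => // x _; exact: ct.
have := cT; rewrite compact_cover => /(_ I [set: I] (fun g => tau g @^-1` U)) H.
case: H => [||D' _ cov].
- by move=> g _; exact: otau.
- by move=> x _; have [g gx] := tr x u; exists g => //=; rewrite gx.
have : (P setT <= 0)%E.
  have Dfin : finite_set [set` D'] by exact: finite_fset.
  apply: le_trans (content_sub_fsum P (A_ := fun g => tau g @^-1` U) Dfin _ _ cov) _ => //.
  - by move=> g _; apply: sub_sigma_algebra; exact: otau.
  - by rewrite fsbig1 // => g _; rewrite -[RHS]PU0; exact: Pt.
by rewrite leNgt (_ : P setT = 1%E) ?lte01 //; exact: probability_setT.
Qed.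

Lemma Rintegral_gt0 d (T : measurableType d) (R : realType) (P : probability T R)
    (f : T -> R) (U : set T) (c : R) :
  P.-integrable setT (EFin \o f) -> (forall x, 0 <= f x) -> measurable U ->
  (0 < P U)%E -> 0 < c -> (forall x, U x -> c <= f x) -> 0 < (\int[P]_x f x)%R.
Proof.
move=> fi f0 mU PU c0 cf.
have ii : P.-integrable setT (EFin \o (\1_U : T -> R)).
  by apply: bounded_integrable => //; exists 1 => x; rewrite indicE; case: (_ \in _); rewrite ?normr1 ?normr0.
have ic : P.-integrable setT (EFin \o (fun x => c * \1_U x)).
  by have := integrableZl measurableT c ii; apply: eq_integrable.
apply: (@lt_le_trans _ _ (\int[P]_x (c * \1_U x))%R).
  rewrite RintegralZl // mulr_gt0 // /Rintegral integral_indic // setIT fine_gt0 // PU /=.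
  by rewrite (le_lt_trans (probability_le1 _ mU)) // ltry.
apply: le_Rintegral => // x _; rewrite indicE; case: (boolP (x \in U)) => [|_].
  by rewrite inE mulr1; exact: cf.
by rewrite mulr0.
Qed.

Lemma continuous_bmeas (R : realType) (T : ptopologicalType) (f : T -> R[i]) :
  compact [set: T] -> continuous (fun x => complex.Re (f x)) ->
  continuous (fun x => complex.Im (f x)) -> bmeas (f : borel T -> R[i]).
Proof.
move=> cT cR cI; split; first by split; exact: continuous_borel_measurable.
have bd (h : T -> R) : continuous h -> exists B, forall x, `|h x| <= B.
  move=> ch; have := continuous_compact (continuous_subspaceT ch) cT.
  move=> /compact_bounded [B [Br HB]]; exists (B + 1) => x.
  by apply: (HB (B + 1)); [rewrite ltrDl|exists x].
have [A hA] := bd _ cR; have [B hB] := bd _ cI; exists (A + B) => x.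
have -> : f x = (complex.Re (f x))%:C + 'i * (complex.Im (f x))%:C.
  by case: (f x) => a b; simpc.
rewrite (le_trans (normcD_le _ _)) // lerD //; first by rewrite normc_real.
by rewrite normcM normc_real (_ : normc 'i = 1) ?mul1r //= expr0n expr1n add0r sqrtr1.
Qed.

(** * Matrix coefficients on G/K *)

Section Homogeneous.
Context {R : realType} {n m : nat} {G : ptopGroupType} {LG : lie_group R n G}.
Context {K : set G} {M : ptopologicalType}.
Variable H : homogeneous m LG K M.
Hypothesis G_compact : compact [set: G].
Local Notation C := R[i].
Local Notation base := (base H).
Local Notation act := (act H).

Lemma act_continuous_r g : continuous (act g).
Proof.
move=> x; apply: (@continuous_comp _ _ _ (fun x => (g, x)) (fun z : G * M => act z.1 z.2)).
  by apply: continuous_pair; [exact: cst_continuous|exact: cvg_id].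
exact: act_continuous.
Qed.

Lemma act_continuous_l x : continuous (act ^~ x).
Proof.
move=> g; apply: (@continuous_comp _ _ _ (fun g => (g, x)) (fun z : G * M => act z.1 z.2)).
  by apply: continuous_pair; [exact: cvg_id|exact: cst_continuous].
exact: act_continuous.
Qed.

Lemma mulg_continuous_r (h : G) : continuous (fun g => (h * g)%g).
Proof.
move=> x; have [cm _] := lie_mul LG.
apply: (@continuous_comp _ _ _ (fun x => (h, x)) (fun z : G * G => (z.1 * z.2)%g)).
  by apply: continuous_pair; [exact: cst_continuous|exact: cvg_id].
exact: cm.
Qed.

Lemma invg_continuous : continuous (fun g : G => g^-1%g).
Proof. by case: (lie_inv LG). Qed.

Lemma homogeneous_compact : compact [set: M].
Proof.
have <- : act ^~ base @` [set: G] = [set: M].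
  by apply/seteqP; split=> // x _; have [g gx] := act_trans H base x; exists g.
apply: continuous_compact G_compact; apply: continuous_subspaceT.
exact: act_continuous_l.
Qed.

(* The orbit map of a compact group is closed, so continuity on G/K can be
   tested on G. *)
Lemma continuous_descends (Y : topologicalType) (f : M -> Y) (r : G -> Y) :
  continuous r -> (forall g, f (act g base) = r g) -> continuous f.
Proof.
move=> cr fr; apply/continuous_closedP => A cA.
have -> : f @^-1` A = act ^~ base @` (r @^-1` A).
  apply/seteqP; split => [x fx|_ [g rg <-]]; last by rewrite /= fr.
  by have [g gx] := act_trans H base x; exists g; rewrite //= -fr gx.
apply: compact_closed; first exact: (mfd_hausdorff (hom_mfd H)).
apply: continuous_compact.
  by apply: continuous_subspaceT; exact: act_continuous_l.
apply: (subclosed_compact _ G_compact) => //.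
exact: ((continuous_closedP r).1 cr).
Qed.

(** An arbitrary choice of coset representatives, with no continuity. By [section_act] the ambiguity
    is a right factor in [K], which disappears in front of a K-invariant vector. *)
Definition section (x : M) : G := sval (cid (act_trans H base x)).

Lemma sectionK x : act (section x) base = x.
Proof. by rewrite /section; case: cid. Qed.

Lemma section_act g : exists2 h, K h & section (act g base) = (g * h)%g.
Proof.
exists (g^-1 * section (act g base))%g; last by rewrite mulgA mulgV mul1g.
by apply/(stab_base H); rewrite actM sectionK -actM mulVg act1.
Qed.

Section Coefficients.
Variables (d : nat) (pi : G -> 'M[C]_d) (v : 'cV[C]_d).
Hypothesis up : unitary_irrep pi.
Hypothesis vK : invariant_vector K pi v.

Definition orbit_vector (x : M) : 'cV[C]_d := pi (section x) *m v.

Lemma orbit_vector_act g : orbit_vector (act g base) = pi g *m v.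
Proof.
have [h Kh gh] := section_act g; case: up => _ pM _ _ _.
by rewrite /orbit_vector gh pM -mulmxA vK.
Qed.

Lemma orbit_vectorM g x : orbit_vector (act g x) = pi g *m orbit_vector x.
Proof.
case: (up) => _ pM _ _ _.
by rewrite -{1}(sectionK x) -actM orbit_vector_act pM -mulmxA.
Qed.

End Coefficients.

End Homogeneous.

Lemma continuous_borel (T T' : ptopologicalType) (f : T -> T') :
  continuous f -> measurable_fun setT (f : borel T -> borel T').
Proof.
move=> /continuousP cf; apply: (@measurability _ _ (borel T) (borel T') setT f (@open T')) => //.
by move=> _ [A oA <-]; rewrite setTI; apply: sub_sigma_algebra; exact: cf.
Qed.

Lemma continuous_normc (R : realType) (X : topologicalType) (f : X -> R[i]) :
  continuous (f : X -> (R[i])^o) -> continuous (fun x => normc (f x)).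
Proof.
move=> cf x; rewrite (_ : (fun _ => _) =
    (fun x => Num.sqrt (complex.Re (f x) ^+ 2 + complex.Im (f x) ^+ 2))); last first.
  by apply/funext => y; rewrite -normc_sqr sqrtr_sqr ger0_norm ?normc_ge0.
apply: (@continuous_comp _ _ _
  (fun x => complex.Re (f x) ^+ 2 + complex.Im (f x) ^+ 2) (@Num.sqrt R)); last exact: sqrt_continuous.
have cR : {for x, continuous (fun x => complex.Re (f x))} by exact: continuous_Re.
have cI : {for x, continuous (fun x => complex.Im (f x))} by exact: continuous_Im.
exact: (continuousD (continuousM cR cR) (continuousM cI cI)).
Qed.

Lemma continuous_Csum (R : realType) (X : topologicalType) (J : Type) (s : seq J)
    (f : J -> X -> R[i]) : (forall j, continuous (f j : X -> (R[i])^o)) ->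
  continuous ((fun x => \sum_(j <- s) f j x) : X -> (R[i])^o).
Proof.
move=> cf; elim: s => [|j s IH].
  by under eq_fun do rewrite big_nil; exact: cst_continuous.
under eq_fun do rewrite big_cons.
by move=> x; apply: cvgD; [exact: cf|exact: IH].
Qed.

(** * Smoothness of matrix coefficients by averaging *)

Section NearIdentity.
Context {R : realType} {d : nat}.
Local Notation C := R[i].
Local Open Scope sesquilinear_scope.

(** The sesquilinear expression w^* Z w. *)
Definition hform (w : 'cV[C]_d) (Z : 'M[C]_d) : C :=
  \sum_p Num.conj (w p 0) * (Z *m w) p 0.

Lemma hform_trC (w : 'cV[C]_d) (Z : 'M[C]_d) : hform w (Z^t* ) = Num.conj (hform w Z).
Proof.
rewrite /hform conjC_sum.
transitivity (\sum_p \sum_q Num.conj (w p 0) * (Num.conj (Z q p) * w q 0)).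
  apply: eq_bigr => p _; rewrite mxE mulr_sumr; apply: eq_bigr => q _.
  by rewrite !mxE.
rewrite exchange_big; apply: eq_bigr => q _; rewrite conjCM conjCK mxE conjC_sum mulr_sumr.
by apply: eq_bigr => p _; rewrite conjCM mulrCA mulrA mulrC.
Qed.

(** With entries off by at most 1/(2d), the error is at most the sum of |w_p| |w_q| / (2d), hence at
    most |w|^2 / 2. Only the columns in the support of [w] are constrained, since only the first [k]
    columns of a representation will be under control. *)
Lemma hform_near1 (w : 'cV[C]_d) (Z : 'M[C]_d) : (forall p q, w q 0 != 0 ->
    normc (Z p q - (p == q)%:R) <= (2 * d%:R)^-1) ->
  (\sum_p normc (w p 0) ^+ 2) / 2 <= complex.Re (hform w Z).
Proof.
move=> hZ.
have -> : hform w Z = (\sum_p normc (w p 0) ^+ 2)%:C +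
    \sum_p \sum_q Num.conj (w p 0) * ((Z p q - (p == q)%:R) * w q 0).
  have -> : (\sum_p normc (w p 0) ^+ 2)%:C = \sum_p Num.conj (w p 0) * w p 0.
    by rewrite rmorph_sum; apply: eq_bigr => p _; rewrite mulrC mulr_conj.
  rewrite -big_split /=; apply: eq_bigr => p _.
  rewrite -mulr_sumr -mulrDr; congr (_ * _).
  rewrite mxE; under [in RHS]eq_bigr do rewrite mulrBl.
  have e1 : \sum_q (p == q)%:R * w q 0 = w p 0.
    rewrite (bigD1 p) //= eqxx mul1r big1 ?addr0 // => q qp.
    by rewrite eq_sym (negbTE qp) mul0r.
  by rewrite sumrB e1 addrC subrK.
rewrite complex_ReD /=; set E := \sum_p \sum_q _; set S := \sum_p _.
suff : normc E <= S / 2.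
  move=> hE; have := le_trans (Re_le_normc E) hE.
  by rewrite ler_norml => /andP[+ _]; lra.
have S0 : 0 <= S by rewrite sumr_ge0 // => p _; rewrite sqr_ge0.
apply: (@le_trans _ _ (\sum_p \sum_(q < d) (2 * d%:R)^-1 *
    ((normc (w p 0) ^+ 2 + normc (w q 0) ^+ 2) / 2))).
  apply: le_trans (normc_sum _ _ _) _; apply: ler_sum => p _.
  apply: le_trans (normc_sum _ _ _) _; apply: ler_sum => q _.
  rewrite !normcM normc_conj.
  have [->|wq] := eqVneq (w q 0) 0.
    rewrite normc0 !mulr0 expr0n /= addr0; apply: mulr_ge0.
      by rewrite invr_ge0 mulr_ge0.
    by rewrite mulr_ge0 ?sqr_ge0 // invr_ge0.
  have := hZ p q wq; set z := normc _; set e := _^-1; set a := normc _; set b := normc _.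
  move=> ze; have a0 : 0 <= a by exact: normc_ge0.
  have b0 : 0 <= b by exact: normc_ge0.
  have e0 : 0 <= e by rewrite invr_ge0 mulr_ge0.
  rewrite mulrCA; apply: (ler_pM (normc_ge0 _)) => //; first exact: mulr_ge0.
  have := sqr_ge0 (a - b); rewrite !expr2; lra.
under eq_bigr do rewrite -mulr_sumr -mulr_suml big_split /= sumr_const card_ord.
rewrite -mulr_sumr -mulr_suml big_split /= sumr_const card_ord sumrMnl -/S.
have [d0|d0] := eqVneq (d%:R : R) 0.
  by rewrite d0 mulr0 invr0 mul0r divr_ge0.
rewrite -mulr_natr; set D := d%:R in d0 *.
by rewrite le_eqVlt; apply/orP; left; apply/eqP; field.
Qed.

End NearIdentity.

Section SmoothCoefficients.
Context {R : realType} {n m : nat} {G : ptopGroupType} {LG : lie_group R n G}.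
Context {K : set G} {M : ptopologicalType}.
Variable H : homogeneous m LG K M.
Hypothesis G_compact : compact [set: G].
Variable mu : probability (borel G) R.
Hypothesis mu_haar : is_haar mu.
Local Notation C := R[i].
Local Notation base := (base H).
Local Notation act := (act H).
Local Open Scope sesquilinear_scope.

Variables (d : nat) (pi : G -> 'M[C]_d).
Hypothesis up : unitary_irrep pi.

Lemma rep_continuous p q : continuous ((fun g => pi g p q) : G -> C^o).
Proof. by case: up. Qed.

Lemma rep_mul_continuous (u : 'cV[C]_d) p : continuous ((fun g => (pi g *m u) p 0) : G -> C^o).
Proof.
under eq_fun do rewrite mxE.
apply: continuous_Csum => q g; apply: continuousM; first exact: rep_continuous.
exact: cst_continuous.
Qed.

Lemma rep_bmeas (u : 'cV[C]_d) p : bmeas ((fun g => (pi g *m u) p 0) : borel G -> C).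
Proof.
apply: continuous_bmeas => //; first exact/continuous_Re/rep_mul_continuous.
exact/continuous_Im/rep_mul_continuous.
Qed.

Section Average.
Variable eta : M -> R.
Hypothesis eta_smooth : forall c, atlas (hom_mfd H) c -> forall k,
  sliceCk k [set z | ccod c z.2] (fun g u => eta (act g (cinv c u))).

Lemma orbit_bump_continuous x : continuous (fun g => eta (act g^-1%g x)).
Proof.
move=> g; have [c ac cx] := atlas_cover (hom_mfd H) x.
have [ec _] := eta_smooth ac 0.
have -> : (fun g => eta (act g^-1%g x)) = (fun g => eta (act g^-1%g (cinv c (cmap c x)))).
  by rewrite cmapK.
apply: (@continuous_comp _ _ _ (fun g : G => (g^-1%g, cmap c x))
  (fun z : G * 'rV[R]_m => eta (act z.1 (cinv c z.2)))).
  by apply: continuous_pair; [exact: (invg_continuous (LG := LG))|exact: cst_continuous].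
by apply: ec; exact: cmap_in.
Qed.

Definition average (u : 'cV[C]_d) (x : M) : 'cV[C]_d :=
  \col_p Cintegral mu (fun g : borel G => (eta (act g^-1%g x))%:C * (pi g *m u) p 0).

Lemma orbit_bump_bmeas x : bmeas ((fun g => (eta (act g^-1%g x))%:C) : borel G -> C).
Proof.
by apply: continuous_bmeas => //=; [exact: orbit_bump_continuous|exact: cst_continuous].
Qed.

Lemma average_bmeas (u : 'cV[C]_d) x p :
  bmeas ((fun g => (eta (act g^-1%g x))%:C * (pi g *m u) p 0) : borel G -> C).
Proof. by apply: bmeasM; [exact: orbit_bump_bmeas|exact: rep_bmeas]. Qed.

(** Left invariance of Haar measure transfers [h] from the bump function to the representation. *)
Lemma average_act (u : 'cV[C]_d) h x : average u (act h x) = pi h *m average u x.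
Proof.
have pM : forall x y, pi (x * y)%g = pi x *m pi y by case: up.
apply/matrixP => p j; rewrite ord1 !mxE.
have mh : measurable_fun setT ((fun g => (h * g)%g) : borel G -> borel G).
  by apply: continuous_borel; exact: (mulg_continuous_r (LG := LG)).
rewrite -(Cintegral_comp mh (mu_haar h) (average_bmeas u (act h x) p)).
transitivity (Cintegral mu (fun g : borel G =>
    \sum_q pi h p q * ((eta (act g^-1%g x))%:C * (pi g *m u) q 0))).
  congr (Cintegral mu _); apply/funext => g.
  rewrite invgM -actM -mulgA mulVg mulg1 pM -mulmxA mxE mulr_sumr.
  by apply: eq_bigr => q _; rewrite mulrCA.
rewrite Cintegral_sum => [|q]; last first.
  by apply: bmeasM; [exact: bmeas_cst|exact: average_bmeas].
by apply: eq_bigr => q _; rewrite mxE CintegralZ //; exact: average_bmeas.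
Qed.

Lemma average_smooth (u : 'cV[C]_d) p : smooth_complex (hom_mfd H) (fun x => average u x p 0).
Proof.
have main (r : G -> R) : continuous r -> smooth_real (hom_mfd H)
    (fun x => (\int[mu]_g (eta (act g^-1%g x) * r g))%R).
  move=> cr c ac k; apply: Ck_Rintegral => //; first exact: ccod_open.
  have oO : open [set z : G * 'rV[R]_m | ccod c z.2].
    rewrite -[X in open X]/((@snd G 'rV[R]_m) @^-1` ccod c).
    by apply: open_comp; [move=> z _; exact: cvg_snd|exact: ccod_open].
  apply: sliceCkM => //; last exact: sliceCk_param.
  exact: (sliceCk_reparam (invg_continuous (LG := LG)) (eta_smooth ac k)).
split.
- rewrite (_ : (fun x => _) = (fun x => (\int[mu]_g (eta (act g^-1%g x) *
    complex.Re ((pi g *m u) p 0)))%R)); first exact/main/continuous_Re/rep_mul_continuous.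
  apply/funext => x; rewrite mxE Re_Cintegral; apply: eq_Rintegral => g _.
  by rewrite complex_ReM /= mul0r subr0.
- rewrite (_ : (fun x => _) = (fun x => (\int[mu]_g (eta (act g^-1%g x) *
    complex.Im ((pi g *m u) p 0)))%R)); first exact/main/continuous_Im/rep_mul_continuous.
  apply/funext => x; rewrite mxE Im_Cintegral; apply: eq_Rintegral => g _.
  by rewrite complex_ImM /= mul0r addr0.
Qed.

Lemma average_hform (u : 'cV[C]_d) (w : 'cV[C]_d) : \sum_p Num.conj (w p 0) * average u base p 0 =
  Cintegral mu (fun g : borel G => (eta (act g^-1%g base))%:C *
    \sum_p Num.conj (w p 0) * (pi g *m u) p 0).
Proof.
under [in RHS]eq_fun do rewrite mulr_sumr.
rewrite Cintegral_sum => [|p]; last first.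
  apply: bmeasM; first exact: orbit_bump_bmeas.
  by apply: bmeasM; [exact: bmeas_cst|exact: rep_bmeas].
apply: eq_bigr => p _; rewrite mxE -CintegralZ; last exact: average_bmeas.
by congr (Cintegral mu _); apply/funext => g; rewrite mulrCA.
Qed.

End Average.

Variable k : nat.
Hypothesis kP : forall v : 'cV[C]_d, invariant_vector K pi v <->
  (forall j : 'I_d, (k <= j)%N -> v j 0 = 0).

(** The first [k] columns of [pi] descend to continuous functions on [M], so they are close to those
    of the identity as soon as the orbit point is close to [base]. Nothing of the kind is available
    for the other columns. *)
Lemma near_base_rep : exists N : set M, [/\ open N, N base &
  forall g, N (act g base) -> forall p q : 'I_d, (q < k)%N ->
    normc (pi g p q - (p == q)%:R) <= (2 * d%:R)^-1].
Proof.
have d0 : (0 < d)%N by case: up => _ _ _ _ [].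
have e0 : 0 < (2 * d%:R)^-1 :> R by rewrite invr_gt0 mulr_gt0 // ltr0n.
pose f p q x := normc (pi (section H x) p q - (p == q)%:R).
have fg p (q : 'I_d) g : (q < k)%N -> f p q (act g base) = normc (pi g p q - (p == q)%:R).
  move=> qk; rewrite /f; congr (normc (_ - _)).
  have vK : invariant_vector K pi (delta_mx q 0 : 'cV[C]_d).
    apply/kP => j kj; rewrite mxE andbT; case: eqP => // jq.
    by move: kj; rewrite jq leqNgt qk.
  have /matrixP/(_ p 0) := orbit_vector_act H up vK g.
  by rewrite /orbit_vector -!colE !mxE.
have fc p (q : 'I_d) : (q < k)%N -> continuous (f p q).
  move=> qk; apply: (continuous_descends G_compact (r := fun g => normc (pi g p q - (p == q)%:R))).
    apply: (@continuous_normc _ _ (fun g => pi g p q - (p == q)%:R)) => g.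
    by apply: cvgB; [exact: rep_continuous|exact: cvg_cst].
  by move=> g; exact: fg.
have : \forall x \near base, forall pq : 'I_d * 'I_d, (pq.2 < k)%N -> f pq.1 pq.2 x <= (2 * d%:R)^-1.
  apply: filter_forall => -[p q] /=.
  have [qk|qk] := ltnP q k; last by apply: nearW.
  have fb : f p q base = 0.
    have <- : act 1%g base = base by rewrite act1.
    rewrite fg //; case: (up) => -> _ _ _ _; rewrite !mxE subrr.
    exact: normc0.
  have /cvgrPdist_le/(_ _ e0) := fc p q qk base; apply: filterS => x; rewrite fb sub0r normrN => h _.
  exact: le_trans (ler_norm _) h.
rewrite /prop_near1 nbhsE => -[N [oN Nb] hN]; exists N; split=> // g Ng p q qk.
by rewrite -fg //; exact: (hN _ Ng (p, q)).
Qed.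

(* The average of [u] is smooth because the group variable has been moved to the
   bump function, and u |-> average u base is invertible on the K-invariant
   vectors: it is close to a positive multiple of the identity when the bump is
   supported near the base point. *)
Lemma orbit_vector_average (v : 'cV[C]_d) : invariant_vector K pi v ->
  exists eta u, (forall c, atlas (hom_mfd H) c -> forall k,
    sliceCk k [set z | ccod c z.2] (fun g u => eta (act g (cinv c u)))) /\
    forall x, orbit_vector H pi v x = average eta u x.
Proof.
move=> vK.
have [N [oN Nb hN]] := near_base_rep.
have [eta [eta0 etab etaN etaS]] := exists_bump oN Nb.
have p1 : pi 1%g = 1%:M by case: up.
have avK (u : 'cV[C]_d) : invariant_vector K pi (average eta u base).
  by move=> h /(stab_base H) hb; rewrite -average_act // hb.
(* The map u -> [average eta u base] on the first [k] coordinates, completed by the identity.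
   Averages at [base] are K-invariant, so [X] respects the splitting of the coordinates at [k], and
   invertibility can be tested on the whole space. *)
pose X := \matrix_(p, q) (if (q < k)%N then average eta (delta_mx q 0) base p 0 else (p == q)%:R) : 'M[C]_d.
pose tr (w : 'cV[C]_d) := \col_p (if (p < k)%N then w p 0 else 0) : 'cV[C]_d.
have avE (u : 'cV[C]_d) p : average eta u base p 0 = \sum_q u q 0 * average eta (delta_mx q 0) base p 0.
  rewrite mxE.
  transitivity (Cintegral mu (fun g : borel G => \sum_q u q 0 *
      ((eta (act g^-1%g base))%:C * (pi g *m delta_mx q (0 : 'I_1)) p 0))).
    congr (Cintegral mu _); apply/funext => g; rewrite mxE mulr_sumr; apply: eq_bigr => q _.
    by rewrite -colE [col _ _ _ _]mxE mulrA mulrC.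
  rewrite Cintegral_sum => [|q]; last first.
    by apply: bmeasM; [exact: bmeas_cst|exact: average_bmeas].
  by apply: eq_bigr => q _; rewrite CintegralZ ?mxE //; exact: average_bmeas.
have XE (w : 'cV[C]_d) : X *m w = average eta (tr w) base + (w - tr w).
  apply/matrixP => p j; rewrite ord1 [in LHS]mxE [in RHS]mxE avE.
  transitivity (\sum_q ((tr w) q 0 * average eta (delta_mx q 0) base p 0 +
     (p == q)%:R * (w - tr w) q 0)).
    apply: eq_bigr => q _; rewrite [X p q]mxE.
    have -> : (w - tr w) q 0 = w q 0 - tr w q 0 by rewrite !mxE.
    have -> : tr w q 0 = if (q < k)%N then w q 0 else 0 by rewrite mxE.
    by case: ifP => _; rewrite ?subrr ?mulr0 ?addr0 ?mul0r ?add0r ?subr0 // mulrC.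
  rewrite big_split /=; congr (_ + _).
  by rewrite (bigD1 p) //= eqxx mul1r big1 ?addr0 // => q; rewrite eq_sym => /negbTE ->; rewrite mul0r.
have trK (w : 'cV[C]_d) : (forall p : 'I_d, (k <= p)%N -> w p 0 = 0) -> tr w = w.
  by move=> wk; apply/matrixP => p j; rewrite ord1 mxE; case: ltnP => // /wk.
have Xtr (w : 'cV[C]_d) : (forall p : 'I_d, (k <= p)%N -> (X *m w) p 0 = 0) -> tr w = w.
  move=> Xw; apply: trK => p kp; have := Xw p kp.
  rewrite XE mxE ((kP _).1 (avK (tr w)) p kp) add0r !mxE ltnNge kp subr0.
  by [].
have Xinj (w : 'cV[C]_d) : X *m w = 0 -> w = 0.
  move=> Xw; have tw : tr w = w by apply: Xtr => p _; rewrite Xw mxE.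
  have aw : average eta w base = 0 by rewrite -[RHS]Xw XE tw subrr addr0.
  apply/eqP; apply/negPn/negP => w0.
  pose S := \sum_p normc (w p 0) ^+ 2.
  have S0 : 0 < S.
    rewrite lt0r; apply/andP; split; last by rewrite sumr_ge0 // => p _; rewrite sqr_ge0.
    apply: contra w0 => /eqP S0; apply/eqP/matrixP => p j; rewrite ord1 mxE.
    move/eqP: S0; rewrite psumr_eq0 => [/allP/(_ p)|q _]; last by rewrite sqr_ge0.
    by rewrite mem_index_enum => /(_ isT); rewrite sqrf_eq0 => /eqP /eq0_normc.
  (* The neighbourhood controls [pi g^-1], the adjoint of [pi g]; passing to the adjoint conjugates
     the form and keeps its real part. *)
  have hf g : N (act g^-1%g base) -> S / 2 <= complex.Re (hform w (pi g)).
    move=> Ng; rewrite -[pi g](unitary_irrepV g up) hform_trC complex_Re_conj.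
    apply: hform_near1 => p q wq; apply: hN => //.
    rewrite ltnNge; apply: contra wq => kq.
    by have := f_equal (fun A : 'cV[C]_d => A q 0) tw; rewrite mxE ltnNge kq /= => ->.
  pose ph g := eta (act g^-1%g base) * complex.Re (hform w (pi g)).
  have cph : continuous ph.
    move=> g; apply: continuousM; first exact: orbit_bump_continuous.
    apply: continuous_Re; apply: continuous_Csum => p h; apply: continuousM; first exact: cst_continuous.
    exact: rep_mul_continuous.
  have ph0 g : 0 <= ph g.
    rewrite /ph; have [->|/etaN/hf h] := eqVneq (eta (act g^-1%g base)) 0.
      by rewrite mul0r.
    rewrite mulr_ge0 //; apply: le_trans h; rewrite divr_ge0 // ltW //.
  have c0 : 0 < eta base * (S / 2) / 2 by rewrite !divr_gt0 // mulr_gt0 // divr_gt0.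
  (* A neighbourhood of the identity, cut at half the lower bound of [ph 1]. Its positive Haar
     measure makes the integral of [ph] positive, against [aw]. *)
  pose U := [set g : G | eta base * (S / 2) / 2 < ph g].
  have oU : open U.
    rewrite -[X in open X]/(ph @^-1` [set r | eta base * (S / 2) / 2 < r]).
    by apply: open_comp; [move=> g _; exact: cph|exact: open_gt].
  have U1 : U 1%g.
    rewrite /U /ph /= invg1 act1; apply: (@lt_le_trans _ _ (eta base * (S / 2))).
      by rewrite ltr_pdivrMr // ltr_pMr ?ltr1n // mulr_gt0 // divr_gt0.
    by rewrite ler_pM2l //; apply: hf; rewrite invg1 act1.
  have PU : (0 < mu U)%E.
    apply: (@nbhs_measurable_gt0 R G G mu (fun h g => (h * g)%g)) => //.
    - by move=> h; exact: (mulg_continuous_r (LG := LG)).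
    - by move=> x y; exists (y * x^-1)%g; rewrite -mulgA mulVg mulg1.
    - by exists 1%g.
  have mU : @measurable _ (borel G) U by exact: sub_sigma_algebra.
  have := Rintegral_gt0 (continuous_integrable G_compact mu cph) ph0 mU PU c0
    (fun g Ug => ltW Ug).
  have -> : (\int[mu]_g ph g)%R = complex.Re (\sum_p Num.conj (w p 0) * average eta w base p 0).
    rewrite average_hform // Re_Cintegral; apply: eq_Rintegral => g _.
    by rewrite complex_ReM /= mul0r subr0.
  by rewrite aw; under eq_bigr do rewrite mxE mulr0; rewrite big1 // ltxx.
have Xu : X \in unitmx.
  rewrite -unitmx_tr -row_free_unit; apply: inj_row_free => w Xw.
  apply: trmx_inj; rewrite trmx0; apply: Xinj.
  by apply: trmx_inj; rewrite trmx_mul trmxK Xw trmx0.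
pose u := invmx X *m v.
have XuE : X *m u = v by rewrite mulKVmx.
have tu : tr u = u by apply: Xtr => p kp; rewrite XuE; exact: (kP v).1.
exists eta, u; split=> // x.
have vE : v = average eta u base by rewrite -XuE XE tu subrr addr0.
rewrite -[in RHS](sectionK H x) average_act // -vE.
by rewrite /orbit_vector.
Qed.

Lemma orbit_vector_smooth (v : 'cV[C]_d) p : invariant_vector K pi v ->
  smooth_complex (hom_mfd H) (fun x => orbit_vector H pi v x p 0).
Proof.
move=> /orbit_vector_average [eta [u [etaS E]]].
rewrite (_ : (fun x => _) = fun x => average eta u x p 0); first exact: average_smooth.
by apply/funext => x; rewrite E.
Qed.

Lemma orbit_vector_continuous (v : 'cV[C]_d) p : invariant_vector K pi v ->
  continuous (fun x => complex.Re (orbit_vector H pi v x p 0)) /\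
  continuous (fun x => complex.Im (orbit_vector H pi v x p 0)).
Proof.
move=> vK; split.
- apply: (continuous_descends (H := H) G_compact (r := fun g => complex.Re ((pi g *m v) p 0))).
    exact/continuous_Re/rep_mul_continuous.
  by move=> g; rewrite [orbit_vector _ _ _ _](orbit_vector_act H up vK g).
- apply: (continuous_descends (H := H) G_compact (r := fun g => complex.Im ((pi g *m v) p 0))).
    exact/continuous_Im/rep_mul_continuous.
  by move=> g; rewrite [orbit_vector _ _ _ _](orbit_vector_act H up vK g).
Qed.

Lemma orbit_vector_bmeas (v : 'cV[C]_d) p : invariant_vector K pi v ->
  bmeas ((fun x => orbit_vector H pi v x p 0) : borel M -> C).
Proof.
move=> vK; have [cR cI] := orbit_vector_continuous p vK.
by apply: continuous_bmeas => //; exact: (homogeneous_compact H).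
Qed.

End SmoothCoefficients.

(** * A Hausdorff-Young inequality *)

Section Interpolation.
Context {R : realType}.

(** A geometric sum is dominated by its last term, and the last admissible power 2^l is at most
    [t]. *)
Lemma dyadic_sum_le (t b : R) (N : nat) : 0 < t -> 0 < b ->
  \sum_(l < N | 2 ^+ l <= t) (2 `^ b) ^+ l <= 2 `^ b / (2 `^ b - 1) * t `^ b.
Proof.
move=> t0 b0; set r := 2 `^ b.
have r1 : 1 < r.
  have := @gt0_ltr_powR R b b0 1 2; rewrite !nnegrE powR1.
  by apply=> //; rewrite ltr1n.
have r10 : 0 < r - 1 by rewrite subr_gt0.
have r0 : 0 < r by exact: lt_trans r1.
elim: N => [|N IH]; first by rewrite big_ord0 mulr_ge0 ?divr_ge0 ?powR_ge0 // ltW.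
rewrite big_mkcond big_ord_recr /= -big_mkcond /=.
case: ifP => [Nt|_]; last by rewrite addr0.
have geo n : \sum_(l < n) r ^+ l = (r ^+ n - 1) / (r - 1).
  rewrite [X in X / _](_ : _ = (r - 1) * \sum_(l < n) r ^+ l); last exact: subrX1.
  by rewrite mulrAC divff ?mul1r // gt_eqF.
apply: (@le_trans _ _ (\sum_(l < N.+1) r ^+ l)).
  rewrite big_ord_recr /= lerD2r big_mkcond; apply: ler_sum => l _.
  by case: ifP => // _; rewrite exprn_ge0 // ltW.
rewrite geo mulrAC ler_pM2r ?invr_gt0 //.
apply: (@le_trans _ _ (r ^+ N.+1)); first by rewrite lerBlDr lerDl ler01.
rewrite exprS ler_pM2l // -powR_mulrn ?(ltW r0) // /r powRAC powR_mulrn //.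
by apply: ge0_ler_powR; rewrite ?nnegrE ?exprn_ge0 // ltW.
Qed.

(** Write x^p = x^{p-2} x^2. The upper end of the shell bounds the first factor; the lower end gives
    2^l < x/2, so x <= 2y bounds the second. *)
Lemma powR_le_dyadic (p x y : R) (l : nat) : 2 <= p -> 0 <= y ->
  2 ^+ l.+1 < x -> x <= 2 ^+ l.+2 -> x - 2 ^+ l <= y ->
  x `^ p <= 4 * 4 `^ (p - 2) * (2 `^ (p - 2)) ^+ l * y ^+ 2.
Proof.
move=> p2 y0 x1 x2 xy; have x0 : 0 < x by rewrite (le_lt_trans _ x1) // exprn_ge0.
have -> : x `^ p = x `^ (p - 2) * x ^+ 2.
  by rewrite -(powR_mulrn _ (ltW x0)) -powRD ?(gt_eqF x0) ?implybT // subrK.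
have h1 : x `^ (p - 2) <= 4 `^ (p - 2) * (2 `^ (p - 2)) ^+ l.
  rewrite -(powR_mulrn l (powR_ge0 _ _)) powRAC powR_mulrn // -powRM ?exprn_ge0 //.
  apply: ge0_ler_powR; rewrite ?nnegrE ?subr_ge0 ?mulr_ge0 ?exprn_ge0 ?(ltW x0) //.
  by apply: le_trans x2 _; rewrite !exprS mulrA -natrM.
have h2 : x ^+ 2 <= 4 * y ^+ 2.
  have xy2 : x <= 2 * y by move: x1 xy; rewrite exprS; lra.
  rewrite (_ : 4 * y ^+ 2 = (2 * y) ^+ 2); last by rewrite exprMn -natrX.
  by rewrite ler_pXn2r // nnegrE ?mulr_ge0 // ltW.
apply: (le_trans (ler_pM (powR_ge0 _ _) (sqr_ge0 _) h1 h2)).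
by rewrite le_eqVlt; apply/orP; left; apply/eqP; ring.
Qed.

Lemma exists_dyadic (x : R) (N : nat) : 2 < x -> x <= 2 ^+ N.+1 ->
  exists l : 'I_N, 2 ^+ l.+1 < x /\ x <= 2 ^+ l.+2.
Proof.
move=> x2; elim: N => [|N IH] xN; first by move: xN; rewrite expr1 leNgt x2.
have [/IH[l hl]|Nx] := leP x (2 ^+ N.+1); first by exists (widen_ord (leqnSn N) l).
by exists ord_max.
Qed.

(* The second summand is the geometric series produced by the dyadic truncation;
   it degenerates at p = 2, where no interpolation is needed. *)
Definition HYconst (p : R) : R := 2 `^ p +
  (if p == 2 then 1 else 4 * 4 `^ (p - 2) * (2 `^ (p - 2) / (2 `^ (p - 2) - 1))).

(* Marcinkiewicz interpolation, by hand, between the bound L^1 -> L^oo given by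
   the size hypothesis and the bound L^2 -> L^2 given by almost orthogonality. *)
Lemma interpolation_bound {dsp : measure_display} {T : measurableType dsp}
    (P : probability T R) (p : R) (I : eqType) (s : seq I)
    (f : I -> T -> R[i]) (w a : I -> R) : 2 <= p ->
  (forall i, bmeas (f i)) -> (forall i, 0 <= w i) -> (forall i, 0 <= a i) ->
  (forall i x, normc (f i x) <= w i * a i) ->
  (forall Q : pred I, (\int[P]_x normc (\sum_(i <- s | Q i) f i x) ^+ 2)%R <=
     \sum_(i <- s | Q i) w i * a i ^+ 2) ->
  \sum_(i <- s) w i * a i `^ (p / (p - 1)) <= 1 ->
  (\int[P]_x (normc (\sum_(i <- s) f i x) `^ p))%R <= HYconst p.
Proof.
move=> p2 bf w0 a0 fwa f2 sa1.
have p0 : 0 < p by lra.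
have p10 : 0 < p - 1 by lra.
pose F x := normc (\sum_(i <- s) f i x).
pose FQ (Q : pred I) x := normc (\sum_(i <- s | Q i) f i x).
have mFQ Q : measurable_fun setT (FQ Q).
  by apply: Cmeasurable_normc; case: (bmeas_sum s Q bf).
pose L := \sum_(i <- s) w i * a i.
have L0 : 0 <= L by rewrite sumr_ge0 // => i _; rewrite mulr_ge0.
have FQL Q x : FQ Q x <= L.
  apply: (le_trans (normc_sum _ _ _)); rewrite big_mkcond; apply: ler_sum => i _.
  by case: ifP => _ //; rewrite mulr_ge0.
have i2 Q (c : R) : P.-integrable setT (EFin \o (fun x => c * FQ Q x ^+ 2)).
  apply: bounded_integrable; first by apply: measurable_funM => //; exact: measurable_funX.
  exists (`|c| * L ^+ 2) => x; rewrite normrM ler_wpM2l // ger0_norm ?exprn_ge0 ?normc_ge0 //.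
  by rewrite ler_pXn2r // nnegrE ?normc_ge0.
have FE : (fun x => normc (\sum_(i <- s) f i x)) = FQ predT by [].
have ip : P.-integrable setT (EFin \o (fun x => FQ predT x `^ p)).
  apply: bounded_integrable; first exact: (measurableT_comp (measurable_powR p)).
  exists (L `^ p) => x; rewrite ger0_norm ?powR_ge0 //.
  by apply: ge0_ler_powR; rewrite ?nnegrE ?normc_ge0 // ltW.
(* At p = 2 the dual exponent p/(p-1) is 2 and the hypothesis on squares is already the claim. *)
rewrite /HYconst; case: eqP => [pe|/eqP pn2].
  have -> : (\int[P]_x (normc (\sum_(i <- s) f i x) `^ p))%R =
      (\int[P]_x normc (\sum_(i <- s | predT i) f i x) ^+ 2)%R.
    by apply: eq_Rintegral => x _; rewrite pe powR_mulrn ?normc_ge0.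
  apply: (le_trans (f2 predT)); apply: (@le_trans _ _ 1); last by rewrite lerDr powR_ge0.
  apply: le_trans sa1; rewrite le_eqVlt; apply/orP; left; apply/eqP.
  apply: eq_bigr => i _; rewrite pe (_ : 2 / (2 - 1) = 2%:R) ?powR_mulrn //.
  by field; rewrite -?[2]/(2%:R) ; lra.
have pp2 : 0 < p - 2 by rewrite subr_gt0 lt_neqAle p2 eq_sym pn2.
pose al := (p - 1)^-1.
(* Truncation at level [l]: indices with a_i <= 2^{-l(p-1)} are kept. Zero sizes are kept by a
   separate clause, because a negative power of 0 evaluates to 0. *)
pose Q l i := (a i == 0) || (2 ^+ l <= a i `^ (- al)).
have [N hN] : exists N : nat, L <= 2 ^+ N.+1.
  exists (Num.truncn L).+1; apply: (le_trans (ltW (truncnS_gt L))).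
  rewrite -natrX ler_nat; apply: (leq_trans (ltnW (ltn_expl _ (isT : (1 < 2)%N)))).
  by rewrite leq_exp2l.
set D := 4 * 4 `^ (p - 2); set r := 2 `^ (p - 2).
have D0 : 0 <= D by rewrite mulr_ge0 ?powR_ge0.
have r0 : 0 <= r by exact: powR_ge0.
(* The discarded part is at most 2^l by the sup bound: w a = w a^{p/(p-1)} a^{-1/(p-1)}, the last
   factor is below 2^l, and the remaining weights sum to at most 1. *)
have rest (l : nat) x : FQ predT x - 2 ^+ l <= FQ (Q l) x.
  rewrite lerBlDr /FQ (bigID (Q l)) /=; apply: (le_trans (normcD_le _ _)).
  rewrite lerD2l; apply: (le_trans (normc_sum _ _ _)).
  apply: (@le_trans _ _ (\sum_(i <- s) 2 ^+ l * (w i * a i `^ (p / (p - 1))))).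
    rewrite big_mkcond; apply: ler_sum => i _; case: ifPn => [|_]; last first.
      by rewrite !mulr_ge0 ?powR_ge0 ?exprn_ge0.
    rewrite negb_or => /andP[ai]; rewrite -ltNge => lt; apply: (le_trans (fwa i x)).
    have aE : a i = a i `^ (- al) * a i `^ (p / (p - 1)).
      rewrite -powRD ?ai ?implybT // -[LHS]powRr1 //; congr (_ `^ _).
      by rewrite /al; field; rewrite gt_eqF.
    by rewrite mulrCA ler_wpM2l // {1}aE ler_wpM2r ?powR_ge0 // ltW.
  by rewrite -mulr_sumr -[leRHS]mulr1 ler_wpM2l ?exprn_ge0.
(* Values up to 2 account for the term 2^p. A larger value lies in one of the [N] dyadic shells,
   enough of them because the sum is bounded by [L]. *)
have pw x : FQ predT x `^ p <= 2 `^ p + \sum_(l < N) D * r ^+ l * FQ (Q l) x ^+ 2.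
  have S0 : 0 <= \sum_(l < N) D * r ^+ l * FQ (Q l) x ^+ 2.
    by apply: sumr_ge0 => l _; rewrite !mulr_ge0 ?exprn_ge0 ?normc_ge0.
  have [le2|gt2] := leP (FQ predT x) 2.
    apply: ler_wpDr => //; apply: ge0_ler_powR; rewrite ?nnegrE ?normc_ge0 //.
    exact: ltW.
  have [l [l1 l2]] := exists_dyadic gt2 (le_trans (FQL _ x) hN).
  apply: (le_trans (powR_le_dyadic p2 (normc_ge0 _) l1 l2 (rest l x))).
  apply: ler_wpDl; first exact: powR_ge0.
  rewrite (bigD1 l) //= lerDl sumr_ge0 // => j _.
  by rewrite !mulr_ge0 ?exprn_ge0 ?normc_ge0.
have isum : P.-integrable setT (EFin \o (fun x => 2 `^ p + \sum_(l < N) D * r ^+ l * FQ (Q l) x ^+ 2)).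
  apply: bounded_integrable.
    apply: measurable_funD => //; apply: measurable_sum => l.
    by apply: measurable_funM => //; exact: measurable_funX.
  exists (2 `^ p + \sum_(l < N) D * r ^+ l * L ^+ 2) => x.
  rewrite ger0_norm ?addr_ge0 ?powR_ge0 ?sumr_ge0 //; last first.
    by move=> l _; rewrite !mulr_ge0 ?exprn_ge0 ?normc_ge0.
  rewrite lerD2l; apply: ler_sum => l _; rewrite ler_wpM2l ?mulr_ge0 ?exprn_ge0 //.
  by rewrite ler_pXn2r // nnegrE ?normc_ge0.
apply: (le_trans (le_Rintegral measurableT ip isum (fun x _ => pw x))).
have Rsum n (h : nat -> T -> R) : (forall l, P.-integrable setT (EFin \o h l)) ->
    P.-integrable setT (EFin \o (fun x => \sum_(l < n) h l x)) /\
    (\int[P]_x (\sum_(l < n) h l x))%R = \sum_(l < n) (\int[P]_x h l x)%R.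
  move=> ih; elim: n => [|n [IH1 IH2]].
    split; last first.
      by rewrite big_ord0; under eq_Rintegral do rewrite big_ord0; rewrite Rintegral_cst // mul0r.
    apply: bounded_integrable; first by apply: measurable_sum => -[].
    by exists 0 => x; rewrite big_ord0 normr0.
  split.
    have := integrableD measurableT IH1 (ih n); apply: eq_integrable => // x _ /=.
    by rewrite big_ord_recr.
  under eq_Rintegral do rewrite big_ord_recr.
  by rewrite RintegralD // IH2 big_ord_recr.
have [iS eS] := Rsum N (fun l x => D * r ^+ l * FQ (Q l) x ^+ 2) (fun l => i2 _ _).
rewrite RintegralD //; last by apply: bounded_integrable => //; exists `|2 `^ p|.
rewrite Rintegral_cst // eS lerD //.
  by rewrite (_ : fine _ = 1) ?mulr1 //; exact: (f_equal fine (probability_setT P)).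
have ia l : P.-integrable setT (EFin \o (fun x => FQ (Q l) x ^+ 2)).
  by have := i2 (Q l) 1; under eq_fun do rewrite mul1r.
apply: (@le_trans _ _ (\sum_(l < N) \sum_(i <- s) D * (w i * (if Q l i then r ^+ l * a i ^+ 2 else 0)))).
  apply: ler_sum => l _; rewrite RintegralZl //.
  apply: (le_trans (ler_wpM2l _ (f2 (Q l)))); first by rewrite mulr_ge0 ?exprn_ge0.
  rewrite mulr_sumr big_mkcond; apply: ler_sum => i _; case: ifP => _; last by rewrite !mulr0.
  by rewrite le_eqVlt; apply/orP; left; apply/eqP; ring.
rewrite exchange_big /=.
set A := r / (r - 1).
have r1 : 1 < r.
  have := @gt0_ltr_powR R _ pp2 1 2; rewrite !nnegrE powR1; apply=> //.
  by rewrite ltr1n.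
have A0 : 0 <= A by rewrite divr_ge0 // subr_ge0 ltW.
apply: (@le_trans _ _ (D * A * \sum_(i <- s) w i * a i `^ (p / (p - 1)))); last first.
  by rewrite -[leRHS]mulr1 ler_wpM2l // mulr_ge0.
rewrite mulr_sumr; apply: ler_sum => i _; rewrite -mulr_sumr -mulr_sumr -mulrA ler_wpM2l //.
rewrite [leRHS]mulrCA ler_wpM2l //.
have [ai|ai] := eqVneq (a i) 0.
  rewrite big1 => [|l _]; first by apply: mulr_ge0 => //; exact: powR_ge0.
  by rewrite ai expr0n /= mulr0; case: ifP.
have ai0 : 0 < a i by rewrite lt0r ai a0.
have t0 : 0 < a i `^ (- al) by exact: powR_gt0.
(* The exponents match, 2 - (p-2)/(p-1) = p/(p-1), so for fixed [i] the sum over levels is the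
   geometric sum of [dyadic_sum_le] with t = a_i^{-1/(p-1)}. *)
have -> : a i `^ (p / (p - 1)) = (a i `^ (- al)) `^ (p - 2) * a i ^+ 2.
  rewrite -powRrM -(powR_mulrn _ (a0 i)) -powRD ?ai ?implybT //; congr (_ `^ _).
  by rewrite /al; field; rewrite gt_eqF.
rewrite mulrA; apply: le_trans (ler_wpM2r (sqr_ge0 _) (dyadic_sum_le N t0 pp2)).
rewrite mulr_suml [leRHS]big_mkcond; apply: ler_sum => l _.
by rewrite /Q (negbTE ai) /=; case: ifP.
Qed.

End Interpolation.

(** By Lagrange's identity, which writes twice the defect as a double sum of squares. *)
Lemma cauchy_schwarz_sum (R : realType) (J : finType) (Q : pred J) (u v : J -> R) :
  (forall j, 0 <= u j) -> (forall j, 0 <= v j) ->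
  \sum_(j | Q j) u j * v j <=
  Num.sqrt (\sum_(j | Q j) u j ^+ 2) * Num.sqrt (\sum_(j | Q j) v j ^+ 2).
Proof.
move=> u0 v0; have s0 (z : J -> R) : 0 <= \sum_(j | Q j) z j ^+ 2.
  by rewrite sumr_ge0 // => j _; rewrite sqr_ge0.
rewrite -sqrtrM //; apply: le_trans (ler_norm _) _; rewrite -sqrtr_sqr ler_wsqrtr //.
have : 0 <= \sum_(i | Q i) \sum_(j | Q j) (u i * v j - u j * v i) ^+ 2.
  by apply: sumr_ge0 => i _; apply: sumr_ge0 => j _; exact: sqr_ge0.
have -> : \sum_(i | Q i) \sum_(j | Q j) (u i * v j - u j * v i) ^+ 2 =
    2 * ((\sum_(j | Q j) u j ^+ 2) * (\sum_(j | Q j) v j ^+ 2) - (\sum_(j | Q j) u j * v j) ^+ 2).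
  transitivity (\sum_(i | Q i) \sum_(j | Q j) (u i ^+ 2 * v j ^+ 2)
     + \sum_(i | Q i) \sum_(j | Q j) (v i ^+ 2 * u j ^+ 2)
     - 2 * \sum_(i | Q i) \sum_(j | Q j) ((u i * v i) * (u j * v j))).
    rewrite mulr_sumr -big_split -sumrB; apply: eq_bigr => i _ /=.
    rewrite mulr_sumr -big_split -sumrB; apply: eq_bigr => j _ /=; ring.
  have e (x y : J -> R) : \sum_(i | Q i) \sum_(j | Q j) (x i * y j) =
      (\sum_(i | Q i) x i) * (\sum_(j | Q j) y j).
    by rewrite mulr_suml; apply: eq_bigr => i _; rewrite mulr_sumr.
  rewrite !(e (fun _ => _)); ring.
by rewrite pmulr_rge0 // subr_ge0.
Qed.

(** * Orthogonality and Fourier transforms of the coefficients *)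

Section Coefficients.
Context {R : realType} {n m : nat} {G : ptopGroupType} {LG : lie_group R n G}.
Context {K : set G} {M : ptopologicalType} {I : choiceType}.
Variables (H : homogeneous m LG K M) (Gh : class_one_dual R K I).
Hypothesis G_compact : compact [set: G].
Local Notation C := R[i].
Local Notation rdim := (rdim Gh).
Local Notation kdim := (kdim Gh).
Local Open Scope sesquilinear_scope.

Local Notation idx i := ('I_(rdim i) * 'I_(rdim i))%type.

(** For [rs.2 < kdim i] this is the descended matrix coefficient ([coef_act]). For the other columns
    it depends on the choice made by [section]. *)
Definition coef (i : I) (rs : idx i) (x : M) : C :=
  orbit_vector H (rep Gh i) (delta_mx rs.2 0) x rs.1 0.

Lemma delta_invariant i (s : 'I_(rdim i)) : (s < kdim i)%N ->
  invariant_vector K (rep Gh i) (delta_mx s 0).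
Proof.
move=> sk; apply/kdimP => j kj; rewrite mxE andbT; case: eqP => // js.
by move: kj; rewrite js leqNgt sk.
Qed.

Lemma rdim_gt0 i : (0 < rdim i)%N.
Proof. by case: (rep_irr Gh i) => _ _ _ _ []. Qed.

Lemma kdim_gt0 i : (0 < kdim i)%N.
Proof.
have [v v0 vK] := rep_class_one Gh i; rewrite lt0n; apply: contra v0 => /eqP k0.
apply/eqP/matrixP => p q; rewrite ord1 mxE; move/kdimP : vK; apply.
by rewrite k0.
Qed.

Lemma coef_act i (rs : idx i) g : (rs.2 < kdim i)%N ->
  coef (i := i) rs (act H g (base H)) = rep Gh i g rs.1 rs.2.
Proof.
move=> sk; rewrite /coef (orbit_vector_act H (rep_irr Gh i) (delta_invariant sk)).
by rewrite -colE mxE.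
Qed.

Lemma coef_bmeas i (rs : idx i) : (rs.2 < kdim i)%N -> bmeas (coef (i := i) rs : borel M -> C).
Proof.
move=> sk; apply: orbit_vector_bmeas => //; [exact: rep_irr|exact: delta_invariant].
Qed.

Lemma coef_smooth (mu : probability (borel G) R) i (rs : idx i) : is_haar mu -> (rs.2 < kdim i)%N ->
  smooth_complex (hom_mfd H) (coef (i := i) rs).
Proof.
move=> hmu sk; have h v := @kdimP _ _ _ _ Gh i v.
exact: (orbit_vector_smooth H G_compact hmu (rep_irr Gh i) h rs.1 (delta_invariant sk)).
Qed.

Lemma unitary_column_dot d (U : 'M[C]_d) s q : U \is unitarymx ->
  \sum_r (U *m delta_mx s (0 : 'I_1)) r 0 * Num.conj ((U *m delta_mx q (0 : 'I_1)) r 0) = (s == q)%:R.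
Proof.
move=> Uu; have : U^t* *m U = 1%:M.
  by rewrite -{2}[U]trmxCK; apply/unitarymxP; rewrite trmxC_unitary.
move=> /matrixP/(_ q s); rewrite !mxE eq_sym => <-.
by apply: eq_bigr => r _; rewrite -!colE !mxE mulrC.
Qed.

Lemma coef_column_norm i (s : 'I_(rdim i)) x :
  \sum_r normc (coef (r, s) x) ^+ 2 = 1.
Proof.
have Uu : rep Gh i (section H x) \is unitarymx by case: (rep_irr Gh i).
have := unitary_column_dot s s Uu; rewrite eqxx => e.
apply: (@complexI R); rewrite rmorph_sum -[RHS]e; apply: eq_bigr => r _.
by rewrite mulr_conj.
Qed.

Section OrthoM.
Variable nu : probability (borel M) R.
Hypothesis nu_inv : is_invariant (act H) nu.

Let mact g : measurable_fun setT (act H g : borel M -> borel M).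
Proof. by apply: continuous_borel; exact: act_continuous_r. Qed.

Lemma coef_ortho i j (rs : idx i) (pq : idx j) : i != j -> (rs.2 < kdim i)%N -> (pq.2 < kdim j)%N ->
  Cintegral nu (fun x : borel M => coef (i := i) rs x * Num.conj (coef (i := j) pq x)) = 0.
Proof.
move=> ij sk qk.
apply: (@Cintegral_ortho R G _ (borel M) nu (act H) mact nu_inv _ _ (rep Gh i) (rep Gh j)
  (orbit_vector H (rep Gh i) (delta_mx rs.2 0)) (orbit_vector H (rep Gh j) (delta_mx pq.2 0))).
- by move=> p; apply: (@coef_bmeas i (p, rs.2)).
- by move=> p; apply: (@coef_bmeas j (p, pq.2)).
- by move=> h x; apply: orbit_vectorM; [exact: rep_irr|exact: delta_invariant].
- by move=> h x; apply: orbit_vectorM; [exact: rep_irr|exact: delta_invariant].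
- exact: rep_irr.
- exact: rep_irr.
- by move/rep_inj => ji; rewrite ji eqxx in ij.
Qed.

Lemma coef_ortho_same i (rs pq : idx i) : (rs.2 < kdim i)%N -> (pq.2 < kdim i)%N ->
  Cintegral nu (fun x : borel M => coef (i := i) rs x * Num.conj (coef (i := i) pq x)) =
  (rs == pq)%:R / (rdim i)%:R.
Proof.
move=> sk qk.
rewrite (@Cintegral_schur R G _ (borel M) nu (act H) _ (rep Gh i)
  (orbit_vector H (rep Gh i) (delta_mx rs.2 0)) (orbit_vector H (rep Gh i) (delta_mx pq.2 0))
  (rs.2 == pq.2)%:R) //.
- by rewrite mulrA -natrM mulnb; case: rs pq {sk qk} => [a b] [c e].
- by move=> p; apply: (@coef_bmeas i (p, rs.2)).
- by move=> p; apply: (@coef_bmeas i (p, pq.2)).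
- by move=> h x; apply: orbit_vectorM; [exact: rep_irr|exact: delta_invariant].
- by move=> h x; apply: orbit_vectorM; [exact: rep_irr|exact: delta_invariant].
- exact: rep_irr.
- by move=> x; apply: unitary_column_dot; case: (rep_irr Gh i).
Qed.

End OrthoM.

Section OrthoG.
Variable mu : probability (borel G) R.
Hypothesis mu_haar : is_haar mu.

Let mmul h : measurable_fun setT ((fun g => (h * g)%g) : borel G -> borel G).
Proof. by apply: continuous_borel; exact: (mulg_continuous_r (LG := LG)). Qed.

Let rep_equiv i (s : 'I_(rdim i)) h x :
  rep Gh i (h * x)%g *m delta_mx s (0 : 'I_1) = rep Gh i h *m (rep Gh i x *m delta_mx s 0).
Proof. by case: (rep_irr Gh i) => _ -> _ _ _; rewrite mulmxA. Qed.

(** Orthogonality is used on the group rather than on [M]: the row index of the Fourier matrix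
    selects a column of the representation that may lie beyond [kdim i] and then does not
    descend. *)
Lemma fourier_coef_ne j i (rs : idx j) : i != j -> (rs.2 < kdim j)%N ->
  fourier H mu Gh (coef (i := j) rs) i = 0.
Proof.
move=> ij sk; apply/matrixP => p q; rewrite !mxE.
transitivity (Cintegral mu (fun x : borel G => (rep Gh j x *m delta_mx rs.2 (0 : 'I_1)) rs.1 0 *
   Num.conj ((rep Gh i x *m delta_mx p (0 : 'I_1)) q 0))).
  congr (Cintegral mu _); apply/funext => x.
  by rewrite /lifting coef_act // -!colE !mxE.
apply: (@Cintegral_ortho R G _ (borel G) mu (fun h g => (h * g)%g) mmul mu_haar _ _ (rep Gh j) (rep Gh i)
  (fun x => rep Gh j x *m delta_mx rs.2 0) (fun x => rep Gh i x *m delta_mx p 0)).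
- by move=> p'; apply: rep_bmeas => //; exact: rep_irr.
- by move=> p'; apply: rep_bmeas => //; exact: rep_irr.
- by move=> h x; exact: rep_equiv.
- by move=> h x; exact: rep_equiv.
- exact: rep_irr.
- exact: rep_irr.
- by move/rep_inj => e; rewrite e eqxx in ij.
Qed.

(** The adjoint in [fourier] exchanges the two indices, so a trace against this matrix reads off the
    entry (r, s); the factor 1/d will cancel the d_pi of the operator. *)
Lemma fourier_coef_same i (rs : idx i) : (rs.2 < kdim i)%N ->
  fourier H mu Gh (coef (i := i) rs) i = (rdim i)%:R^-1 *: delta_mx rs.2 rs.1.
Proof.
move=> sk; apply/matrixP => p q; rewrite !mxE.
transitivity (Cintegral mu (fun x : borel G => (rep Gh i x *m delta_mx rs.2 (0 : 'I_1)) rs.1 0 *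
   Num.conj ((rep Gh i x *m delta_mx p (0 : 'I_1)) q 0))).
  congr (Cintegral mu _); apply/funext => x.
  by rewrite /lifting coef_act // -!colE !mxE.
rewrite (@Cintegral_schur R G _ (borel G) mu (fun h g => (h * g)%g) _ (rep Gh i)
  (fun x => rep Gh i x *m delta_mx rs.2 0) (fun x => rep Gh i x *m delta_mx p 0)
  (rs.2 == p)%:R) //.
- rewrite mulrA -natrM mulnb mulrC; congr (_ * _%:R).
  by rewrite andbC eq_sym [rs.1 == q]eq_sym.
- by move=> p'; apply: rep_bmeas => //; exact: rep_irr.
- by move=> p'; apply: rep_bmeas => //; exact: rep_irr.
- exact: rep_irr.
- by move=> x; apply: unitary_column_dot; case: (rep_irr Gh i).
Qed.

End OrthoG.

End Coefficients.

Section ConditionalSums.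
Context {R : realType} {dsp : measure_display} {T : measurableType dsp}.
Variable P : probability T R.

Lemma bmeas_sum_cond (J : Type) (s : seq J) (Q : pred J) (F : J -> T -> R[i]) :
  (forall i, Q i -> bmeas (F i)) -> bmeas (fun x => \sum_(i <- s | Q i) F i x).
Proof.
move=> bF; under eq_fun do rewrite big_mkcond.
apply: bmeas_sum => i; case Qi: (Q i); first exact: bF.
exact: bmeas_cst.
Qed.

Lemma Cintegral_sum_cond (J : Type) (s : seq J) (Q : pred J) (F : J -> T -> R[i]) :
  (forall i, Q i -> bmeas (F i)) ->
  Cintegral P (fun x => \sum_(i <- s | Q i) F i x) = \sum_(i <- s | Q i) Cintegral P (F i).
Proof.
move=> bF; under [in LHS]eq_fun do rewrite big_mkcond.
rewrite Cintegral_sum => [|i]; last first.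
  by case Qi: (Q i); [exact: bF|exact: bmeas_cst].
rewrite [in RHS]big_mkcond; apply: eq_bigr => i _; case: (Q i) => //.
exact: Cintegral_cst.
Qed.

Lemma Cintegral_sum2 (J J' : Type) (s : seq J) (s' : seq J') (Q : pred J) (Q' : pred J')
    (F : J -> T -> R[i]) (F' : J' -> T -> R[i]) :
  (forall i, Q i -> bmeas (F i)) -> (forall i, Q' i -> bmeas (F' i)) ->
  Cintegral P (fun x => (\sum_(i <- s | Q i) F i x) * Num.conj (\sum_(j <- s' | Q' j) F' j x)) =
  \sum_(i <- s | Q i) \sum_(j <- s' | Q' j) Cintegral P (fun x => F i x * Num.conj (F' j x)).
Proof.
move=> bF bF'.
transitivity (Cintegral P (fun x => \sum_(i <- s | Q i) \sum_(j <- s' | Q' j) F i x * Num.conj (F' j x))).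
  congr (Cintegral P _); apply/funext => x; rewrite mulr_suml; apply: eq_bigr => i _.
  by rewrite conjC_sum mulr_sumr.
have bFF i j : Q i -> Q' j -> bmeas (fun x => F i x * Num.conj (F' j x)).
  by move=> Qi Qj; apply: bmeasM; [exact: bF|apply: bmeas_conj; exact: bF'].
rewrite Cintegral_sum_cond => [|i Qi]; last by apply: bmeas_sum_cond => j; exact: bFF.
by apply: eq_bigr => i Qi; rewrite Cintegral_sum_cond => // j; exact: bFF.
Qed.

Lemma Rintegral_normc_sqr (f : T -> R[i]) :
  (\int[P]_x normc (f x) ^+ 2)%R = complex.Re (Cintegral P (fun x => f x * Num.conj (f x))).
Proof. by rewrite Re_Cintegral; apply: eq_Rintegral => x _; rewrite mulr_conj. Qed.

End ConditionalSums.

Lemma nat_conj_cancel (R : realType) (d : nat) (x : R[i]) : d%:R != 0 :> R[i] ->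
  (d%:R * x) * Num.conj (d%:R * x) * (1 / d%:R) = d%:R * (x * Num.conj x).
Proof.
move=> d0; rewrite conjCM conjC_nat; move: (Num.conj x) (d%:R : R[i]) d0 => y e e0.
by rewrite mul1r mulrACA mulrAC mulfK.
Qed.

(** * Fourier blocks: the two endpoint estimates *)

Section Blocks.
Context {R : realType} {n m : nat} {G : ptopGroupType} {LG : lie_group R n G}.
Context {K : set G} {M : ptopologicalType} {I : choiceType}.
Variables (H : homogeneous m LG K M) (Gh : class_one_dual R K I).
Hypothesis G_compact : compact [set: G].
Variable nu : probability (borel M) R.
Hypothesis nu_inv : is_invariant (act H) nu.
Local Notation C := R[i].
Local Notation rdim := (rdim Gh).
Local Notation kdim := (kdim Gh).
Local Notation idx i := ('I_(rdim i) * 'I_(rdim i))%type.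
Local Notation coef := (coef H (Gh := Gh)).

Definition inK i : pred (idx i) := fun rs => (rs.2 < kdim i)%N.

(* With the weights d k and the sizes |c|_HS / sqrt k, the bounds L^1 -> L^oo and
   L^2 -> L^2 for c |-> sum_i block c_i both hold with constant 1. *)
Definition bsize i (c : idx i -> C) : R :=
  Num.sqrt (\sum_(rs | inK rs) normc (c rs) ^+ 2) / Num.sqrt (kdim i)%:R.

Definition weight i : R := (rdim i)%:R * (kdim i)%:R.

Definition block i (c : idx i -> C) (x : M) : C :=
  \sum_(rs | inK rs) ((rdim i)%:R * c rs) * coef rs x.

Lemma bsize_ge0 i (c : idx i -> C) : 0 <= bsize c.
Proof. by rewrite divr_ge0 ?sqrtr_ge0. Qed.

Lemma weight_ge0 i : 0 <= weight i.
Proof. by rewrite mulr_ge0. Qed.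

Lemma block_bmeas i (c : idx i -> C) : bmeas (block c : borel M -> C).
Proof.
apply: bmeas_sum_cond => rs sk.
by apply: bmeasM; [exact: bmeas_cst|exact: coef_bmeas].
Qed.

Lemma normc_nat (k : nat) : normc (k%:R : C) = k%:R.
Proof. by rewrite -[k%:R]/((k%:R : R[i])) -(rmorph_nat (real_complex R)) normc_real ger0_norm. Qed.

Lemma coef_sqr_sum i x : \sum_(rs : idx i | inK rs) normc (coef rs x) ^+ 2 = (kdim i)%:R.
Proof.
transitivity (\sum_(s : 'I_(rdim i) | (s < kdim i)%N) \sum_r normc (coef (r, s) x) ^+ 2).
  rewrite exchange_big pair_big /=.
  by apply: eq_big => [[r s]|[r s] _].
under eq_bigr do rewrite coef_column_norm.
rewrite -(big_ord_widen _ (fun _ => 1) (kdim_le Gh i)).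
by rewrite sumr_const card_ord.
Qed.

(** Cauchy-Schwarz, where the k unit columns contribute sqrt k ([coef_sqr_sum]) and d |c|_HS sqrt k
    is d k times |c|_HS / sqrt k. *)
Lemma block_le i (c : idx i -> C) x : normc (block c x) <= weight i * bsize c.
Proof.
apply: (le_trans (normc_sum _ _ _)).
have -> : weight i * bsize c = (rdim i)%:R *
   (Num.sqrt (\sum_(rs | inK rs) normc (c rs) ^+ 2) * Num.sqrt (kdim i)%:R).
  have k0 : 0 < (kdim i)%:R :> R by rewrite ltr0n kdim_gt0.
  have s0 : Num.sqrt (kdim i)%:R != 0 :> R by rewrite gt_eqF // sqrtr_gt0.
  rewrite /weight /bsize -{1}[(kdim i)%:R]sqr_sqrtr ?(ltW k0) //.
  by field.
under eq_bigr do rewrite !normcM normc_nat -mulrA.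
rewrite -mulr_sumr ler_wpM2l // -[X in _ * Num.sqrt X](coef_sqr_sum i x).
by apply: cauchy_schwarz_sum => j; exact: normc_ge0.
Qed.

Lemma Cintegral_blockM i j (c : idx i -> C) (c' : idx j -> C) :
  Cintegral nu (fun x : borel M => block c x * Num.conj (block c' x)) =
  \sum_(rs | inK rs) \sum_(pq | inK pq)
    ((rdim i)%:R * c rs) * Num.conj ((rdim j)%:R * c' pq) *
    Cintegral nu (fun x : borel M => coef rs x * Num.conj (coef pq x)).
Proof.
rewrite Cintegral_sum2; first last.
- by move=> rs sk; apply: bmeasM; [exact: bmeas_cst|exact: coef_bmeas].
- by move=> rs sk; apply: bmeasM; [exact: bmeas_cst|exact: coef_bmeas].
apply: eq_bigr => rs sk; apply: eq_bigr => pq qk.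
rewrite -CintegralZ; last first.
  by apply: bmeasM; [exact: coef_bmeas|apply: bmeas_conj; exact: coef_bmeas].
congr (Cintegral nu _); apply/funext => x; rewrite [in LHS]conjCM.
by rewrite mulrACA.
Qed.

Lemma block_ortho i j (c : idx i -> C) (c' : idx j -> C) : i != j ->
  Cintegral nu (fun x : borel M => block c x * Num.conj (block c' x)) = 0.
Proof.
move=> ij; rewrite Cintegral_blockM big1 // => rs sk; rewrite big1 // => pq qk.
by rewrite coef_ortho // mulr0.
Qed.

Lemma block_norm2 i (c : idx i -> C) :
  Cintegral nu (fun x : borel M => block c x * Num.conj (block c x)) =
  (weight i * bsize c ^+ 2)%:C.
Proof.
have d0 : (rdim i)%:R != 0 :> C by rewrite pnatr_eq0 -lt0n rdim_gt0.
have k0 : (kdim i)%:R != 0 :> R by rewrite pnatr_eq0 -lt0n kdim_gt0.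
rewrite Cintegral_blockM.
transitivity (\sum_(rs | inK rs) (rdim i)%:R * (normc (c rs) ^+ 2)%:C).
  apply: eq_bigr => rs sk; rewrite (bigD1 rs) //= big1 => [|pq /andP[qk ne]].
    rewrite addr0 (coef_ortho_same G_compact nu_inv sk sk) eqxx.
    by rewrite (nat_conj_cancel _ d0) mulr_conj.
  by rewrite coef_ortho_same // eq_sym (negbTE ne) mul0r mulr0.
rewrite -mulr_sumr -rmorph_sum -(rmorph_nat (real_complex R)) -rmorphM; congr (_%:C).
rewrite /weight /bsize expr_div_n !sqr_sqrtr //; last by rewrite sumr_ge0 // => rs _; rewrite sqr_ge0.
by rewrite -mulrA; congr (_ * _); rewrite mulrCA mulfV ?mulr1.
Qed.

(** Plancherel, by orthogonality of distinct blocks. The selection [Q] is arbitrary because the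
    dyadic truncation uses a different one at each level. *)
Lemma blocks_sqr (s : seq I) (Q : pred I) (c : forall i, idx i -> C) : uniq s ->
  (\int[nu]_(x in [set: borel M]) normc (\sum_(i <- s | Q i) block (c i) x) ^+ 2)%R =
  \sum_(i <- s | Q i) weight i * bsize (c i) ^+ 2.
Proof.
move=> us; rewrite Rintegral_normc_sqr Cintegral_sum2 => [|i _|i _]; try exact: block_bmeas.
transitivity (complex.Re (\sum_(i <- s | Q i) (weight i * bsize (c i) ^+ 2)%:C)); last first.
  by rewrite -rmorph_sum.
apply: (f_equal (@complex.Re R)); rewrite [LHS]big_seq_cond [RHS]big_seq_cond.
apply: eq_bigr => i /andP[si Qi].
rewrite big_mkcond (bigD1_seq i si us) Qi block_norm2 big1; first exact: addr0.
move=> j ji; case: (Q j); last by [].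
by apply: block_ortho; rewrite eq_sym.
Qed.

End Blocks.

Lemma nat_real_conj_mul (R : realType) (d : nat) (a : R) (z : R[i]) :
  (d%:R * (a%:C * Num.conj z)) * z = (d%:R * a * normc z ^+ 2)%:C.
Proof.
have -> : (d%:R * a * normc z ^+ 2)%:C = (d%:R : R)%:C * a%:C * (normc z ^+ 2)%:C.
  by rewrite !rmorphM.
rewrite -mulr_conj (rmorph_nat (real_complex R)).
by rewrite [z * _]mulrC !mulrA.
Qed.

(** * The dual Hausdorff-Young inequality *)

Section DualHausdorffYoung.
Context {R : realType} {n m : nat} {G : ptopGroupType} {LG : lie_group R n G}.
Context {K : set G} {M : ptopologicalType} {I : choiceType}.
Variables (H : homogeneous m LG K M) (Gh : class_one_dual R K I).
Hypothesis G_compact : compact [set: G].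
Variable nu : probability (borel M) R.
Hypothesis nu_inv : is_invariant (act H) nu.
Local Notation C := R[i].
Local Notation rdim := (rdim Gh).
Local Notation kdim := (kdim Gh).
Local Notation idx i := ('I_(rdim i) * 'I_(rdim i))%type.
Local Notation coef := (coef H (Gh := Gh)).
Local Notation block := (block H (Gh := Gh)).

Lemma HYconst_gt0 (p : R) : 2 <= p -> 0 < HYconst p.
Proof.
move=> p2; apply: ltr_wpDr; last exact: powR_gt0.
case: eqP => // /eqP pn2; have pp2 : 0 < p - 2 by rewrite subr_gt0 lt_neqAle p2 eq_sym pn2.
have r1 : 1 < 2 `^ (p - 2) :> R.
  have := @gt0_ltr_powR R _ pp2 1 2; rewrite !nnegrE powR1; apply=> //.
  by rewrite ltr1n.
by rewrite !mulr_ge0 ?powR_ge0 // invr_ge0 subr_ge0 ltW.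
Qed.

Lemma bsizeZ i (a : C) (c : idx i -> C) :
  bsize (fun rs => a * Num.conj (c rs)) = normc a * bsize c.
Proof.
rewrite /bsize mulrA; congr (_ / _).
under eq_bigr do rewrite normcM normc_conj exprMn.
by rewrite -mulr_sumr sqrtrM ?sqr_ge0 // sqrtr_sqr ger0_norm // normc_ge0.
Qed.

Lemma bsize_sqr i (c : idx i -> C) :
  \sum_(rs | inK rs) normc (c rs) ^+ 2 = (kdim i)%:R * bsize c ^+ 2.
Proof.
have k0 : (kdim i)%:R != 0 :> R by rewrite pnatr_eq0 -lt0n kdim_gt0.
rewrite /bsize expr_div_n !sqr_sqrtr //; last by rewrite sumr_ge0 // => rs _; rewrite sqr_ge0.
by rewrite mulrCA mulfV ?mulr1.
Qed.

Variables (p B : R) (e : (borel M -> C) -> C).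
Hypothesis p2 : 2 <= p.
Hypothesis e_lin : forall (c : C) f g, bmeas f -> bmeas g ->
  e (fun x => c * f x + g x) = c * e f + e g.
Hypothesis e_le : forall f, bmeas f -> (\int[nu]_x (normc (f x) `^ p))%R <= 1 ->
  normc (e f) <= B.

Let e0 : e (fun _ => 0) = 0.
Proof.
have b0 : bmeas (fun _ : borel M => 0 : C) by exact: bmeas_cst.
transitivity (-1 * e (fun _ => 0) + e (fun _ => 0)); last by rewrite mulN1r addNr.
by rewrite -e_lin //; congr e; apply/funext => x; rewrite mulr0 addr0.
Qed.

Let eZ (c : C) f : bmeas f -> e (fun x => c * f x) = c * e f.
Proof.
move=> bf; rewrite -[RHS]addr0 -e0 -e_lin //; last exact: bmeas_cst.
by congr e; apply/funext => x; rewrite addr0.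
Qed.

Let eD f g : bmeas f -> bmeas g -> e (fun x => f x + g x) = e f + e g.
Proof.
move=> bf bg; rewrite -[e f]mul1r -e_lin //.
by congr e; apply/funext => x; rewrite mul1r.
Qed.

Let e_sum (J : Type) (s : seq J) (Q : pred J) (F : J -> borel M -> C) :
  (forall i, Q i -> bmeas (F i)) ->
  e (fun x => \sum_(i <- s | Q i) F i x) = \sum_(i <- s | Q i) e (F i).
Proof.
move=> bF; elim: s => [|j s IH].
  by rewrite big_nil -e0; congr e; apply/funext => x; rewrite big_nil.
rewrite big_cons; case Qj: (Q j); last first.
  by rewrite -IH; congr e; apply/funext => x; rewrite big_cons Qj.
rewrite -IH -eD; [|exact: bF|exact: bmeas_sum_cond].
by congr e; apply/funext => x; rewrite big_cons Qj.
Qed.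

(** Duality: [e] is tested on the combination of blocks that is extremal for Hoelder's inequality in
    the weighted sequence space, and [interpolation_bound] controls the L^p norm of that
    combination. *)
Lemma dual_HausdorffYoung (s : seq I) : uniq s ->
  \sum_(i <- s) weight Gh i * bsize (fun rs : idx i => e (coef rs)) `^ p <=
  HYconst p * B `^ p.
Proof.
move=> us.
pose E i (rs : idx i) := e (coef rs); pose A i := bsize (@E i).
have p0 : 0 < p by exact: lt_le_trans p2.
have p10 : 0 < p - 1 by rewrite subr_gt0 (lt_le_trans _ p2) // ltr1n.
have pn : p != 0 by rewrite gt_eqF.
have p1n : p - 1 != 0 by rewrite gt_eqF.
have A0 i : 0 <= A i by exact: bsize_ge0.
have w0 i : 0 <= weight Gh i by exact: weight_ge0.
have H0 := HYconst_gt0 p2.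
rewrite -[leLHS]/(\sum_(i <- s) weight Gh i * A i `^ p); set S := \sum_(i <- s) _.
have S0 : 0 <= S by rewrite sumr_ge0 // => i _; rewrite mulr_ge0 ?powR_ge0.
have [->|Sn] := eqVneq S 0; first by rewrite mulr_ge0 ?powR_ge0 // ltW.
have Sp : 0 < S by rewrite lt0r Sn.
(* Normalizes the test coefficients to weighted l^{p/(p-1)} norm 1, so that [e f] comes out as
   S^{1/p}. *)
pose sg := S `^ (- ((p - 1) / p)).
have sg0 : 0 < sg by exact: powR_gt0.
(* The conjugate aligns the phases, and the power p - 2 gives the block size A_i^{p-1} and the
   pairing A_i^p. *)
pose c i (rs : idx i) : C := (A i `^ (p - 2) * sg)%:C * Num.conj (E i rs).
have cE i : bsize (@c i) = A i `^ (p - 1) * sg.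
  rewrite bsizeZ normc_real ger0_norm; last by rewrite mulr_ge0 ?powR_ge0 // ltW.
  rewrite -/(A i) mulrAC; congr (_ * _); rewrite -(mulr_powRB1 (A0 i) p10) mulrC; congr (_ * _ `^ _).
  by ring.
have sum1 : \sum_(i <- s) weight Gh i * bsize (@c i) `^ (p / (p - 1)) = 1.
  transitivity (\sum_(i <- s) S^-1 * (weight Gh i * A i `^ p)).
    apply: eq_bigr => i _; rewrite cE powRM ?powR_ge0 ?(ltW sg0) //.
    rewrite -!powRrM (_ : (p - 1) * (p / (p - 1)) = p); last by field.
    rewrite (_ : - ((p - 1) / p) * (p / (p - 1)) = -1); last by field; apply/andP.
    by rewrite powR_inv1 // mulrA mulrC.
  by rewrite -mulr_sumr mulVf.
pose f (x : borel M) := \sum_(i <- s) block (@c i) x.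
have bb i : bmeas (block (@c i) : borel M -> C) by exact: block_bmeas.
have bf : bmeas f by exact: bmeas_sum.
have fp : (\int[nu]_x (normc (f x) `^ p))%R <= HYconst p.
  apply: (interpolation_bound (w := weight Gh) (a := fun i => bsize (@c i))) => //.
  - by move=> i; exact: bsize_ge0.
  - by move=> i x; exact: block_le.
  - by move=> Q; rewrite blocks_sqr.
  - by rewrite sum1.
pose D := HYconst p `^ p^-1.
have D0 : 0 < D by exact: powR_gt0.
have Dp : D `^ p = HYconst p by rewrite -powRrM mulVf // powRr1 // ltW.
have gp : (\int[nu]_x (normc (D^-1%:C * f x) `^ p))%R <= 1.
  under eq_Rintegral do rewrite normcM normc_real ger0_norm ?invr_ge0 ?(ltW D0) //
    powRM ?invr_ge0 ?(ltW D0) ?normc_ge0 //.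
  rewrite RintegralZl //; last first.
    have [[mf1 mf2] [B' fB]] := bf; apply: bounded_integrable.
      by apply: (measurableT_comp (measurable_powR p)); apply: Cmeasurable_normc.
    exists (B' `^ p) => x; rewrite ger0_norm ?powR_ge0 //.
    apply: ge0_ler_powR; rewrite ?nnegrE ?normc_ge0 ?(ltW p0) //.
    exact: le_trans (normc_ge0 _) (fB x).
  rewrite -powR_inv1 ?(ltW D0) // powRAC Dp powR_inv1 ?(ltW H0) //.
  by rewrite mulrC ler_pdivrMr // mul1r.
have bg : bmeas (fun x => D^-1%:C * f x) by apply: bmeasM => //; exact: bmeas_cst.
have := e_le bg gp; rewrite eZ // normcM normc_real ger0_norm ?invr_ge0 ?(ltW D0) //.
have -> : e f = (S `^ p^-1)%:C.
  rewrite e_sum //.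
  transitivity (\sum_(i <- s) (sg * (weight Gh i * A i `^ p))%:C).
    apply: eq_bigr => i _; rewrite e_sum; last first.
      by move=> rs sk; apply: bmeasM; [exact: bmeas_cst|exact: coef_bmeas].
    transitivity (\sum_(rs : idx i | inK rs)
        ((rdim i)%:R * (A i `^ (p - 2) * sg) * normc (E i rs) ^+ 2)%:C).
      apply: eq_bigr => rs sk; rewrite eZ; last exact: coef_bmeas.
      exact: nat_real_conj_mul.
    rewrite -rmorph_sum -mulr_sumr bsize_sqr -/(A i); congr (_%:C).
    rewrite /weight.
    have -> : A i `^ p = A i `^ (p - 2) * A i ^+ 2.
      rewrite -(mulr_powRB1 (A0 i) p0) -(mulr_powRB1 (A0 i) p10) (_ : p - 1 - 1 = p - 2); last by ring.
      by ring.
    by ring.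
  rewrite -rmorph_sum -mulr_sumr -/S; congr (_%:C).
  rewrite /sg -{2}[S]powRr1 // -powRD ?Sn ?implybT //; congr (_ `^ _).
  by field.
rewrite normc_real ger0_norm ?powR_ge0 // ler_pdivrMl // => le.
have -> : S = (S `^ p^-1) `^ p by rewrite -powRrM mulVf // powRr1.
have B0 : 0 <= B.
  apply: le_trans (normc_ge0 (e (fun _ => 0))) (e_le (bmeas_cst 0) _).
  by under eq_Rintegral do rewrite normc0 powR0 //; rewrite Rintegral_cst // mul0r.
rewrite -Dp -powRM ?(ltW D0) //.
by apply: ge0_ler_powR; rewrite ?nnegrE ?powR_ge0 ?mulr_ge0 // ltW.
Qed.

End DualHausdorffYoung.

(** A bound on all finite sums leaves, for each n, only finitely many terms above 1/(n+1). *)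
Lemma countable_support_of_sum_le (R : realType) (I : choiceType) (a : I -> R) (C : R) :
  (forall i, 0 <= a i) -> (forall s : seq I, uniq s -> \sum_(i <- s) a i <= C) ->
  countable [set i | 0 < a i].
Proof.
move=> a0 aC.
have -> : [set i | 0 < a i] = \bigcup_(n in [set: nat]) [set i | n.+1%:R^-1 < a i].
  apply/seteqP; split => [i /= ai|i [n _ /=]]; last by apply: lt_trans; rewrite invr_gt0.
  exists (Num.truncn (a i)^-1) => //=.
  by rewrite -[ltRHS]invrK ltf_pV2 ?posrE ?invr_gt0 // truncnS_gt.
apply: bigcup_countable => // n _; apply: finite_set_countable.
apply: contrapT => inf.
have [B BA Bn] := infinite_set_fset (Num.truncn (C * n.+1%:R)).+1 inf.
have := aC (enum_fset B) (fset_uniq B); apply/negP; rewrite -ltNge.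
have C0 : C < (size (enum_fset B))%:R * n.+1%:R^-1.
  rewrite ltr_pdivlMr //; apply: lt_le_trans (truncnS_gt _) _.
  by rewrite ler_nat.
apply: (lt_le_trans C0).
have : forall i, i \in enum_fset B -> n.+1%:R^-1 <= a i by move=> i /BA /= /ltW.
elim: (enum_fset B) => [_|i s IH h]; first by rewrite big_nil mul0r.
rewrite big_cons /= -natr1 mulrDl mul1r addrC lerD //; first by apply: h; rewrite mem_head.
by apply: IH => j js; apply: h; rewrite inE js orbT.
Qed.

Lemma bmeas_powR_integrable (R : realType) d (T : measurableType d) (P : probability T R)
    (f : T -> R[i]) (p : R) : 0 <= p -> bmeas f ->
  P.-integrable setT (EFin \o (fun x => normc (f x) `^ p)).
Proof.
move=> p0 [mf [B fB]]; apply: bounded_integrable.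
  by apply: (measurableT_comp (measurable_powR p)); exact: Cmeasurable_normc.
exists (B `^ p) => x; rewrite ger0_norm ?powR_ge0 //.
apply: ge0_ler_powR; rewrite ?nnegrE ?normc_ge0 //.
exact: le_trans (normc_ge0 _) (fB x).
Qed.

(** * Countability of the class-I dual *)

Section Countability.
Context {R : realType} {n m : nat} {G : ptopGroupType} {LG : lie_group R n G}.
Context {K : set G} {M : ptopologicalType} {I : choiceType}.
Variables (H : homogeneous m LG K M) (Gh : class_one_dual R K I).
Hypothesis G_compact : compact [set: G].
Variable nu : probability (borel M) R.
Hypothesis nu_inv : is_invariant (act H) nu.
Local Notation C := R[i].
Local Notation coef := (coef H (Gh := Gh)).

Lemma open_measure_gt0 (U : set M) : open U -> U !=set0 -> (0 < nu U)%E.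
Proof.
apply: (@nbhs_measurable_gt0 R M G nu (act H)) => //.
- exact: (homogeneous_compact H G_compact).
- by move=> g; exact: act_continuous_r.
- exact: act_trans.
Qed.

(** A crude substitute for Hoelder's inequality: |f| <= 1 + |f|^p bounds the real and the imaginary
    part by 2 each. *)
Lemma normc_Cintegral_le (f : borel M -> C) (p : R) : 1 <= p -> bmeas f ->
  (\int[nu]_x (normc (f x) `^ p))%R <= 1 -> normc (Cintegral nu f) <= 4.
Proof.
move=> p1 bf fp; have [[m1 m2] [B fB]] := bf.
have mn : measurable_fun setT (fun x => normc (f x)) by exact: Cmeasurable_normc.
have ip := bmeas_powR_integrable nu (le_trans ler01 p1) bf.
have i1 : nu.-integrable setT (EFin \o (fun _ : borel M => 1 : R)).
  by apply: bounded_integrable => //; exists 1 => x; rewrite normr1.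
have ip1 : nu.-integrable setT (EFin \o (fun x => 1 + normc (f x) `^ p)).
  by have := integrableD measurableT i1 ip; apply: eq_integrable.
have bd (h : borel M -> R) : nu.-integrable setT (EFin \o h) ->
    (forall x, `|h x| <= normc (f x)) -> `|(\int[nu]_x h x)%R| <= 2.
  move=> ih hf; apply: (le_trans (le_normr_Rintegral _ ih)) => //.
  apply: (@le_trans _ _ (\int[nu]_x (1 + normc (f x) `^ p))%R).
    apply: le_Rintegral => //.
      by have := integrable_norm ih; apply: eq_integrable.
    move=> x _; apply: (le_trans (hf x)); have [le1|gt1] := leP (normc (f x)) 1.
      by apply: ler_wpDr => //; exact: powR_ge0.
    by apply: ler_wpDl => //; apply: le1r_powR => //; exact: ltW.
  rewrite RintegralD // Rintegral_cst // (_ : fine _ = 1); last first.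
    exact: (f_equal fine (probability_setT nu)).
  by rewrite mulr1 -[2]/(1 + 1) lerD2l.
have -> : Cintegral nu f = (\int[nu]_x complex.Re (f x))%R%:C + 'i * (\int[nu]_x complex.Im (f x))%R%:C.
  by rewrite /Cintegral; simpc.
apply: (le_trans (normcD_le _ _)); rewrite normcM !normc_real.
rewrite (_ : normc 'i = 1) /= ?mul1r ?expr0n ?expr1n ?add0r ?sqrtr1 //.
rewrite (_ : 4 = 2 + 2); last by rewrite -natrD.
apply: lerD; apply: bd.
- exact: bmeas_Re.
- by move=> x; exact: Re_le_normc.
- exact: bmeas_Im.
- by move=> x; exact: Im_le_normc.
Qed.

(* For every i some coefficient has a nonzero integral over a member of a countable
   basis, and each such integral is a bounded functional on L^2, so that it is
   nonzero for countably many i only. *)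
Lemma countable_dual : countable [set: I].
Proof.
have [BB cB [oB bB]] := mfd_countable (hom_mfd H).
pose e (U : set M) (f : borel M -> C) := Cintegral nu (fun x => (\1_U x)%:C * f x).
have bU U : BB U -> bmeas ((fun x => (\1_U x)%:C) : borel M -> C).
  move=> BU; split; last first.
    exists 1 => x; rewrite normc_real indicE; case: (_ \in _); by rewrite ?normr1 ?normr0.
  split => /=; last exact: measurable_cst.
  by apply: measurable_indic; apply: sub_sigma_algebra; exact: oB.
have HY U : BB U -> forall s : seq I, uniq s ->
    \sum_(i <- s) weight Gh i * bsize (fun rs => e U (coef (i := i) rs)) `^ 2 <= HYconst 2 * 4 `^ 2.
  move=> BU s us; apply: (@dual_HausdorffYoung R n m G LG K M I H Gh G_compact nu nu_inv 2 4 (e U)) => //.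
  - move=> c f g bf bg.
    have b1 : bmeas (fun x : borel M => (\1_U x)%:C * f x) by apply: bmeasM => //; exact: bU.
    have b2 : bmeas (fun x : borel M => (\1_U x)%:C * g x) by apply: bmeasM => //; exact: bU.
    have b3 : bmeas (fun x : borel M => c * ((\1_U x)%:C * f x)) by apply: bmeasM => //; exact: bmeas_cst.
    rewrite /e -(CintegralZ nu c b1) -(CintegralD nu b3 b2).
    by congr (Cintegral nu _); apply/funext => x; rewrite mulrDr mulrCA.
  - move=> f bf fp; apply: (@normc_Cintegral_le _ 2); first by rewrite ler1n.
      by apply: bmeasM => //; exact: bU.
    apply: le_trans fp; apply: le_Rintegral => //.
    + by apply: bmeas_powR_integrable => //; apply: bmeasM => //; exact: bU.
    + exact: bmeas_powR_integrable.
    + move=> x _; rewrite normcM normc_real indicE; case: (_ \in _); rewrite ?normr1 ?mul1r //.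
      by rewrite normr0 mul0r powR0 ?powR_ge0.
have cU U : BB U -> countable [set i | 0 < weight Gh i * bsize (fun rs => e U (coef (i := i) rs)) `^ 2].
  move=> BU; apply: (countable_support_of_sum_le _ (HY _ BU)).
  by move=> i; rewrite mulr_ge0 ?powR_ge0 // weight_ge0.
apply: sub_countable (bigcup_countable cB cU).
apply: subset_card_le => i _.
have d0 := rdim_gt0 Gh i; have k0 := kdim_gt0 Gh i.
(* Column 0 is admissible because [kdim i] is positive. This coefficient is 1 at the base point, so
   its real part exceeds 1/2 on some basic open set. *)
pose rs := (Ordinal d0, Ordinal d0).
have rsK : inK (Gh := Gh) rs by [].
have c1 : coef rs (base H) = 1.
  rewrite -[X in coef rs X](act1 H) coef_act //.
  by case: (rep_irr Gh i) => -> _ _ _ _; rewrite mxE eqxx.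
have [cR _] : continuous (fun x => complex.Re (coef rs x)) /\
    continuous (fun x => complex.Im (coef rs x)).
  by apply: orbit_vector_continuous => //; [exact: rep_irr|exact: delta_invariant].
have nb : \forall x \near base H, 2^-1 < complex.Re (coef rs x).
  have /cvgr_gt := cR (base H); apply; rewrite c1 /=.
  by rewrite invf_lt1 // ltr1n.
have [U [BU Ub] UN] := bB (base H) _ nb.
exists U => //=; rewrite mulr_gt0 //; first by rewrite mulr_gt0 // ltr0n.
rewrite powR_gt0 // lt0r bsize_ge0 andbT; apply/negP => /eqP bs0.
have := bsize_sqr (fun rs => e U (coef (i := i) rs)); rewrite bs0 expr0n mulr0 => /eqP.
rewrite psumr_eq0 => [/allP/(_ rs)|rs' _]; last by rewrite sqr_ge0.
rewrite mem_index_enum => /(_ isT); rewrite rsK implyTb sqrf_eq0 => /eqP /eq0_normc e0.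
have mU : @measurable _ (borel M) U by apply: sub_sigma_algebra; exact: oB.
have bc : bmeas (fun x : borel M => (\1_U x)%:C * coef rs x).
  by apply: bmeasM; [exact: bU|exact: coef_bmeas].
have := @Rintegral_gt0 _ (borel M) R nu (fun x => \1_U x * complex.Re (coef rs x)) U 2^-1.
have -> : (\int[nu]_x (\1_U x * complex.Re (coef rs x)))%R = complex.Re (e U (coef rs)).
  by rewrite Re_Cintegral; apply: eq_Rintegral => x _; rewrite complex_ReM /= mul0r subr0.
rewrite e0 /= ltxx => h; suff : false by []; apply: h => //.
- have := bmeas_Re nu bc; apply: eq_integrable => // x _ /=.
  by rewrite complex_ReM /= mul0r subr0.
- move=> x; rewrite indicE; case: (boolP (x \in U)) => [|_]; last by rewrite mul0r.
  by rewrite inE mul1r => /UN /= /ltW; apply: le_trans; rewrite invr_ge0.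
- by apply: open_measure_gt0; [exact: oB|exists (base H)].
- by move=> x Ux; rewrite indicE mem_set // mul1r ltW //; exact: UN.
Qed.

End Countability.

(** * Nuclear operators *)

Section Measure.
Context {R : realType} {d : measure_display} {T : measurableType d}.
Variable P : {measure set T -> \bar R}.

(* [f] need not be measurable: the integral of a nonnegative function is a
   supremum over the simple functions below it. *)
Lemma ae_le_integral (f g : T -> \bar R) : (forall x, 0 <= f x)%E ->
  (forall x, 0 <= g x)%E -> measurable_fun setT g ->
  {ae P, forall x, (f x <= g x)%E} -> (\int[P]_x f x <= \int[P]_x g x)%E.
Proof.
move=> f0 g0 mg [N [mN PN0 sN]].
pose g' x := maxe (g x) (+oo * (\1_N x)%:E)%E.
have mg' : measurable_fun setT g'.
  apply: measurable_maxe => //; apply: emeasurable_funM => //.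
  exact/measurable_EFinP/measurable_indic.
have g'0 x : (0 <= g' x)%E by rewrite le_max g0.
have -> : (\int[P]_x g x = \int[P]_x g' x)%E.
  apply: ge0_ae_eq_integral => //; exists N; split => // x /= gg'.
  apply: contrapT => Nx; apply: gg' => _.
  rewrite /g' indicE memNset //= mule0; apply/esym/max_idPl; exact: g0.
rewrite !ge0_integralTE //; apply: ereal_sup_le => _ [h /= hf <-].
exists h => //= x; apply: (le_trans (hf x)).
have [Nx|Nx] := pselect (N x).
  by rewrite /g' indicE mem_set // mule1 maxey leey.
have : (f x <= g x)%E by apply: contrapT => fg; apply: Nx; apply: sN.
by move/le_trans; apply; rewrite le_max lexx.
Qed.

Lemma ae_countable (J : Type) (Q : J -> T -> Prop) : countable [set: J] ->
  (forall j, {ae P, forall x, Q j x}) -> {ae P, forall x j, Q j x}.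
Proof.
move=> /countable_injP [i inji] aeQ.
have : {ae P, forall x (k : nat) j, i j = k -> Q j x}.
  apply: ae_foralln => k; have [[j jk]|nj] := pselect (exists j, i j = k).
    apply: filterS (aeQ j) => x Qx j' j'k.
    by rewrite (inji j' j) ?inE // j'k.
  by apply: aeW => x j jk; case: nj; exists j.
by apply: filterS => x h j; exact: (h (i j)).
Qed.

Lemma integral_powR_Lpnorm (p : R) (f : T -> R[i]) : 0 < p ->
  (\int[P]_x (normc (f x) `^ p)%:E = Lpnorm P p f `^ p)%E.
Proof.
move=> p0; rewrite /Lpnorm powR_Lnorm ?gt_eqF //; apply: eq_integral => x _.
by rewrite abse_EFin ger0_norm ?normc_ge0 // poweR_EFin.
Qed.

(** Fatou's lemma applied to |f - S_N|^p: its lower limit has integral 0, so it vanishes almost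
    everywhere. The conclusion replaces the usual almost everywhere convergent subsequence. *)
Lemma Lpnorm_liminf0 (p : R) (f : T -> R[i]) (S : nat -> T -> R[i]) : 0 < p ->
  Cmeasurable f -> (forall N, Cmeasurable (S N)) ->
  (fun N => Lpnorm P p (fun x => f x - S N x)) @ \oo --> 0%E ->
  {ae P, forall x N (e : R), 0 < e -> exists2 M : nat, (N <= M)%N & normc (f x - S M x) < e}.
Proof.
move=> p0 mf mS cv0.
pose h N x : R := normc (f x - S N x) `^ p.
have mg N : measurable_fun setT (fun x => (h N x)%:E).
  apply/measurable_EFinP; apply: (measurableT_comp (measurable_powR p)).
  apply: Cmeasurable_normc; apply: CmeasurableD => //.
  case: (mS N) => m1 m2; split.
    rewrite (_ : (fun x => _) = (fun x => - complex.Re (S N x))); last first.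
      by apply/funext => x; case: (S N x).
    exact: measurableT_comp.
  rewrite (_ : (fun x => _) = (fun x => - complex.Im (S N x))); last first.
    by apply/funext => x; case: (S N x).
  exact: measurableT_comp.
have g0 N x : (0 <= (h N x)%:E)%E by rewrite lee_fin powR_ge0.
have fat := fatou P measurableT mg (fun N x _ => g0 N x).
have cvi : (fun N => \int[P]_x (h N x)%:E)%E @ \oo --> 0%E.
  rewrite (_ : (fun N => _) = (fun N => Lpnorm P p (fun x => f x - S N x)%R `^ p)%E); last first.
    by apply/funext => N; rewrite integral_powR_Lpnorm.
  move/fine_cvgP : cv0 => [fin cv]; apply/fine_cvgP; split.
    by apply: filterS fin => N; exact: fin_num_poweR.
  apply/cvgrPdist_lt => e e0.
  have e1 : 0 < e `^ p^-1 by exact: powR_gt0.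
  have /cvgrPdist_lt/(_ _ e1) := cv; apply: filterS => N /=.
  rewrite !sub0r !normrN fine_poweR !ger0_norm ?powR_ge0 ?fine_ge0 ?Lnorm_ge0 // => lt.
  have -> : e = (e `^ p^-1) `^ p by rewrite -powRrM mulVf ?gt_eqF // powRr1 // ltW.
  by apply: gt0_ltr_powR; rewrite ?nnegrE ?fine_ge0 ?Lnorm_ge0 // ltW.
have [cve _] := cvg_limn_einf_sup cvi; rewrite cve in fat.
have einf0 x : (0 <= limn_einf (fun N => (h N x)%:E))%E.
  rewrite limn_einf_lim; apply: lime_ge; first exact: is_cvg_einfs.
  by apply: nearW => N; apply: le_ereal_inf_tmp => _ [M _ <-]; exact: g0.
have mE : measurable_fun setT (fun x => limn_einf (fun N => (h N x)%:E)).
  apply: measurableT_comp => //; apply: measurable_fun_limn_esup => N.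
  exact: measurableT_comp.
have ae0 : ae_eq P setT (fun x => limn_einf (fun N => (h N x)%:E)) (cst 0%E).
  apply/ae_eq_integral_abs => //; apply/eqP; rewrite eq_le integral_ge0 ?andbT => [|x _]; last exact: abse_ge0.
  apply: le_trans fat; rewrite le_eqVlt; apply/orP; left; apply/eqP.
  by apply: eq_integral => x _; rewrite gee0_abs.
apply: filterS ae0 => x /(_ I) /= lx N e e0; apply: contrapT => nM.
have : ((e `^ p)%:E <= limn_einf (fun N => (h N x)%:E))%E.
  rewrite limn_einf_lim; apply: lime_ge; first exact: is_cvg_einfs.
  exists N => // k /= Nk; apply: le_ereal_inf_tmp => _ [M /= kM <-].
  rewrite lee_fin; apply: ge0_ler_powR; rewrite ?nnegrE ?normc_ge0 ?(ltW p0) ?(ltW e0) //.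
  rewrite leNgt; apply/negP => lt; apply: nM; exists M => //.
  exact: leq_trans kM.
by rewrite lx lee_fin leNgt powR_gt0.
Qed.

End Measure.

(** [Z] is the p-th power of the sum of eps_n |y_n|, as an increasing limit: Minkowski bounds the
    partial sums in L^p and monotone convergence passes to the limit. Its measurability will spare
    any discussion of the integrand in the symbol norm. *)
Lemma nuclear_majorant (R : realType) d (T : measurableType d)
    (P : {measure set T -> \bar R}) (p : R) (eps : nat -> R) (y : nat -> T -> R[i]) :
  1 <= p -> (forall n, 0 <= eps n) -> (forall n, Lp P p (y n)) ->
  (\sum_(0 <= n <oo) ((eps n)%:E * Lpnorm P p (y n)) < +oo)%E ->
  exists Z : T -> \bar R, [/\ measurable_fun setT Z, forall x, (0 <= Z x)%E,
    (\int[P]_x Z x < +oo)%E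
  & forall x N, ((\sum_(n < N) eps n * normc (y n x)) `^ p)%:E <= Z x]%E.
Proof.
move=> p1 eps0 yLp; set B := (\sum_(0 <= n <oo) _)%E => Bfin.
have p0 : 0 < p by exact: lt_le_trans p1.
have mn n : measurable_fun setT (fun x => normc (y n x)).
  by apply: Cmeasurable_normc; case: (yLp n).
pose Y N x := \sum_(n < N) eps n * normc (y n x).
have Y0 N x : 0 <= Y N x by apply: sumr_ge0 => n _; rewrite mulr_ge0 ?normc_ge0.
have mY N : measurable_fun setT (Y N).
  by apply: measurable_sum => n; apply: measurable_funM.
have YL N : (Lnorm P p%:E (EFin \o Y N) <= \sum_(n < N) ((eps n)%:E * Lpnorm P p (y n)))%E.
  elim: N => [|N IH].
    rewrite big_ord0 (_ : EFin \o Y 0 = cst 0%E) ?Lnorm0 ?eqe ?gt_eqF //.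
    by apply/funext => x; rewrite /Y /= big_ord0.
  rewrite big_ord_recr /=.
  have -> : Y N.+1 = (Y N \+ (fun x => eps N * normc (y N x)))%R.
    by apply/funext => x; rewrite /Y /= big_ord_recr.
  apply: (le_trans (minkowski_EFin _ _ _ _)) => //; first exact: measurable_funM.
  apply: leeD => //; rewrite /Lpnorm unlock.
  under eq_integral => x _.
    rewrite /= normrM ger0_norm // powRM ?normr_ge0 // EFinM.
    over.
  rewrite ge0_integralZl_EFin ?powR_ge0 //; last first.
    apply/measurable_EFinP; apply: (measurableT_comp (measurable_powR p)).
    exact: measurableT_comp.
  rewrite poweRM ?lee_fin ?powR_ge0 //; last first.
    by apply: integral_ge0 => x _; rewrite lee_fin powR_ge0.
  rewrite poweR_EFin -powRrM mulfV ?gt_eqF // powRr1 //.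
pose g N x := (Y N x `^ p)%:E.
have g0 N x : (0 <= g N x)%E by rewrite lee_fin powR_ge0.
have mg N : measurable_fun setT (g N).
  by apply/measurable_EFinP; exact: (measurableT_comp (measurable_powR p)).
have ndY x : nondecreasing_seq (Y ^~ x).
  move=> N N' NN'; rewrite /Y -(subnKC NN') big_split_ord /= lerDl.
  by apply: sumr_ge0 => n _; rewrite mulr_ge0 ?normc_ge0.
have ndg x : nondecreasing_seq (g ^~ x).
  move=> N N' NN'; rewrite lee_fin; apply: ge0_ler_powR; rewrite ?nnegrE ?Y0 ?(ltW p0) //.
  exact: ndY.
have gB N : (\int[P]_x g N x <= B `^ p)%E.
  have -> : (\int[P]_x g N x = Lnorm P p%:E (EFin \o Y N) `^ p)%E.
    rewrite powR_Lnorm ?gt_eqF //; apply: eq_integral => x _.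
    by rewrite abse_EFin ger0_norm // poweR_EFin.
  apply: gt0_ler_poweR; rewrite ?(ltW p0) ?in_itv /= ?leey ?andbT ?Lnorm_ge0 //.
    by apply: nneseries_ge0 => n _ _; rewrite mule_ge0 ?lee_fin ?Lnorm_ge0.
  apply: (le_trans (YL N)); rewrite -(big_mkord xpredT (fun n => ((eps n)%:E * Lpnorm P p (y n))%E)).
  apply: nneseries_lim_ge => n _; rewrite mule_ge0 ?lee_fin ?Lnorm_ge0 //.
exists (fun x => limn (g ^~ x)); split.
- apply: (@emeasurable_fun_cvg _ _ R setT g _ mg) => x _; exact: ereal_nondecreasing_is_cvgn.
- move=> x; apply: lime_ge; first exact: ereal_nondecreasing_is_cvgn.
  exact: nearW.
- rewrite (monotone_convergence P measurableT mg (fun N x _ => g0 N x) (fun x _ => ndg x)).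
  apply: (@le_lt_trans _ _ (B `^ p)%E); last exact: poweR_lty.
  apply: lime_le; last exact: nearW.
  apply: ereal_nondecreasing_is_cvgn => N N' NN'.
  by apply: ge0_le_integral => // x _; exact: ndg.
- move=> x N; apply: lime_ge; first exact: ereal_nondecreasing_is_cvgn.
  by exists N => // N' /= NN'; exact: ndg.
Qed.

(** * Hilbert-Schmidt and operator norms *)

Section OperatorNorm.
Context {R : realType}.
Local Notation C := R[i].

Lemma hsnorm_ge0 m n (A : 'M[C]_(m, n)) : 0 <= hsnorm A.
Proof. exact: sqrtr_ge0. Qed.

Lemma hsnorm_sqr m n (A : 'M[C]_(m, n)) :
  hsnorm A ^+ 2 = \sum_i \sum_j normc (A i j) ^+ 2.
Proof.
rewrite sqr_sqrtr // sumr_ge0 // => i _; rewrite sumr_ge0 // => j _; exact: sqr_ge0.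
Qed.

Lemma hsnormM_le m n p (A : 'M[C]_(m, n)) (B : 'M[C]_(n, p)) :
  hsnorm (A *m B) <= hsnorm A * hsnorm B.
Proof.
rewrite -(ler_pXn2r (n := 2)) ?nnegrE ?mulr_ge0 ?hsnorm_ge0 // exprMn !hsnorm_sqr.
have e : (\sum_i \sum_j normc (A i j) ^+ 2) * (\sum_i \sum_j normc (B i j) ^+ 2) =
   \sum_i \sum_k ((\sum_j normc (A i j) ^+ 2) * (\sum_j normc (B j k) ^+ 2)).
  rewrite mulr_suml; apply: eq_bigr => i _; rewrite -mulr_sumr; congr (_ * _).
  exact: exchange_big.
rewrite e; apply: ler_sum => i _; apply: ler_sum => k _.
have s0 (n' : nat) (z : 'I_n' -> R) : 0 <= \sum_j z j ^+ 2.
  by rewrite sumr_ge0 // => j _; exact: sqr_ge0.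
rewrite -[leRHS]sqr_sqrtr ?mulr_ge0 // ler_pXn2r ?nnegrE ?normc_ge0 ?sqrtr_ge0 //.
rewrite mxE (le_trans (normc_sum _ _ _)) // sqrtrM //.
under eq_bigr do rewrite normcM.
by apply: cauchy_schwarz_sum => j; exact: normc_ge0.
Qed.

Lemma hsnormZ m n (c : C) (A : 'M[C]_(m, n)) : hsnorm (c *: A) = normc c * hsnorm A.
Proof.
rewrite /hsnorm -{1}[normc c]ger0_norm ?normc_ge0 // -sqrtr_sqr -sqrtrM ?sqr_ge0 //; congr Num.sqrt.
rewrite mulr_sumr; apply: eq_bigr => i _; rewrite mulr_sumr; apply: eq_bigr => j _.
by rewrite mxE normcM exprMn.
Qed.

Lemma opnorm_vec d (A : 'M[C]_d) (v : 'cV[C]_d) : hsnorm (A *m v) <= opnorm A * hsnorm v.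
Proof.
have [v0|v0] := eqVneq (hsnorm v) 0.
  by rewrite v0 mulr0 (le_trans (hsnormM_le _ _)) // v0 mulr0.
have vp : 0 < hsnorm v by rewrite lt0r v0 hsnorm_ge0.
rewrite -ler_pdivrMr //.
have -> : hsnorm (A *m v) / hsnorm v = hsnorm (A *m ((hsnorm v)^-1%:C *: v)).
  by rewrite -scalemxAr hsnormZ normc_real ger0_norm ?invr_ge0 ?(ltW vp) // mulrC.
apply: sup_ubound.
  exists (hsnorm A) => _ [w /= w1 <-]; apply: (le_trans (hsnormM_le _ _)).
  by rewrite ler_piMr // hsnorm_ge0.
exists ((hsnorm v)^-1%:C *: v) => //=.
by rewrite hsnormZ normc_real ger0_norm ?invr_ge0 ?(ltW vp) // mulVf.
Qed.

Lemma hsnorm_columns m n (A : 'M[C]_(m, n)) :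
  hsnorm A ^+ 2 = \sum_j hsnorm (col j A) ^+ 2.
Proof.
rewrite hsnorm_sqr exchange_big; apply: eq_bigr => j _; rewrite hsnorm_sqr.
by apply: eq_bigr => i _; rewrite big_ord1 mxE.
Qed.

(** The operator norm acts on each column separately, and squared column norms add up. *)
Lemma hsnorm_opnorm_le d n (A : 'M[C]_d) (B : 'M[C]_(d, n)) (c : R) :
  0 <= c -> opnorm A <= c -> hsnorm (A *m B) <= c * hsnorm B.
Proof.
move=> c0 Ac; rewrite -(ler_pXn2r (n := 2)) ?nnegrE ?mulr_ge0 ?hsnorm_ge0 //.
rewrite exprMn !hsnorm_columns mulr_sumr; apply: ler_sum => j _.
rewrite -exprMn ler_pXn2r ?nnegrE ?mulr_ge0 ?hsnorm_ge0 //.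
rewrite colE -mulmxA -colE; apply: (le_trans (opnorm_vec _ _)).
by rewrite ler_wpM2r // hsnorm_ge0.
Qed.

End OperatorNorm.

Lemma continuous_powR_pos (R : realType) (p b : R) : 0 < b ->
  {for b, continuous (fun x : R => x `^ p)}.
Proof.
move=> b0; apply/differentiable_continuous/derivable1_diffP.
by apply: derivable_powR; rewrite in_itv /= b0.
Qed.

(** * Passage to the limit in weighted sums *)

Section LimitOfSums.
Context {R : realType} {n m : nat} {G : ptopGroupType} {LG : lie_group R n G}.
Context {K : set G} {M : ptopologicalType} {I : choiceType}.
Variables (Gh : class_one_dual R K I).
Local Notation C := R[i].
Local Notation rdim := (rdim Gh).
Local Notation kdim := (kdim Gh).
Local Notation idx i := ('I_(rdim i) * 'I_(rdim i))%type.

Lemma bsize_cvg i (S : nat -> idx i -> C) (z : idx i -> C) :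
  (forall rs, inK rs -> (fun N => normc (z rs - S N rs)) @ \oo --> 0) ->
  (fun N => bsize (S N)) @ \oo --> bsize z.
Proof.
move=> cv; apply: cvgM; last exact: cvg_cst.
have cvn rs : inK rs -> (fun N => normc (S N rs)) @ \oo --> normc (z rs).
  move=> sk; apply/cvgrPdist_le => e e0.
  have /cvgrPdist_le/(_ e e0) := cv rs sk; apply: filterS => N.
  rewrite sub0r normrN => h; apply: le_trans h; rewrite [leRHS]ger0_norm ?normc_ge0 //.
  have h1 := normcD_le (z rs - S N rs) (S N rs); rewrite subrK in h1.
  have h2 := normcD_le (S N rs - z rs) (z rs); rewrite subrK -opprB normcN in h2.
  by rewrite ler_norml; apply/andP; split; lra.
suff cvs : (fun N => \sum_(rs | inK rs) normc (S N rs) ^+ 2) @ \oo --> \sum_(rs | inK rs) normc (z rs) ^+ 2.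
  exact: (cvg_comp _ _ cvs (@sqrt_continuous R _)).
elim: (index_enum _) => [|rs s IH].
  by rewrite big_nil; under eq_fun do rewrite big_nil; exact: cvg_cst.
rewrite big_cons; under eq_fun do rewrite big_cons.
case sk: (inK rs) => //; apply: cvgD => //.
by apply: cvgM; exact: cvn.
Qed.

Lemma weighted_sum_le_limit (p D : R) (s : seq I) (b : nat -> I -> R) (b0 : I -> R) :
  0 < p -> (forall i, 0 <= b0 i) -> (forall N i, 0 <= b N i) ->
  (forall i, (fun N => b N i) @ \oo --> b0 i) ->
  (forall N, \sum_(i <- s) weight Gh i * b N i `^ p <= D) ->
  \sum_(i <- s) weight Gh i * b0 i `^ p <= D.
Proof.
move=> p0 b00 bN cv le.
(* Terms with limit 0 contribute nothing to the limit sum; dropping them leaves only points where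
   [continuous_powR_pos] applies. *)
have -> : \sum_(i <- s) weight Gh i * b0 i `^ p = \sum_(i <- s | 0 < b0 i) weight Gh i * b0 i `^ p.
  rewrite [RHS]big_mkcond; apply: eq_bigr => i _; case: ltP => // bi.
  by rewrite (_ : b0 i = 0) ?powR0 ?mulr0 ?gt_eqF //; apply/eqP; rewrite eq_le bi b00.
have cvs : (fun N => \sum_(i <- s | 0 < b0 i) weight Gh i * b N i `^ p) @ \oo -->
    \sum_(i <- s | 0 < b0 i) weight Gh i * b0 i `^ p.
  elim: s {le} => [|i s IH].
    by rewrite big_nil; under eq_fun do rewrite big_nil; exact: cvg_cst.
  rewrite big_cons; under eq_fun do rewrite big_cons.
  have [bi|//] := ltP 0 (b0 i).
  apply: cvgD => //; apply: cvgM; first exact: cvg_cst.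
  exact: (cvg_comp _ _ (cv i) (continuous_powR_pos bi)).
rewrite -(cvg_lim _ cvs) //; apply: limr_le; first by apply/cvg_ex; eexists; exact: cvs.
apply: nearW => N; apply: le_trans (le N); rewrite big_mkcond; apply: ler_sum => i _.
by case: ifP => // _; rewrite mulr_ge0 ?powR_ge0 // weight_ge0.
Qed.

End LimitOfSums.

Section DualNorm.
Context {R : realType} {d : measure_display} {T : measurableType d}.
Variables (P : probability T R) (p : R).
Hypothesis p0 : 0 < p.
Local Notation C := R[i].

Lemma bmeas_Lpnorm (f : T -> C) : bmeas f ->
  (Lpnorm P p f `^ p)%E = (\int[P]_x (normc (f x) `^ p))%R%:E.
Proof.
move=> bf; rewrite -integral_powR_Lpnorm // /Rintegral fineK //.
apply: integrable_fin_num => //; exact: (bmeas_powR_integrable P (ltW p0) bf).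
Qed.

Lemma bmeas_Lp (f : T -> C) : bmeas f -> Lp P p f.
Proof.
move=> bf; split; first by case: bf.
have h : (Lpnorm P p f `^ p < +oo)%E by rewrite bmeas_Lpnorm // ltry.
by move/lty_poweRy: h; apply; rewrite gt_eqF.
Qed.

Lemma bmeas_Lpnorm_le1 (f : T -> C) : bmeas f ->
  (\int[P]_x (normc (f x) `^ p))%R <= 1 -> (Lpnorm P p f <= 1)%E.
Proof.
move=> bf f1; rewrite -[leLHS]poweRe1 ?Lnorm_ge0 // -[1%R in leLHS](mulfV (x := p)) ?gt_eqF //.
rewrite poweRrM bmeas_Lpnorm // poweR_EFin lee_fin.
apply: (@le_trans _ _ (1 `^ p^-1)); last by rewrite powR1.
by apply: ge0_ler_powR; rewrite ?nnegrE ?invr_ge0 ?(ltW p0) // Rintegral_ge0 // => x _; exact: powR_ge0.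
Qed.

Lemma dual_norm_le (e : (T -> C) -> C) f : bmeas f ->
  (\int[P]_x (normc (f x) `^ p))%R <= 1 -> ((normc (e f))%:E <= dual_norm P p e)%E.
Proof.
move=> bf f1; apply: ereal_sup_ubound; exists f => //; split; first exact: bmeas_Lp.
exact: bmeas_Lpnorm_le1.
Qed.

Lemma dual_norm_ge0 (e : (T -> C) -> C) : (0 <= dual_norm P p e)%E.
Proof.
apply: (@le_trans _ _ (normc (e (fun=> 0)))%:E); first by rewrite lee_fin normc_ge0.
apply: dual_norm_le; first exact: bmeas_cst.
under eq_Rintegral do rewrite normc0 powR0 ?gt_eqF //.
by rewrite /Rintegral integral0.
Qed.

Lemma dual_norm_fineK (e : (T -> C) -> C) : Lp_dual P p e ->
  (fine (dual_norm P p e))%:E = dual_norm P p e.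
Proof. by move=> [_ ef]; rewrite fineK // ge0_fin_numE ?dual_norm_ge0. Qed.

End DualNorm.

(** * Reading the symbol off the operator *)

Section Symbol.
Context {R : realType} {n m : nat} {G : ptopGroupType} {LG : lie_group R n G}.
Context {K : set G} {M : ptopologicalType} {I : choiceType}.
Variables (H : homogeneous m LG K M) (Gh : class_one_dual R K I).
Hypothesis G_compact : compact [set: G].
Variables (mu : probability (borel G) R) (nu : probability (borel M) R).
Hypothesis mu_haar : is_haar mu.
Local Notation C := R[i].
Local Notation rdim := (rdim Gh).
Local Notation kdim := (kdim Gh).
Local Notation coef := (coef H (Gh := Gh)).
Local Notation idx i := ('I_(rdim i) * 'I_(rdim i))%type.

Lemma partial_sum_coef (B : forall i, 'M[C]_(rdim i)) i (rs : idx i) (A : {fset I}) :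
  inK rs -> i \in A ->
  summability.partial_sum
    (fun j => (rdim j)%:R * \tr (B j *m fourier H mu Gh (coef rs) j)) A = B i rs.1 rs.2.
Proof.
move=> sk iA; rewrite /summability.partial_sum.
rewrite -(big_seq_fsetE _ A xpredT (fun j => (rdim j)%:R * \tr (B j *m fourier H mu Gh (coef rs) j))).
rewrite (bigD1_seq i) ?fset_uniq //= big1; last first.
  move=> j ji; rewrite (fourier_coef_ne H G_compact mu_haar ji sk) mulmx0.
  by rewrite mxtrace0 mulr0.
rewrite addr0 (fourier_coef_same H G_compact mu_haar sk) -scalemxAr mxtraceZ mulrA.
have d0 : (rdim i)%:R != 0 :> C by rewrite pnatr_eq0 -lt0n rdim_gt0.
rewrite mulfV // mul1r /mxtrace (bigD1 rs.1) //= big1 => [|k kr].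
  rewrite addr0 mxE (bigD1 rs.2) //= mxE !eqxx mulr1 big1 ?addr0 // => l lr.
  by rewrite mxE (negPf lr) mulr0.
rewrite mxE big1 // => l _; rewrite mxE (negPf kr) andbF mulr0 //.
Qed.

(** On a coefficient the series has a single nonzero term, so its partial sums are constant on all
    finite sets containing [i], and uniqueness of limits identifies the value. *)
Lemma fio_coef Phi a F i (rs : idx i) : is_fio H mu nu (Gh := Gh) Phi a F -> inK rs ->
  {ae nu, forall x : borel M, F (coef rs) x = (Phi x i *m a x i) rs.1 rs.2}.
Proof.
move=> hF sk; apply: filterS (hF _ (coef_smooth H G_compact mu_haar sk)) => x cv.
have pF := @summability.totally_filter I.
have cv' : summability.partial_sum
   (fun j => (rdim j)%:R * \tr (Phi x j *m a x j *m fourier H mu Gh (coef rs) j))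
   @ summability.totally --> ((Phi x i *m a x i) rs.1 rs.2 : C^o).
  apply: (@cvg_near_cst _ (C^o : topologicalType) _ _ _ _).
  exists [fset i]%fset => // A /= iA; apply: (partial_sum_coef (fun j => Phi x j *m a x j)) => //.
  by apply: (fsubsetP iA); rewrite inE.
exact: (cvg_unique (@norm_hausdorff _ (C^o)) cv cv').
Qed.

(** Multiplication on the left keeps the columns beyond [kdim i] zero, so [bsize], which sees only
    the first columns, loses nothing. *)
Lemma kblock_hsnorm (A B : forall i, 'M[C]_(rdim i)) i :
  (forall r s : 'I_(rdim i), (kdim i <= s)%N -> B i r s = 0) ->
  hsnorm (A i *m B i) ^+ 2 = (kdim i)%:R * bsize (fun rs : idx i => (A i *m B i) rs.1 rs.2) ^+ 2.
Proof.
move=> B0; rewrite hsnorm_sqr pair_big -bsize_sqr [RHS]big_mkcond /=.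
apply: eq_bigr => -[r s] _; rewrite /inK /=; case: ltnP => // ks.
rewrite mxE big1 ?normc0 ?expr0n // => l _; by rewrite B0 // mulr0.
Qed.

(** Undoing [A i] costs [c], and |A B|_HS = sqrt k times the block size. The powers of k combine by
    p (1/p - 1/2) + p/2 = 1 into the weight d k. *)
Lemma symbol_term_le (p c : R) (A B : forall i, 'M[C]_(rdim i)) i :
  0 < p -> 0 <= c -> A i \in unitmx -> opnorm (invmx (A i)) <= c ->
  (forall r s : 'I_(rdim i), (kdim i <= s)%N -> B i r s = 0) ->
  (rdim i)%:R * (kdim i)%:R `^ (p * (p^-1 - 2^-1)) * hsnorm (B i) `^ p <=
  c `^ p * (weight Gh i * bsize (fun rs : idx i => (A i *m B i) rs.1 rs.2) `^ p).
Proof.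
move=> p0 c0 Au Ac B0; set b := bsize _.
have k0 : 0 < (kdim i)%:R :> R by rewrite ltr0n kdim_gt0.
have b0 : 0 <= b by exact: bsize_ge0.
have k2 : ((kdim i)%:R `^ 2^-1) ^+ 2 = (kdim i)%:R :> R.
  by rewrite -powR_mulrn ?powR_ge0 // -powRrM mulVf // powRr1 // ltW.
have hAB : hsnorm (A i *m B i) = (kdim i)%:R `^ 2^-1 * b.
  apply/eqP; rewrite -(@eqrXn2 _ 2) ?hsnorm_ge0 ?mulr_ge0 ?powR_ge0 //.
  by rewrite kblock_hsnorm // -/b [eqbRHS]exprMn k2.
have hB : hsnorm (B i) <= c * ((kdim i)%:R `^ 2^-1 * b).
  by rewrite -hAB -{1}[B i](mulKmx Au) hsnorm_opnorm_le.
have hBp : hsnorm (B i) `^ p <= c `^ p * ((kdim i)%:R `^ (p / 2) * b `^ p).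
  apply: (@le_trans _ _ ((c * ((kdim i)%:R `^ 2^-1 * b)) `^ p)).
    by apply: ge0_ler_powR; rewrite ?nnegrE ?(ltW p0) ?hsnorm_ge0 ?mulr_ge0 ?powR_ge0.
  by rewrite !powRM ?mulr_ge0 ?powR_ge0 // -powRrM [2^-1 * p]mulrC.
apply: (@le_trans _ _ ((rdim i)%:R * (kdim i)%:R `^ (p * (p^-1 - 2^-1)) *
   (c `^ p * ((kdim i)%:R `^ (p / 2) * b `^ p)))).
  by rewrite ler_wpM2l // mulr_ge0 ?powR_ge0.
have -> : (rdim i)%:R * (kdim i)%:R `^ (p * (p^-1 - 2^-1)) *
   (c `^ p * ((kdim i)%:R `^ (p / 2) * b `^ p)) =
   c `^ p * ((rdim i)%:R * ((kdim i)%:R `^ (p * (p^-1 - 2^-1)) * (kdim i)%:R `^ (p / 2)) * b `^ p) by ring.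
have e1 : p * (p^-1 - 2^-1) + p / 2 = 1 by rewrite mulrBr mulfV ?gt_eqF // subrK.
by rewrite -powRD e1 ?oner_eq0 // powRr1 // ltW.
Qed.

End Symbol.

(** * Bounds at a fixed point of M *)

Section PointwiseBound.
Context {R : realType} {n m : nat} {G : ptopGroupType} {LG : lie_group R n G}.
Context {K : set G} {M : ptopologicalType} {I : choiceType}.
Variables (H : homogeneous m LG K M) (Gh : class_one_dual R K I).
Hypothesis G_compact : compact [set: G].
Variables (nu : probability (borel M) R) (nu_inv : is_invariant (act H) nu).
Local Notation C := R[i].
Local Notation rdim := (rdim Gh).
Local Notation coef := (coef H (Gh := Gh)).
Local Notation idx i := ('I_(rdim i) * 'I_(rdim i))%type.

Lemma normc_coef_le1 i (rs : idx i) x : normc (coef rs x) <= 1.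
Proof.
rewrite -(ler_pXn2r (n := 2)) ?nnegrE ?normc_ge0 // expr1n.
case: rs => r s; rewrite -(coef_column_norm H s x) (bigD1 r) //= lerDl.
by apply: sumr_ge0 => k _; exact: sqr_ge0.
Qed.

Lemma coef_powR_integral_le1 i (rs : idx i) (p : R) : 0 <= p -> inK rs ->
  (\int[nu]_x (normc (coef rs x) `^ p))%R <= 1.
Proof.
move=> p0 sk; have bc := coef_bmeas H G_compact sk.
have -> : 1 = (\int[nu]_(x in setT) (cst 1 : borel M -> R) x)%R.
  rewrite Rintegral_cst // mul1r; exact/esym/(f_equal fine (probability_setT nu)).
apply: le_Rintegral => //.
- exact: (bmeas_powR_integrable nu p0 bc).
- by apply: finite_measure_integrable_cst.
- move=> x _ /=; apply: (@le_trans _ _ (1 `^ p)); last by rewrite powR1.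
  by apply: ge0_ler_powR; rewrite ?nnegrE ?normc_ge0 // normc_coef_le1.
Qed.

Variables (p : R) (e : nat -> (borel M -> C) -> C) (eps : nat -> R).
Hypothesis p2 : 2 <= p.
Hypothesis e_lin : forall k (c : C) f g, bmeas f -> bmeas g ->
  e k (fun x => c * f x + g x) = c * e k f + e k g.
Hypothesis e_le : forall k f, bmeas f ->
  (\int[nu]_x (normc (f x) `^ p))%R <= 1 -> normc (e k f) <= eps k.

(** At a fixed point the scalars [y k] turn each partial sum into a functional of norm at most [D],
    to which [dual_HausdorffYoung] applies uniformly in the number of terms. It remains to let that
    number grow. *)
Lemma nuclear_pointwise_bound (y : nat -> C) (D : R) (z : forall i, idx i -> C) (s : seq I) :
  (forall k, 0 <= eps k) ->
  (forall N : nat, \sum_(0 <= k < N) eps k * normc (y k) <= D) ->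
  (forall i (rs : idx i), inK rs -> forall N (d : R), 0 < d ->
     exists2 N' : nat, (N <= N')%N &
       normc (z i rs - \sum_(0 <= k < N') e k (coef rs) * y k) < d) ->
  uniq s -> \sum_(i <- s) weight Gh i * bsize (z i) `^ p <= HYconst p * D `^ p.
Proof.
move=> eps0 YD zS us; have p0 : 0 < p by exact: lt_le_trans p2.
pose Y (N : nat) := \sum_(0 <= k < N) eps k * normc (y k).
have YS N N' : (N <= N')%N -> Y N' = Y N + \sum_(N <= k < N') eps k * normc (y k).
  by move=> NN'; rewrite /Y (@big_cat_nat _ _ _ N).
have ndY : nondecreasing_seq Y.
  by move=> N N' NN'; rewrite (YS _ _ NN') lerDl sumr_ge0 // => k _; rewrite mulr_ge0 ?normc_ge0.
have ubY : has_ubound (range Y) by exists D => _ [N _ <-]; exact: YD.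
have cvY := nondecreasing_cvgn ndY ubY.
have YL N : Y N <= sup (range Y).
  by apply: sup_ubound => //; exists N.
pose S N i (rs : idx i) := \sum_(0 <= k < N) e k (coef rs) * y k.
have Sdiff N N' i (rs : idx i) : inK rs -> (N <= N')%N ->
    normc (S N' i rs - S N i rs) <= Y N' - Y N.
  move=> sk NN'; rewrite /S (@big_cat_nat _ _ _ N 0 N') //= addrAC subrr add0r (YS _ _ NN') [leRHS]addrAC subrr add0r.
  apply: (le_trans (normc_sum _ _ _)); apply: ler_sum => k _.
  rewrite normcM ler_wpM2r ?normc_ge0 // e_le //; first exact: coef_bmeas.
  by apply: coef_powR_integral_le1 => //; exact: ltW.
(* Closeness infinitely often becomes convergence: from any later index where the sum is within [d]
   of [z], the way back to [N] costs at most the tail of [Y]. *)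
have zSY N i (rs : idx i) : inK rs -> normc (z i rs - S N i rs) <= sup (range Y) - Y N.
  move=> sk; apply/ler_addgt0Pr => d d0; have [N' NN' zN'] := zS i rs sk N d d0.
  have -> : z i rs - S N i rs = (z i rs - S N' i rs) + (S N' i rs - S N i rs) by rewrite addrA subrK.
  apply: (le_trans (normcD_le _ _)); have h1 := Sdiff N N' i rs sk NN'; have h2 := YL N'.
  rewrite -/(S N' i rs) in zN'; lra.
have cvL : (fun N => sup (range Y) - Y N) @ \oo --> 0.
  by rewrite -[0](subrr (sup (range Y))); apply: cvgB; [exact: cvg_cst|exact: cvY].
apply: (weighted_sum_le_limit (Gh := Gh) (b := fun N i => bsize (S N i)) (b0 := fun i => bsize (z i))) => //.
- by move=> i; exact: bsize_ge0.
- by move=> N i; exact: bsize_ge0.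
- move=> i; apply: bsize_cvg => rs sk.
  apply: (squeeze_cvgr _ _ cvL); last exact: cvg_cst.
  by apply: nearW => N; rewrite normc_ge0 /= zSY.
- move=> N; pose f (g : borel M -> C) := \sum_(0 <= k < N) e k g * y k.
  apply: (dual_HausdorffYoung Gh G_compact nu_inv (e := f)) => //.
    move=> c g h bg bh; rewrite /f mulr_sumr -big_split; apply: eq_bigr => k _ /=.
    by rewrite e_lin // mulrDl mulrA.
  move=> g bg g1; apply: (le_trans (normc_sum _ _ _)); apply: le_trans (YD N).
  by apply: ler_sum => k _; rewrite normcM ler_wpM2r ?normc_ge0 // e_le.
Qed.

End PointwiseBound.

Section PointwiseSymbol.
Context {R : realType} {n m : nat} {G : ptopGroupType} {LG : lie_group R n G}.
Context {K : set G} {M : ptopologicalType} {I : choiceType}.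
Variables (Gh : class_one_dual R K I) (p1 p2 c B : R).
Hypotheses (p10 : 0 < p1) (p20 : 0 < p2) (c0 : 0 <= c) (B0 : 0 <= B).
Local Notation C := R[i].
Local Notation rdim := (rdim Gh).
Local Notation kdim := (kdim Gh).
Local Notation idx i := ('I_(rdim i) * 'I_(rdim i))%type.

Lemma symbol_esum_le (A S : forall i, 'M[C]_(rdim i)) (Z : \bar R) :
  (forall i, A i \in unitmx) -> (forall i, opnorm (invmx (A i)) <= c) ->
  (forall i (r s : 'I_(rdim i)), (kdim i <= s)%N -> S i r s = 0) ->
  (0 <= Z)%E -> (Z < +oo)%E ->
  (forall s, uniq s ->
    \sum_(i <- s) weight Gh i * bsize (fun rs : idx i => (A i *m S i) rs.1 rs.2) `^ p1 <=
    B * (fine Z `^ p2^-1) `^ p1) ->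
  ((\esum_(i in [set: I]) ((rdim i)%:R * (kdim i)%:R `^ (p1 * (p1^-1 - 2^-1))
      * hsnorm (S i) `^ p1)%:E) `^ (p2 / p1) <=
   ((c `^ p1 * B) `^ (p2 / p1))%:E * Z)%E.
Proof.
move=> Au Ac S0 Z0 Zfin le; set D := fine Z `^ p2^-1.
have t0 i : 0 <= (rdim i)%:R * (kdim i)%:R `^ (p1 * (p1^-1 - 2^-1)) * hsnorm (S i) `^ p1.
  by rewrite !mulr_ge0 ?powR_ge0.
have q0 : 0 <= p2 / p1 by rewrite divr_ge0 // ltW.
have es : (\esum_(i in [set: I]) ((rdim i)%:R * (kdim i)%:R `^ (p1 * (p1^-1 - 2^-1))
      * hsnorm (S i) `^ p1)%:E <= (c `^ p1 * (B * D `^ p1))%:E)%E.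
  apply: ge_ereal_sup => _ [X [finX _] <-].
  rewrite fsbig_finite //= sumEFin lee_fin.
  apply: (@le_trans _ _ (\sum_(i <- fset_set X) c `^ p1 *
      (weight Gh i * bsize (fun rs : idx i => (A i *m S i) rs.1 rs.2) `^ p1))).
    by apply: ler_sum => i _; apply: symbol_term_le => //; exact: S0.
  by rewrite -mulr_sumr ler_wpM2l ?powR_ge0 // le.
have esp : (0 <= \esum_(i in [set: I]) ((rdim i)%:R * (kdim i)%:R `^ (p1 * (p1^-1 - 2^-1))
      * hsnorm (S i) `^ p1)%:E)%E by apply: esum_ge0 => i _; rewrite lee_fin.
apply: (@le_trans _ _ (((c `^ p1 * (B * D `^ p1))%:E) `^ (p2 / p1))%E).
  by apply: gt0_ler_poweR => //; rewrite in_itv /= leey andbT // lee_fin !mulr_ge0 ?powR_ge0.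
rewrite poweR_EFin mulrA powRM ?mulr_ge0 ?powR_ge0 // -powRrM mulrCA mulfV ?gt_eqF // mulr1.
rewrite -powRrM mulVf ?gt_eqF // powRr1 ?fine_ge0 // EFinM fineK //.
by rewrite ge0_fin_numE.
Qed.

End PointwiseSymbol.

Theorem theorem4p3 (R : realType) (n m : nat) (G : ptopGroupType)
  (LG : lie_group R n G) (G_compact : compact [set: G])
  (K : set G) (K_subgroup : is_subgroup K) (K_closed : closed K)
  (M : ptopologicalType) (H : homogeneous m LG K M)
  (mu : probability (borel G) R) (mu_haar : is_haar mu)
  (nu : probability (borel M) R) (nu_inv : is_invariant (act H) nu)
  (I : choiceType) (Gh : class_one_dual R K I)
  (p1 p2 : R) (hp1 : 2 <= p1) (hp2 : 1 <= p2)
  (Phi a : M -> forall i : I, 'M[R[i]]_(rdim Gh i))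
  (hPhi : is_phase Phi) (ha : is_symbol a)
  (F : (M -> R[i]) -> (M -> R[i])) (hF : is_fio H mu nu Phi a F)
  (hPhi_inv : (inv_phase_norm Phi < +oo)%E)
  (F_nuclear : nuclear nu p1 p2
     [set phi | smooth_complex (hom_mfd H) phi] F) :
  (symbol_norm nu p1 p2 a < +oo)%E.
Proof.
have p10 : 0 < p1 by exact: lt_le_trans hp1.
have p20 : 0 < p2 by exact: lt_le_trans hp2.
case: F_nuclear => FLp [e [y [edual yLp Fcv efin]]].
pose eps k := fine (dual_norm nu p1 (e k)).
have epsE k : (eps k)%:E = dual_norm nu p1 (e k) by exact: dual_norm_fineK.
have eps0 k : 0 <= eps k by rewrite -lee_fin epsE dual_norm_ge0.
have e_le k (f : borel M -> R[i]) : bmeas f ->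
    (\int[nu]_x (normc (f x) `^ p1))%R <= 1 -> normc (e k f) <= eps k.
  by move=> bf f1; rewrite -lee_fin epsE; exact: dual_norm_le.
have e_lin k (c : R[i]) (f g : borel M -> R[i]) : bmeas f -> bmeas g ->
    e k (fun x => c * f x + g x) = c * e k f + e k g.
  by move=> bf bg; case: (edual k) => h _; apply: h; exact: bmeas_Lp.
have [|Z [mZ Z0 Zfin YZ]] := nuclear_majorant hp2 eps0 yLp.
  by under eq_eseriesr do rewrite epsE.
have cI := countable_dual Gh G_compact nu_inv.
have aeZ : {ae nu, forall x, (Z x < +oo)%E}.
  have iZ : nu.-integrable setT Z.
    apply/integrableP; split => //.
    by under eq_integral => x _ do rewrite gee0_abs ?Z0 //.
  apply: filterS (integrable_ae measurableT iZ) => x /(_ Logic.I) fx.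
  by rewrite -ge0_fin_numE.
(* Countability of [I] and finiteness of the set of index pairs gather all exceptional sets into one
   null set. *)
have aeF : {ae nu, forall (x : borel M) i (rs : 'I_(rdim Gh i) * 'I_(rdim Gh i)), inK rs ->
     F (coef H rs) x = (Phi x i *m a x i) rs.1 rs.2}.
  apply: ae_countable => // i; apply: ae_countable; first exact: countableP.
  move=> rs; have [sk|nsk] := boolP (inK rs); last by apply: aeW => x /negP.
  by apply: filterS (fio_coef G_compact mu_haar hF sk).
have aeS : {ae nu, forall (x : borel M) i (rs : 'I_(rdim Gh i) * 'I_(rdim Gh i)), inK rs ->
     forall N (d : R), 0 < d -> exists2 N' : nat, (N <= N')%N &
       normc (F (coef H rs) x - \sum_(0 <= k < N') e k (coef H rs) * y k x) < d}.
  apply: ae_countable => // i; apply: ae_countable; first exact: countableP.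
  move=> rs; have [sk|nsk] := boolP (inK rs); last by apply: aeW => x /negP.
  have cs := coef_smooth H G_compact mu_haar sk.
  have mF : Cmeasurable (F (coef H rs) : borel M -> R[i]) by case: (FLp _ cs).
  have mS N : Cmeasurable (fun x : borel M => \sum_(0 <= k < N) e k (coef H rs) * y k x).
    elim: N => [|N IH].
      by under eq_fun do rewrite big_geq //; case: (@bmeas_cst R _ (borel M) 0).
    under eq_fun do rewrite big_nat_recr //=.
    apply: CmeasurableD => //; apply: CmeasurableM; last by case: (yLp N).
    by case: (@bmeas_cst R _ (borel M) (e N (coef H rs))).
  apply: filterS (Lpnorm_liminf0 p20 mF mS (Fcv _ cs)) => x h _; exact: h.
(* The maximum gives [0 <= c] directly, with no appeal to an element of [I] or to the sign of
   [opnorm]. *)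
pose c := Num.max 0 (fine (inv_phase_norm Phi)).
have c0 : 0 <= c by rewrite le_max lexx.
have Phic x i : opnorm (invmx (Phi x i)) <= c.
  have h : ((opnorm (invmx (Phi x i)))%:E <= inv_phase_norm Phi)%E.
    by apply: ereal_sup_ubound; exists (x, i).
  rewrite le_max; apply/orP; right; rewrite -lee_fin fineK //.
  rewrite fin_numE; apply/andP; split; last by rewrite lt_eqF.
  by rewrite gt_eqF // (lt_le_trans _ h) // ltNyr.
apply: poweR_lty.
apply: (@le_lt_trans _ _ (\int[nu]_x (((c `^ p1 * HYconst p1) `^ (p2 / p1))%:E * Z x))%E); last first.
  rewrite ge0_integralZl_EFin ?powR_ge0 //.
  by rewrite lte_mul_pinfty ?lee_fin ?powR_ge0.
(* Only the majorant, a multiple of [Z], has to be shown measurable. *)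
apply: ae_le_integral => //.
- by move=> x; exact: poweR_ge0.
- by move=> x; rewrite mule_ge0 ?lee_fin ?powR_ge0.
- by apply: measurable_funeM.
apply: filterS3 aeZ aeF aeS => x Zx Fx Sx.
have HY0 : 0 <= HYconst p1 by exact/ltW/HYconst_gt0.
apply: (symbol_esum_le p10 p20 c0 HY0 (A := Phi x)) => //.
- by move=> i r s ks; case: ha => _; apply; rewrite ks orbT.
move=> s us.
apply: (nuclear_pointwise_bound G_compact nu_inv hp1 e_lin e_le (y := fun k => y k x)) => //.
(* [Z] majorizes the p2-th powers of the partial sums, so the sums themselves are at most
   Z^{1/p2}. *)
- move=> N; rewrite big_mkord.
  have Y0 : 0 <= \sum_(k < N) eps k * normc (y k x).
    by apply: sumr_ge0 => k _; rewrite mulr_ge0 ?normc_ge0.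
  have YN := YZ x N; rewrite -(@fineK _ (Z x)) ?lee_fin in YN; last by rewrite ge0_fin_numE.
  rewrite -[leLHS]powRr1 // -[1 in leLHS](mulfV (x := p2)) ?gt_eqF // powRrM.
  by apply: ge0_ler_powR; rewrite ?nnegrE ?invr_ge0 ?powR_ge0 ?fine_ge0 // ltW.
- by move=> i rs sk N d d0; rewrite -Fx //; exact: Sx.
Qed.
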